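(* Let $n\ge 3$, $\lambda\in(0,n)$, and assume that $\mu$ minimizes $\mathcal{E}_{\infty,\lambda}$ on $\mathcal{P}$. Then there exists a convex body $W\subset\mathbb{R}^n$ of constant width $1$ such that $$\begin{cases}\operatorname{supp}\mu\subset\partial W & \text{if }\lambda\in(0,n-2),\\ \operatorname{supp}\mu=\partial W & \text{if }\lambda=n-2,\\ \operatorname{supp}\mu=W & \text{if }\lambda\in(n-2,n).\end{cases}$$
   Context: $\mathcal{P}$ is the set of Borel measures $\mu$ on $\mathbb{R}^n$ with $\mu(\mathbb{R}^n)=1$. For $\mu\in\mathcal{P}$, $$\mathcal{E}_{\infty,\lambda}(\mu)=\begin{cases}\displaystyle\int_{\mathbb{R}^n}\int_{\mathbb{R}^n}|x-y|^{-\lambda}\,d\mu(x)\,d\mu(y) & \text{if } \operatorname{diam}(\operatorname{supp}\mu)\le 1,\\ +\infty & \text{otherwise,}\end{cases}$$ where $|x-y|^{-\lambda}=+\infty$ if $x=y$. A convex body is a compact convex set with non-empty interior; it has constant width $1$ if the distance between its two parallel supporting hyperplanes orthogonal to any given direction equals $1$. The set $W$ may depend on $\mu$ and on $\lambda$. *)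

(* Defs.v *)
From HB Require Import structures.
From mathcomp Require Import all_boot all_order all_algebra.
From mathcomp Require Import all_classical all_reals all_analysis.

Set Implicit Arguments.
Unset Strict Implicit.
Unset Printing Implicit Defensive.

Import Order.TTheory GRing.Theory Num.Theory.
Import numFieldNormedType.Exports.

Local Open Scope classical_set_scope.
Local Open Scope ring_scope.

Definition dotv (R : realType) (n : nat) (x y : 'rV[R]_n) : R :=
  \sum_(i < n) x 0 i * y 0 i.

(* The norm `|x| of the library on 'rV[R]_n is the sup norm; the Euclidean norm
   induces the same topology, hence the library's open sets, compact sets,
   interiors, closures and Borel sets of 'rV[R]_n are those of R^n. *)
Definition enorm (R : realType) (n : nat) (x : 'rV[R]_n) : R :=
  Num.sqrt (dotv x x).

Definition diam (R : realType) (n : nat) (A : set 'rV[R]_n) : \bar R :=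
  ereal_sup [set (enorm (x - y))%:E | x in A & y in A].

Definition set_dist (R : realType) (n : nat) (A B : set 'rV[R]_n) : R :=
  inf [set enorm (x - y) | x in A & y in B].

Definition boundary (T : topologicalType) (A : set T) : set T :=
  closure A `\` interior A.

Definition borelRn (R : realType) (n : nat) : measurableType _ :=
  g_sigma_algebraType (@open 'rV[R]_n).

Definition supp (R : realType) (n : nat) (mu : probability (borelRn R n) R)
    : set 'rV[R]_n :=
  [set x | forall U : set 'rV[R]_n, open U -> U x -> (0 < mu U)%E].

(* The case split is needed since 0 `^ (- lambda) = 0 for lambda != 0. *)
Definition riesz (R : realType) (n : nat) (lambda : R) (x y : 'rV[R]_n)
    : \bar R :=
  if x == y then +oo%E else (enorm (x - y) `^ (- lambda))%:E.

Definition energy (R : realType) (n : nat) (lambda : R)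
    (mu : probability (borelRn R n) R) : \bar R :=
  if (diam (supp mu) <= 1)%E
  then (\int[mu]_y \int[mu]_x riesz lambda x y)%E
  else +oo%E.

Definition minimizes_energy (R : realType) (n : nat) (lambda : R)
    (mu : probability (borelRn R n) R) : Prop :=
  forall nu : probability (borelRn R n) R,
    (energy lambda mu <= energy lambda nu)%E.

Definition convex_body (R : realType) (n : nat) (W : set 'rV[R]_n) : Prop :=
  [/\ compact W, convex_set W & interior W !=set0].

(* H is the supporting hyperplane of W with outer normal u. *)
Definition supporting_hyperplane (R : realType) (n : nat) (W : set 'rV[R]_n)
    (u : 'rV[R]_n) (H : set 'rV[R]_n) : Prop :=
  exists c : R, [/\ H = [set x | dotv u x = c], W `&` H !=set0
    & forall x, W x -> dotv u x <= c].

(* For u != 0 and a convex body W, the hyperplanes H1 and H2 below exist and are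
   unique: they are the two supporting hyperplanes of W orthogonal to u. *)
Definition constant_width (R : realType) (n : nat) (w : R) (W : set 'rV[R]_n)
    : Prop :=
  forall u : 'rV[R]_n, u != 0 -> exists H1 H2 : set 'rV[R]_n,
    [/\ supporting_hyperplane W u H1, supporting_hyperplane W (- u) H2
      & set_dist H1 H2 = w].

(* Main.v *)
(* Complete [supp mu], whose points are at mutual distance at most 1, to a maximal
   set [W] with this property. Such a [W] is the intersection of the unit balls
   about its points, hence a convex body of constant width 1. Every probability on
   [W] is a competitor, so with [U] the potential of [mu] and [E] the minimal
   energy, [U <= E] almost everywhere for [mu], and [U >= E] on [W] off [supp mu].

   For [lambda <= n - 2], the kernel being a mixture of Gaussians, convolving the
   part of [mu] in a small cube with a truncated Gaussian of matching variance
   lowers its potential there by a definite amount, up to a truncation error that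
   is smaller than any power of the side of the cube. If [supp mu] met the interior
   of [W], some cube of side of order [1/N] would carry a mass of order [N^-n], and
   this would contradict the minimality of [mu].

   For [lambda >= n - 2], the kernel is subharmonic off the diagonal and a maximum
   principle gives [U <= E] off [supp mu]. If [lambda > n - 2], then [U = E] at a
   point of [W] off [supp mu] contradicts strict subharmonicity. If
   [lambda = n - 2], a boundary point of [W] is at distance 1 from some [c] in [W];
   if it is off [supp mu], a small move towards [c] divides its distances to
   [supp mu] by at least a common factor larger than 1, and therefore [U < E] there. *)

Require Import Defs.
From HB Require Import structures.
From mathcomp Require Import all_boot all_order all_algebra.
From mathcomp Require Import all_classical all_reals all_analysis.
From mathcomp Require Import measurable_realfun ring lra.

Set Implicit Arguments.
Unset Strict Implicit.
Unset Printing Implicit Defensive.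

Import Order.TTheory GRing.Theory Num.Theory.
Import numFieldNormedType.Exports.

Local Open Scope classical_set_scope.
Local Open Scope ring_scope.

(** * The Euclidean norm *)

(** A competitor must live on a set of diameter at most 1 and have finite energy, which rules out
    point masses. The test measures are therefore [mu] conditioned on a set, or smears: convolutions
    with a Gaussian truncated to a box. The truncation keeps a smear inside [W], and [lambda < n]
    makes the smeared kernel bounded.

    At [lambda = n - 2] the kernel is harmonic off the diagonal, so the only gain that smearing
    guarantees is the interaction of the cube with itself. This gain is proportional to the mass of
    the cube, a power of [1/N], which is why the truncation error has to beat powers.

    For [lambda >= n - 2] the obstacle is that [U] need not be continuous and that [U <= E] is known
    only almost everywhere for [mu]: near [supp mu] nothing bounds [U] directly. The maximum
    principle is therefore run for the part of [mu] on a set [F] of almost full mass, where [U] is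
    at most [E + e] and small balls contribute uniformly little. Nothing is differentiated under the
    integral: the Laplacian is a second difference of step [h] with an error of order [h^4], and
    suprema are approached rather than attained. *)

Section euclidean.
Context {R : realType} {n : nat}.
Implicit Types (x y z : 'rV[R]_n) (a : R).

Lemma dotvC x y : dotv x y = dotv y x.
Proof. by apply: eq_bigr => i _; rewrite mulrC. Qed.

Lemma dotvDl x y z : dotv (x + y) z = dotv x z + dotv y z.
Proof. by rewrite /dotv -big_split; apply: eq_bigr => i _; rewrite mxE mulrDl. Qed.

Lemma dotvZl a x y : dotv (a *: x) y = a * dotv x y.
Proof. by rewrite /dotv mulr_sumr; apply: eq_bigr => i _; rewrite mxE mulrA. Qed.

Lemma dotvNl x y : dotv (- x) y = - dotv x y.
Proof. by rewrite -scaleN1r dotvZl mulN1r. Qed.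

Lemma dotvBl x y z : dotv (x - y) z = dotv x z - dotv y z.
Proof. by rewrite dotvDl dotvNl. Qed.

Lemma dotvDr x y z : dotv z (x + y) = dotv z x + dotv z y.
Proof. by rewrite !(dotvC z) dotvDl. Qed.

Lemma dotvZr a x y : dotv y (a *: x) = a * dotv y x.
Proof. by rewrite !(dotvC y) dotvZl. Qed.

Lemma dotvNr x y : dotv y (- x) = - dotv y x.
Proof. by rewrite !(dotvC y) dotvNl. Qed.

Lemma dotvBr x y z : dotv z (x - y) = dotv z x - dotv z y.
Proof. by rewrite !(dotvC z) dotvBl. Qed.

Definition dotvE := (dotvDl, dotvDr, dotvNl, dotvNr, dotvZl, dotvZr).

Lemma dotv_ge0 x : 0 <= dotv x x.
Proof. by apply: sumr_ge0 => i _; rewrite -expr2 sqr_ge0. Qed.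

Lemma enorm_ge0 x : 0 <= enorm x.
Proof. exact: sqrtr_ge0. Qed.

Lemma sqr_enorm x : enorm x ^+ 2 = dotv x x.
Proof. by rewrite sqr_sqrtr // dotv_ge0. Qed.

Lemma sqr_coord_le_dotv x i : x 0 i ^+ 2 <= dotv x x.
Proof.
rewrite /dotv (bigD1 i)//= -expr2 lerDl.
by apply: sumr_ge0 => j _; rewrite -expr2 sqr_ge0.
Qed.

Lemma coord_le_enorm x i : `|x 0 i| <= enorm x.
Proof.
by rewrite -(@ler_pXn2r _ 2)// ?nnegrE ?enorm_ge0// real_normK ?num_real//
   sqr_enorm sqr_coord_le_dotv.
Qed.

Lemma enorm_eq0 x : (enorm x == 0) = (x == 0).
Proof.
apply/eqP/eqP => [x0|->]; last first.
  by rewrite /enorm /dotv big1 ?sqrtr0// => i _; rewrite mxE mul0r.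
apply/rowP => i; rewrite mxE; apply/eqP; rewrite -normr_le0.
by rewrite -x0 coord_le_enorm.
Qed.

Lemma enorm0 : enorm (0 : 'rV[R]_n) = 0.
Proof. by apply/eqP; rewrite enorm_eq0. Qed.

Lemma enorm_gt0 x : (0 < enorm x) = (x != 0).
Proof. by rewrite lt_def enorm_ge0 andbT enorm_eq0. Qed.

Lemma enormN x : enorm (- x) = enorm x.
Proof. by rewrite /enorm dotvNl dotvNr opprK. Qed.

Lemma enormB x y : enorm (x - y) = enorm (y - x).
Proof. by rewrite -enormN opprB. Qed.

Lemma enormZ a x : enorm (a *: x) = `|a| * enorm x.
Proof.
by rewrite /enorm dotvZl dotvZr mulrA -expr2 sqrtrM ?sqr_ge0// sqrtr_sqr.
Qed.

Lemma enorm_le x a : 0 <= a -> (enorm x <= a) = (dotv x x <= a ^+ 2).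
Proof.
by move=> a0; rewrite -sqr_enorm ler_pXn2r// nnegrE enorm_ge0.
Qed.

Lemma le_enorm x a : 0 <= a -> (a <= enorm x) = (a ^+ 2 <= dotv x x).
Proof.
by move=> a0; rewrite -sqr_enorm ler_pXn2r// nnegrE enorm_ge0.
Qed.

Lemma lt_enorm x a : 0 <= a -> (a < enorm x) = (a ^+ 2 < dotv x x).
Proof. by move=> a0; rewrite !ltNge enorm_le. Qed.

Lemma cauchy_schwarz x y : dotv x y <= enorm x * enorm y.
Proof.
have [->|x0] := eqVneq x 0.
  by rewrite enorm0 mul0r /dotv big1// => i _; rewrite mxE mul0r.
have [->|y0] := eqVneq y 0.
  by rewrite enorm0 mulr0 /dotv big1// => i _; rewrite mxE mulr0.
have xp : 0 < enorm x by rewrite enorm_gt0.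
have yp : 0 < enorm y by rewrite enorm_gt0.
have := dotv_ge0 (enorm y *: x - enorm x *: y).
rewrite !dotvE -!sqr_enorm (dotvC y x) => H.
rewrite -(ler_pM2l (mulr_gt0 xp yp)).
by lra.
Qed.

Lemma dotv_step x (h : R) (i : 'I_n) : dotv (x + h *: delta_mx 0 i) (x + h *: delta_mx 0 i) =
  dotv x x + h ^+ 2 + 2 * h * x 0 i.
Proof.
have xi : dotv x (delta_mx 0 i) = x 0 i.
  rewrite /dotv (bigD1 i)//= big1 ?addr0 => [|j ji]; first by rewrite !mxE !eqxx/= mulr1.
  by rewrite !mxE (negPf ji) andbF mulr0.
have ii : dotv (delta_mx 0 i : 'rV[R]_n) (delta_mx 0 i) = 1.
  rewrite /dotv (bigD1 i)//= big1 ?addr0 => [|j ji]; first by rewrite !mxE !eqxx/= mulr1.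
  by rewrite !mxE (negPf ji) andbF mul0r.
by rewrite !dotvE [dotv (delta_mx _ _) x]dotvC xi ii; ring.
Qed.

Lemma enorm_delta (i : 'I_n) : enorm (delta_mx 0 i : 'rV[R]_n) = 1.
Proof.
rewrite /enorm -[delta_mx 0 i]scale1r -[1 *: _]add0r dotv_step mxE mulr0 addr0.
by rewrite /dotv big1 ?add0r ?expr1n ?sqrtr1// => j _; rewrite mxE mul0r.
Qed.

Lemma ler_enormD x y : enorm (x + y) <= enorm x + enorm y.
Proof.
rewrite enorm_le ?addr_ge0 ?enorm_ge0// !dotvE (dotvC y x) sqrrD !sqr_enorm.
by have := cauchy_schwarz x y; lra.
Qed.

Lemma enorm_triangle y x z : enorm (x - z) <= enorm (x - y) + enorm (y - z).
Proof. by apply: le_trans (ler_enormD _ _); rewrite addrA subrK. Qed.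

Lemma mx_norm_le_enorm x : `|x| <= enorm x.
Proof.
rewrite /Num.norm/= mx_normrE; apply/bigmax_leP; split; first exact: enorm_ge0.
by case=> i j _ /=; rewrite (ord1 i) coord_le_enorm.
Qed.

Lemma coord_le_mx_norm x i : `|x 0 i| <= `|x|.
Proof.
rewrite [leRHS]/Num.norm/= mx_normrE; apply/bigmax_geP; right => /=.
by exists (0, i).
Qed.

Lemma enorm_le_coord x a : (forall i, `|x 0 i| <= a) -> enorm x <= n%:R * a.
Proof.
move=> xa; have [n0|n0] := posnP n.
  have -> : x = 0 by apply/rowP => i; exfalso; move: (ltn_ord i); rewrite [X in (_ < X)%N]n0.
  by rewrite enorm0 n0 mul0r.
have a0 : 0 <= a by apply: le_trans (xa (Ordinal n0)).
rewrite enorm_le ?mulr_ge0// (@le_trans _ _ (\sum_(i < n) a ^+ 2))//.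
  apply: ler_sum => i _; rewrite -expr2 -real_normK ?num_real//.
  by rewrite ler_pXn2r ?nnegrE.
rewrite sumr_const card_ord -[leLHS]mulr_natl exprMn ler_wpM2r ?sqr_ge0//.
by rewrite expr2 -natrM ler_nat leq_pmulr.
Qed.

Lemma enorm_le_mx_norm x : enorm x <= n%:R * `|x|.
Proof. by apply: enorm_le_coord => i; exact: coord_le_mx_norm. Qed.

(** The balls of the library are those of the sup norm, which is at most the Euclidean norm and at
    least its [n]-th part. *)
Lemma nbhs_enormP x (A : set 'rV[R]_n) :
  nbhs x A <-> exists2 e, 0 < e & forall y, enorm (x - y) < e -> A y.
Proof.
split.
  move=> /nbhs_ballP[e /= e0 eA]; exists e => // y xy; apply: eA.
  by rewrite -ball_normE/=; apply: le_lt_trans xy; exact: mx_norm_le_enorm.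
(* [n.+1] instead of [n], which may be 0 here. *)
move=> [e e0 eA]; apply/nbhs_ballP; exists (e / n.+1%:R) => /=.
  by rewrite divr_gt0.
move=> y; rewrite -ball_normE/= => xy; apply: eA.
apply: le_lt_trans (enorm_le_mx_norm _) _.
move: xy; rewrite ltr_pdivlMr// => /le_lt_trans; apply.
by rewrite mulrC ler_wpM2l// ler_nat.
Qed.

Lemma continuous_enormB x : continuous (fun y : 'rV[R]_n => enorm (x - y)).
Proof.
move=> y; apply/(@cvgrPdist_lt _ R^o _ _ (nbhs_filter y)) => e e0; apply/nbhs_enormP; exists e => // z yz.
apply: le_lt_trans yz; rewrite ler_norml.
have := enorm_triangle y x z; have := enorm_triangle z x y.
by rewrite (enormB z y); lra.
Qed.

Lemma continuous_dotv u : continuous (dotv u : 'rV[R]_n -> R).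
Proof.
move=> y; apply/(@cvgrPdist_lt _ R^o _ _ (nbhs_filter y)) => e e0; apply/nbhs_enormP.
exists (e / (enorm u + 1)).
  by rewrite divr_gt0// ltr_wpDl// enorm_ge0.
move=> z yz; rewrite -dotvBr.
have up : 0 < enorm u + 1 by rewrite ltr_wpDl// enorm_ge0.
have H : enorm u * enorm (y - z) <= (enorm u + 1) * enorm (y - z).
  by rewrite ler_wpM2r ?enorm_ge0// lerDl.
move: yz; rewrite ltr_pdivlMr// mulrC; apply: le_lt_trans.
apply: le_trans H; rewrite ler_norml cauchy_schwarz andbT lerNl -dotvNr.
by apply: le_trans (cauchy_schwarz _ _) _; rewrite enormN.
Qed.

End euclidean.

(** * Maximal sets of diameter one *)

Section completion.
Context {R : realType} {n : nat}.
Implicit Types (x y z u p : 'rV[R]_n) (W K : set 'rV[R]_n).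

(** One equation holds both properties: left to right, the diameter is at most 1; right to left, no
    point can be added. *)
Definition unit_complete W : Prop :=
  W = [set x | forall y, W y -> enorm (x - y) <= 1].

Lemma ex_unit_complete K :
  (forall x y, K x -> K y -> enorm (x - y) <= 1) ->
  exists2 W, K `<=` W & unit_complete W.
Proof.
move=> K1.
(* Zorn's lemma is applied to the sets whose union with [K] has diameter at most 1, so that the
   maximal set is above [K] and the empty chain is no exception. *)
pose P A := forall x y, (K `|` A) x -> (K `|` A) y -> enorm (x - y) <= 1.
have [|A [PA maxA]] := @Zorn_bigcup _ P.
  move=> F FP totF x y [Kx|[B FB Bx]] [Ky|[C FC Cy]].
  - exact: K1.
  - by apply: (FP _ FC); [left|right].
  - by apply: (FP _ FB); [right|left].
  - have [BC|CB] := totF _ _ FB FC.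
    + by apply: (FP _ FC); right => //; exact: BC.
    + by apply: (FP _ FB); right => //; exact: CB.
exists (K `|` A); first by move=> x; left.
apply/seteqP; split => [x Wx y Wy|x Wx]; first exact: PA.
apply: contrapT => nWx.
apply: (maxA (x |` A)).
  split; first by move=> y; right.
  by move=> /(_ x (or_introl erefl)) Ax; apply: nWx; right.
have x0 y : (K `|` (x |` A)) y -> y = x \/ (K `|` A) y.
  by move=> [Ky|[->|Ay]]; [right; left|left|right; right].
move=> y z /x0[->|Wy] /x0[->|Wz]; last exact: PA.
- by rewrite subrr enorm0.
- exact: Wx.
- by rewrite enormB; exact: Wx.
Qed.

Lemma unit_complete_dist W x y : unit_complete W -> W x -> W y ->
  enorm (x - y) <= 1.
Proof. by move=> WE; rewrite {1}WE/= => + Wy; exact. Qed.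

Lemma unit_complete_in W x : unit_complete W ->
  (forall y, W y -> enorm (x - y) <= 1) -> W x.
Proof. by move=> WE xW; rewrite WE. Qed.

(** For an empty [W] the defining condition is vacuous and puts every point in [W]. *)
Lemma unit_complete_neq0 W : unit_complete W -> W !=set0.
Proof.
move=> cW; apply/set0P/eqP => W0.
by have := @unit_complete_in W 0 cW; rewrite W0; apply.
Qed.

Lemma unit_complete_closed W : unit_complete W -> closed W.
Proof.
move=> cW x; rewrite /closure/= => clx; apply: (unit_complete_in cW) => y Wy.
apply/ler_addgt0Pr => e e0.
have [|z [Wz xz]] := clx [set z | enorm (x - z) < e].
  by apply/nbhs_enormP; exists e.
apply: le_trans (enorm_triangle z _ _) _.
by rewrite addrC; apply: lerD; [exact: unit_complete_dist cW Wz Wy|exact: ltW].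
Qed.

Lemma unit_complete_compact W : unit_complete W -> compact W.
Proof.
move=> cW; have [y Wy] := unit_complete_neq0 cW.
apply: bounded_closed_compact; last exact: unit_complete_closed.
exists (enorm y + 1); split; first exact: num_real.
move=> M yM x Wx; apply: le_trans (mx_norm_le_enorm _) _.
apply: le_trans (ltW yM).
have := ler_enormD (x - y) y; rewrite subrK.
by have := unit_complete_dist cW Wx Wy; lra.
Qed.

Lemma unit_complete_convex W : unit_complete W -> convex_set W.
Proof.
move=> cW x y l; rewrite !inE => Wx Wy.
apply: (unit_complete_in cW) => z Wz.
change (enorm (l%:num *: x + (1 - l%:num) *: y - z) <= 1).
have a0 : 0 <= l%:num by rewrite ge0.
have a1 : l%:num <= 1 by rewrite le1.
set a := l%:num in a0 a1 *.
have -> : a *: x + (1 - a) *: y - z = a *: (x - z) + (1 - a) *: (y - z).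
  by apply/rowP => i; rewrite !mxE; ring.
apply: le_trans (ler_enormD _ _) _; rewrite !enormZ !ger0_norm ?subr_ge0//.
have xz := unit_complete_dist cW Wx Wz.
have yz := unit_complete_dist cW Wy Wz.
nra.
Qed.

(* Otherwise some [y] in [W] lies outside the unit ball about [p - u], which is
   tangent at [p] to the supporting hyperplane; the unit arcs joining [p] to [y]
   stay in [W] but leave the half-space, and the point [p + e (y - p) + e b u]
   below is close to such an arc. *)
Lemma unit_complete_opposite W u p : unit_complete W -> enorm u = 1 ->
  W p -> (forall x, W x -> dotv u x <= dotv u p) -> W (p - u).
Proof.
move=> cW u1 Wp pmax; apply: (unit_complete_in cW) => y0 Wy0.
rewrite leNgt; apply/negP => y0far.
have [y yE] : exists y, y = y0 - p by exists (y0 - p).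
have uy : dotv u y <= 0 by rewrite yE dotvBr subr_le0 pmax.
have uu : dotv u u = 1 by rewrite -sqr_enorm u1 expr1n.
have yu : 0 < dotv y y + 2 * dotv u y.
  have : 1 < dotv (p - u - y0) (p - u - y0).
    by rewrite -[ltLHS](expr1n _ 2) -lt_enorm.
  have -> : p - u - y0 = - (y + u) by rewrite yE; apply/rowP => i; rewrite !mxE; ring.
  by rewrite !dotvE (dotvC y u) uu; lra.
set q := dotv y y in yu.
have q1 : q <= 1.
  rewrite /q -[leRHS](expr1n _ 2) -enorm_le// yE; exact: unit_complete_dist cW Wy0 Wp.
set s := dotv u y in uy yu.
(* By [yu], [b] lies strictly between [- s] and [q / 2]. The first bound puts [z] beyond the
   supporting hyperplane. For the second, [(1 - e) |d|^2 + e |d + y|^2 <= 1] shows that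
   [|z - c|^2 - 1] is at most [e (- q + 2 b + e q + e b^2)], where [2 b - q = - (q + 2 s) / 2]
   outweighs [e q + e b^2 <= 2 e = (q + 2 s) / 4]. *)
have [b bE] : exists b, b = (q - 2 * s) / 4 by eexists.
have [e eE] : exists e, e = (q + 2 * s) / 8 by eexists.
have e0 : 0 < e by rewrite eE; lra.
have sb : 0 < b + s by rewrite bE; lra.
pose z := p + e *: y + (e * b) *: u.
suff /pmax : W z.
  rewrite /z !dotvE -/s uu mulr1 => H.
  by have := mulr_gt0 e0 sb; lra.
apply: (unit_complete_in cW) => c Wc.
have cp := unit_complete_dist cW Wp Wc.
have cy := unit_complete_dist cW Wy0 Wc.
have [d dE] : exists d, d = p - c by exists (p - c).
have cpE : dotv d d <= 1 by rewrite dE -[leRHS](expr1n _ 2) -enorm_le.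
have cyE : dotv (d + y) (d + y) <= 1.
  by rewrite dE yE -[leRHS](expr1n _ 2) -enorm_le// addrC addrA subrK.
have ud : dotv u d <= 1.
  by apply: le_trans (cauchy_schwarz _ _) _; rewrite u1 mul1r dE.
rewrite enorm_le// expr1n.
have -> : z - c = d + e *: y + (e * b) *: u.
  by rewrite /z dE; apply/rowP => i; rewrite !mxE; ring.
move: cyE; rewrite !dotvE uu (dotvC y d) (dotvC d u) (dotvC y u) -/q -/s.
set dy := dotv d y => cyE.
set f := dotv u d in ud *.
set g := dotv d d in cpE cyE *.
have e1 : e <= 1 / 8 by rewrite eE; lra.
have b1 : b <= 1 / 2 by rewrite bE; lra.
have b0 : 0 < b by lra.
have H1 : e * (g + dy + (dy + q)) <= e * 1 by rewrite ler_wpM2l// ltW.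
have H2 : (1 - e) * g <= (1 - e) * 1 by rewrite ler_wpM2l// subr_ge0; lra.
have H3 : e * b * f <= e * b * 1 by rewrite ler_wpM2l// mulr_ge0// ltW.
have H4 : e * (e * b) * s <= 0 by rewrite mulr_ge0_le0// !mulr_ge0// ltW.
suff : e * (- q + e * q + 2 * b + e * b * b) <= 0 by lra.
rewrite pmulr_rle0//.
have : e * q <= e * 1 by rewrite ler_wpM2l// ltW.
have : e * b * b <= e * 1.
  by rewrite -mulrA ler_wpM2l//; [rewrite ltW|nra].
rewrite bE eE; lra.
Qed.

Lemma unit_complete_support W u : unit_complete W -> enorm u = 1 ->
  exists p, [/\ W p, W (p - u) & forall x, W x -> dotv u x <= dotv u p].
Proof.
move=> cW u1.
have [] := @compact_EVT_max _ _ (dotv u) W (unit_complete_neq0 cW)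
  (unit_complete_compact cW).
  by apply: continuous_subspaceT; exact: continuous_dotv.
move=> p /set_mem Wp pmax; exists p.
have pmax' x : W x -> dotv u x <= dotv u p by move=> Wx; apply: pmax; rewrite inE.
by split => //; exact: unit_complete_opposite.
Qed.

(** The unit chord from [p] to [p - v] is normal to the two hyperplanes through its ends, which are
    thus at distance 1. The second one supports [W] because [W] has diameter at most 1. *)
Lemma unit_complete_width W : unit_complete W -> constant_width 1 W.
Proof.
move=> cW u u0.
have up : 0 < enorm u by rewrite enorm_gt0.
have [v vE] : exists v, v = (enorm u)^-1 *: u by eexists.
have v1 : enorm v = 1 by rewrite vE enormZ ger0_norm ?invr_ge0 ?enorm_ge0// mulVf// gt_eqF.
have uE : u = enorm u *: v by rewrite vE scalerA divff ?gt_eqF// scale1r.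
have [p [Wp Wpv pmax]] := unit_complete_support cW v1.
exists [set x | dotv u x = dotv u p], [set x | dotv (- u) x = dotv (- u) (p - v)].
have vv : dotv v v = 1 by rewrite -sqr_enorm v1 expr1n.
split.
- exists (dotv u p); split => //; first by exists p.
  by move=> x Wx; rewrite uE !dotvZl ler_pM2l// pmax.
- exists (dotv (- u) (p - v)); split => //; first by exists (p - v).
  move=> x Wx; rewrite !dotvNl lerN2 uE !dotvZl ler_pM2l//.
  have : dotv v (p - x) <= 1.
    apply: le_trans (cauchy_schwarz _ _) _; rewrite v1 mul1r.
    exact: unit_complete_dist cW Wp Wx.
  by rewrite !dotvE vv; lra.
- rewrite /set_dist; set S := [set _ | _ in _ & _ in _].
  have S1 : S 1.
    exists p => //; exists (p - v) => //.
    by rewrite opprB addrCA subrr addr0.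
  have lbS : lbound S 1.
    move=> _ [x /= xp [y yp <-]].
    have : dotv v (x - y) = 1.
      move: xp yp; rewrite uE -!scalerN !dotvZl !dotvNl.
      move=> /(mulfI (lt0r_neq0 up)) xp /(mulfI (lt0r_neq0 up)).
      by rewrite !dotvE vv xp; lra.
    by move=> <-; apply: le_trans (cauchy_schwarz _ _) _; rewrite v1 mul1r.
  apply/eqP; rewrite eq_le; apply/andP; split.
    by apply: ge_inf => //; exists 1.
  by apply: lb_le_inf => //; exists 1.
Qed.

(** By the parallelogram law the midpoint of a unit chord is within [sqrt (3/4) < 9/10] of every
    point of [W]; a displacement of [1/10] is then harmless, as [W] is complete. *)
Lemma unit_complete_interior W : (0 < n)%N -> unit_complete W ->
  exists c r, [/\ 0 < r & forall x, enorm (x - c) <= r -> W x].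
Proof.
move=> n0 cW; have [u uE] : exists u : 'rV[R]_n, u = delta_mx 0 (Ordinal n0) by eexists.
have u1 : enorm u = 1 by rewrite uE enorm_delta.
have [p [Wp Wpu _]] := unit_complete_support cW u1.
exists (p - 2^-1 *: u), (1 / 10); split; first by lra.
move=> x xc; apply: (unit_complete_in cW) => y Wy.
apply: le_trans (enorm_triangle (p - 2^-1 *: u) _ _) _.
suff : enorm (p - 2^-1 *: u - y) <= 9 / 10 by move: xc; lra.
rewrite enorm_le; last by lra.
have py : dotv (p - y) (p - y) <= 1.
  by rewrite -[leRHS](expr1n _ 2) -enorm_le//; exact: unit_complete_dist cW Wp Wy.
have puy : dotv (p - u - y) (p - u - y) <= 1.
  by rewrite -[leRHS](expr1n _ 2) -enorm_le//; exact: unit_complete_dist cW Wpu Wy.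
have uu : dotv u u = 1 by rewrite -sqr_enorm u1 expr1n.
move: py puy; rewrite !dotvE uu (dotvC p u) (dotvC p y) (dotvC y u).
lra.
Qed.

Lemma unit_complete_body W : (0 < n)%N -> unit_complete W -> convex_body W.
Proof.
move=> n0 cW; split; [exact: unit_complete_compact|exact: unit_complete_convex|].
have [c [r [r0 rW]]] := unit_complete_interior n0 cW.
exists c; apply/nbhs_enormP; exists r => // y yc; apply: rW.
by rewrite enormB ltW.
Qed.

(** If the farthest point of [W] were at distance less than 1 from [x], all points near [x] would be
    within 1 of [W], hence in [W]. *)
Lemma unit_complete_boundary W x : unit_complete W -> W x -> ~ interior W x ->
  exists2 c, W c & enorm (x - c) = 1.
Proof.
move=> cW Wx nWx.
have [] := @compact_EVT_max _ _ (fun y => enorm (x - y)) W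
  (unit_complete_neq0 cW) (unit_complete_compact cW).
  by apply: continuous_subspaceT; exact: continuous_enormB.
move=> c /set_mem Wc cmax; exists c => //.
apply/eqP; rewrite eq_le (unit_complete_dist cW Wx Wc)/= leNgt.
apply/negP => c1; apply: nWx; apply/nbhs_enormP.
exists (1 - enorm (x - c)); first by rewrite subr_gt0.
move=> z xz; apply: (unit_complete_in cW) => y Wy.
apply: le_trans (enorm_triangle x _ _) _.
rewrite (enormB z); have : enorm (x - y) <= enorm (x - c) by apply: cmax; rewrite inE.
by lra.
Qed.

End completion.

(** * Probabilities on the Borel sets of R^n *)

Section borel.
Context {R : realType} {n : nat}.
Local Notation T := (borelRn R n).

Lemma borel_open (U : set 'rV[R]_n) : open U -> measurable (U : set T).
Proof. by move=> oU; exact: sub_sigma_algebra. Qed.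

Lemma borel_closed (U : set 'rV[R]_n) : closed U -> measurable (U : set T).
Proof.
by move=> cU; rewrite -(setCK U); apply: measurableC; apply: borel_open; exact: closed_openC.
Qed.

(** A countable base of the topology. It reduces measurability into [borelRn] to coordinates, and
    makes the complement of a support a countable union of null sets. *)
Definition rat_box (ck : 'rV[rat]_n * nat) : set 'rV[R]_n :=
  [set y | forall i, `|y 0 i - ratr (ck.1 0 i)| < ck.2.+1%:R^-1].

Lemma rat_box_nbhs (U : set 'rV[R]_n) x : nbhs x U ->
  exists2 ck, rat_box ck x & rat_box ck `<=` U.
Proof.
move=> /nbhs_ballP[e /= e0 eU].
pose k := Num.truncn (2 * e^-1).
have ke : k.+1%:R^-1 < e / 2.
  rewrite -[ltRHS]invrK ltf_pV2 ?posrE ?invr_gt0 ?divr_gt0// invf_div.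
  exact: truncnS_gt.
have k0 : 0 < k.+1%:R^-1 :> R by rewrite invr_gt0.
set r : R := k.+1%:R^-1 in ke k0.
have /choice[q qP] : forall i, exists q : rat, `|x 0 i - ratr q| < r.
  move=> i.
  have H : x 0 i - r < x 0 i + r by lra.
  have [q] := rat_in_itvoo H; rewrite in_itv/= => /andP[q1 q2]; exists q.
  by rewrite ltr_norml; apply/andP; split; lra.
exists (\row_i q i, k); first by move=> i; rewrite mxE; exact: qP.
move=> y yk; apply: eU; split => // i j; rewrite /ball/= (ord1 i).
have := yk j; rewrite mxE/= -/r; have := qP j.
rewrite !ltr_norml => /andP[? ?] /andP[? ?]; apply/andP; split; lra.
Qed.

Lemma open_bigcup_rat_box (U : set 'rV[R]_n) : open U ->
  exists2 F : (set 'rV[R]_n)^nat, U = \bigcup_k F k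
    & forall k, F k = set0 \/ exists2 ck, F k = rat_box ck & rat_box ck `<=` U.
Proof.
move=> oU.
pose F (k : nat) := if @unpickle ('rV[rat]_n * nat)%type k is Some ck then
  [set x | rat_box ck x /\ rat_box ck `<=` U] else set0.
exists F => [|k]; last first.
  rewrite /F; case: unpickle => [ck|]; last by left.
  have [ckU|ckU] := pselect (rat_box ck `<=` U).
    by right; exists ck => //; apply/seteqP; split => x // [].
  by left; rewrite -subset0 => x [_ /ckU].
apply/seteqP; split => [x Ux|x [k _]].
  have [ck xck ckU] := rat_box_nbhs (open_nbhs_nbhs (conj oU Ux)).
  by exists (pickle ck) => //; rewrite /F pickleK.
by rewrite /F; case: unpickle => // ck [xck]; exact.
Qed.

Lemma measurable_coord i : measurable_fun setT (fun x : T => (x : 'rV[R]_n) 0 i).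
Proof.
apply: (measurability _ (RGenOpens.measurableE R)).
move=> _ [_ [a [b ->]] <-]; rewrite setTI.
have o : open ((fun x : 'rV[R]_n => x 0 i) @^-1` `]a, b[).
  have /continuousP := @coord_continuous R 1 n 0 i.
  by apply; exact: interval_open.
exact: borel_open o.
Qed.

Lemma measurable_preimage_box d (X : measurableType d) (f : X -> 'rV[R]_n) ck :
  (forall i, measurable_fun setT (fun x => f x 0 i)) ->
  measurable (f @^-1` rat_box ck).
Proof.
move=> mf.
have -> : f @^-1` rat_box ck = \bigcap_(i in [set: 'I_n]) ((fun x => f x 0 i) @^-1`
    `](ratr (ck.1 0 i) - ck.2.+1%:R^-1), (ratr (ck.1 0 i) + ck.2.+1%:R^-1)[).
  apply/seteqP; split => x H i.
    by move=> _ /=; rewrite in_itv/= -ltr_distlC distrC; exact: H.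
  by have := H i I; rewrite /= in_itv/= -ltr_distlC distrC.
apply: fin_bigcap_measurable => // i _; rewrite -[X in measurable X]setTI.
by apply: mf => //; exact: measurable_itv.
Qed.

Lemma measurable_fun_rV d (X : measurableType d) (f : X -> 'rV[R]_n) :
  (forall i, measurable_fun setT (fun x => f x 0 i)) ->
  measurable_fun setT (f : X -> T).
Proof.
move=> mf; apply: (@measurability _ _ X T setT f (@open 'rV[R]_n)) => //.
move=> _ [U oU <-]; have [F -> FE] := open_bigcup_rat_box oU.
rewrite setTI preimage_bigcup; apply: bigcupT_measurable => k.
by have [->|[ck -> _]] := FE k; [rewrite preimage_set0|exact: measurable_preimage_box].
Qed.

Lemma measurable_rat_box ck : measurable (rat_box ck : set T).
Proof. exact: (@measurable_preimage_box _ T id ck measurable_coord). Qed.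

Lemma closed_supp (mu : probability T R) : closed (supp mu).
Proof.
rewrite -[supp mu]setCK; apply: open_closedC; rewrite openE.
move=> x /existsNP[U /not_implyP[oU /not_implyP[Ux U0]]].
suff : nbhs x (~` supp mu) by [].
by apply: filterS (open_nbhs_nbhs (conj oU Ux)) => y Uy /(_ U oU Uy).
Qed.

(** Every point off the support has a null neighbourhood, hence lies in a null rational box, and
    there are countably many of these. *)
Lemma supp_setC (mu : probability T R) : mu (~` supp mu) = 0%E.
Proof.
pose F (k : nat) := if @unpickle ('rV[rat]_n * nat)%type k is Some ck then
  [set x | rat_box ck x /\ mu (rat_box ck) = 0%E] else set0.
have F0 k : mu.-negligible (F k).
  rewrite /F; case: unpickle => [ck|]; last exact: negligible_set0.
  have [ck0|ck0] := eqVneq (mu (rat_box ck)) 0%E.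
    have N : mu.-negligible (rat_box ck : set T).
      by apply/negligibleP => //; exact: measurable_rat_box.
    by apply: negligibleS N => x [].
  apply: negligibleS (negligible_set0 mu).
  by move=> x [_] /eqP; rewrite (negPf ck0).
apply/negligibleP; first by apply: borel_open; apply: closed_openC; exact: closed_supp.
apply: negligibleS (negligible_bigcup F0).
move=> x /existsNP[U /not_implyP[oU /not_implyP[Ux /negP U0]]].
have [ck xck ckU] := rat_box_nbhs (open_nbhs_nbhs (conj oU Ux)).
exists (pickle ck) => //; rewrite /F pickleK; split => //.
have H : (mu (rat_box ck) <= mu U)%E.
  by apply: le_measure => //; rewrite inE; [exact: measurable_rat_box|exact: borel_open].
by apply/eqP; rewrite eq_le measure_ge0 andbT (le_trans H)// leNgt.
Qed.

End borel.

(** * Constructions of probabilities, each known through its integrals *)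

Section probability_constructions.
Local Open Scope ereal_scope.
Context {R : realType}.

Lemma ge0_integral_mrestr d (X : measurableType d) (m : {measure set X -> \bar R})
    (D : set X) (mD : measurable D) (f : X -> \bar R) :
  measurable_fun setT f -> (forall x, 0 <= f x) ->
  \int[mrestr m mD]_x f x = \int[m]_(x in D) f x.
Proof.
move=> mf f0.
rewrite [LHS](ge0_negligible_integral (N := ~` D))//; first last.
- by rewrite /= /mrestr setICl measure0.
- exact: measurableC.
rewrite setTD setCK; apply: eq_measure_integral => A mA AD.
by rewrite /= /mrestr setIidl.
Qed.

(** Integrals of non-negative measurable functions are all that is ever used of the measures
    constructed here. With [c = 1] the lemma turns a measure of total mass 1 into a probability. *)
Lemma ex_probability_normalize d (X : measurableType d)
    (m : {measure set X -> \bar R}) (c : R) : (0 < c)%R -> m setT = c%:E ->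
  exists M : probability X R, forall f : X -> \bar R,
    measurable_fun setT f -> (forall x, 0 <= f x) ->
    \int[M]_x f x = c^-1%:E * \int[m]_x f x.
Proof.
move=> c0 mc.
(* The Dirac mass is the default of [mnormalize] for total mass 0 or infinity, excluded by [c0] and
   [mc]. *)
exists (mnormalize m (dirac point : probability X R)) => f mf f0.
have ci : (0 <= c^-1)%R by rewrite invr_ge0 ltW.
have := ge0_integral_mscale m measurableT (NngNum ci) mf (fun x _ => f0 x).
move=> /= <-; apply: eq_measure_integral => A mA _.
by rewrite /= /mnormalize mc eqe gt_eqF//= /mscale/= muleC.
Qed.

Lemma ex_probability_cond d (X : measurableType d) (P : probability X R)
    (A : set X) (c : R) : measurable A -> (0 < c)%R -> P A = c%:E ->
  exists M : probability X R, forall f : X -> \bar R,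
    measurable_fun setT f -> (forall x, 0 <= f x) ->
    \int[M]_x f x = c^-1%:E * \int[P]_(x in A) f x.
Proof.
move=> mA c0 PA.
have [|M MP] := @ex_probability_normalize _ X (mrestr P mA) c c0.
  by rewrite /= /mrestr/= setTI.
by exists M => f mf f0; rewrite MP// ge0_integral_mrestr.
Qed.

Lemma ex_probability_mix d (X : measurableType d) (P Q : probability X R) (t : R) :
  (0 <= t <= 1)%R ->
  exists M : probability X R, forall f : X -> \bar R,
    measurable_fun setT f -> (forall x, 0 <= f x) ->
    \int[M]_x f x = (1 - t)%:E * \int[P]_x f x + t%:E * \int[Q]_x f x.
Proof.
move=> /andP[t0 t1]; have t1' : (0 <= 1 - t)%R by rewrite subr_ge0.
pose m : {measure set X -> \bar R} :=
  measure_add (mscale (NngNum t1') P) (mscale (NngNum t0) Q).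
have [|M MP] := @ex_probability_normalize _ X m 1%R ltr01.
  have -> : m setT = mscale (NngNum t1') P setT + mscale (NngNum t0) Q setT by exact: measure_addE.
  rewrite /mscale/=.
  by rewrite [P _]probability_setT [Q _]probability_setT !mule1 -EFinD subrK.
exists M => f mf f0; rewrite MP// invr1 mul1e ge0_integral_measure_add//.
by rewrite !ge0_integral_mscale.
Qed.

Lemma ex_measure_pushforward d1 d2 (X : measurableType d1) (Z : measurableType d2)
    (m : {measure set X -> \bar R}) (phi : X -> Z) : measurable_fun setT phi ->
  exists2 M : {measure set Z -> \bar R}, M setT = m setT & forall f : Z -> \bar R,
    measurable_fun setT f -> (forall z, 0 <= f z) ->
    \int[M]_z f z = \int[m]_x f (phi x).
Proof.
move=> mphi.
exists (measure_function_pushforward__canonical__measure_function_Measure m mphi).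
  by rewrite /= /pushforward preimage_setT.
by move=> f mf f0; rewrite ge0_integral_pushforward.
Qed.

(** [M] is the law of [phi (X, Y)] for independent [X] and [Y] with laws [P] and [Q]; when [phi] is
    the addition, this is the convolution. *)
Lemma ex_probability_push d1 d2 d3 (X : measurableType d1) (Y : measurableType d2)
    (Z : measurableType d3) (P : probability X R) (Q : probability Y R)
    (phi : X * Y -> Z) : measurable_fun setT phi ->
  exists M : probability Z R, forall f : Z -> \bar R,
    measurable_fun setT f -> (forall z, 0 <= f z) ->
    \int[M]_z f z = \int[P]_x \int[Q]_y f (phi (x, y)).
Proof.
move=> mphi.
have [m m1 mE] := ex_measure_pushforward (P \x Q) mphi.
have [|M ME] := @ex_probability_normalize _ Z m 1%R ltr01.
  rewrite m1; have := product_measure1E P Q measurableT measurableT.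
  rewrite setXTT => H; apply: (etrans H).
  by rewrite -[RHS]mule1; congr (_ * _); exact: probability_setT.
exists M => f mf f0; rewrite ME// invr1 mul1e mE//.
by rewrite (fubini_tonelli1 (f \o phi))//=; exact: (measurableT_comp mf mphi).
Qed.

(* The measure of density [g] is the projection of the restriction of the planar
   Lebesgue measure to the subgraph of [g]. *)
Lemma ex_probability_density (g : R -> R) (c : R) :
  measurable_fun setT g -> (forall x, 0 <= g x)%R -> (0 < c)%R ->
  \int[lebesgue_measure]_x (g x)%:E = c%:E ->
  exists M : probability (measurableTypeR R) R, forall f : R -> \bar R,
    measurable_fun setT f -> (forall z, 0 <= f z) ->
    \int[M]_z f z = c^-1%:E * \int[lebesgue_measure]_x (f x * (g x)%:E).
Proof.
move=> mg g0 c0 gc.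
pose leb := @lebesgue_measure R.
pose S := [set z : measurableTypeR R * measurableTypeR R | (0 <= z.2 <= g z.1)%R].
have mS : measurable S.
  have -> : S = [set z | (0 <= z.2)%R] `&` [set z | (z.2 <= g z.1)%R].
    by apply/seteqP; split => z /=; [move=> /andP|move=> ?; apply/andP].
  apply: measurableI; rewrite -[X in measurable X]setTI.
    exact: measurable_fun_le.
  by apply: measurable_fun_le => //; exact: measurableT_comp.
have sectS (f : R -> \bar R) : measurable_fun setT f -> (forall z, 0 <= f z) ->
    \int[leb \x leb]_(z in S) f z.1 = \int[leb]_x (f x * (g x)%:E).
  move=> mf f0; rewrite integral_mkcond fubini_tonelli1; last 2 first.
  - apply/measurable_restrict => //; rewrite setTI.
    by apply: measurable_funTS; exact: measurableT_comp.
  - by move=> z; apply: erestrict_ge0.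
  apply: eq_integral => x _; rewrite /fubini_F.
  transitivity (\int[leb]_(y in `[0%R, g x]) f x).
    rewrite [RHS]integral_mkcond; apply: eq_integral => y _.
    rewrite !patchE /=; have -> // : ((x, y) \in S) = (y \in `[0%R, g x]%classic).
    by apply/idP/idP; rewrite !inE /S/= ?in_itv/=.
  rewrite integral_cst//; congr (_ * _).
  apply: (etrans (lebesgue_measure_itv `[0%R, g x])).
  by rewrite /= lte_fin oppr0 adde0 lt_neqAle g0 andbT; case: eqVneq => // <-.
have [m m1 mE] := ex_measure_pushforward (mrestr (leb \x leb) mS)
  (measurable_fst : measurable_fun setT (fst : measurableTypeR R * measurableTypeR R -> _)).
have [|M ME] := @ex_probability_normalize _ _ m c c0.
  have := mE (cst 1); rewrite integral_cst// mul1e => ->//.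
  rewrite ge0_integral_mrestr// (sectS (cst 1))// -gc.
  by apply: eq_integral => x _; rewrite mul1e.
exists M => f mf f0; rewrite ME// mE// ge0_integral_mrestr//; last exact: measurableT_comp.
by rewrite sectS.
Qed.

End probability_constructions.

(** * Gaussian subordination of the Riesz kernel *)

Section line.
Context {R : realType}.
Local Notation leb := (@lebesgue_measure R).

Lemma measurable_affine (a b : R) :
  measurable_fun setT (fun x : measurableTypeR R => a * x + b : measurableTypeR R).
Proof. by apply: measurable_funD => //; exact: measurable_funM. Qed.

(** The scaled image measure agrees with the Lebesgue measure on the intervals open on the left and
    closed on the right, and these determine it. *)
Lemma ge0_integral_affine (a b : R) (f : R -> \bar R) : 0 < a ->
  measurable_fun setT f -> (forall x, (0 <= f x)%E) ->
  (\int[leb]_x f x = a%:E * \int[leb]_x f (a * x + b)%R)%E.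
Proof.
move=> a0 mf f0; have a0' := ltW a0.
pose m : {measure set (measurableTypeR R) -> \bar R} := mscale (NngNum a0')
  (measure_function_pushforward__canonical__measure_function_Measure leb (measurable_affine a b)).
have lebE : forall A, measurable A -> leb A = m A.
  apply: lebesgue_measure_unique => _ [[s t]] _ <-.
  rewrite /m/= /mscale/= /pushforward.
  have -> : (fun x => a * x + b) @^-1` [set` `]s, t]] = `](s - b) / a, (t - b) / a]%classic.
    apply/seteqP; split => x /=; rewrite !in_itv/= ltr_pdivrMr// ler_pdivlMr// ltrBlDr lerBrDr (mulrC x) => //.
  rewrite !lebesgue_measure_itv/= !lte_fin ltr_pM2r ?invr_gt0// ltrD2r.
  case: ifP; last by rewrite mule0.
  by rewrite -!EFinB -EFinM => _; congr EFin; field; rewrite gt_eqF.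
transitivity (\int[m]_x f x)%E; first by apply: eq_measure_integral => A mA _; exact: lebE.
rewrite /m ge0_integral_mscale//; congr (_ * _)%E.
by rewrite ge0_integral_pushforward//; exact: measurable_affine.
Qed.

Lemma ge0_integral_bigcup_le (F : (set R)^nat) (f : R -> \bar R) (M : \bar R) :
  nondecreasing_seq F -> (forall k, measurable (F k)) ->
  measurable_fun setT f -> (forall x, (0 <= f x)%E) ->
  (forall k, (\int[leb]_(x in F k) f x <= M)%E) ->
  (\int[leb]_(x in \bigcup_k F k) f x <= M)%E.
Proof.
move=> ndF mF mf f0 FM.
have H : (\int[leb]_(x in F k) f x @[k --> \oo] --> \int[leb]_(x in \bigcup_k F k) f x)%E.
  apply: ge0_nondecreasing_set_cvg_integral => //.
  by move=> k; exact: measurable_funTS.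
rewrite -(cvg_lim _ H)//; apply: lime_le; first by apply/cvg_ex; eexists; exact: H.
exact: nearW.
Qed.

Lemma integral_powR (s a b : R) : s != 0 -> 0 < a -> a < b ->
  (\int[leb]_(x in `[a, b]) (x `^ (s - 1))%:E = ((b `^ s - a `^ s) / s)%:E)%E.
Proof.
move=> s0 a0 ab.
have b0 : 0 < b by apply: lt_trans ab.
have dF (x : R) : 0 < x -> is_derive x 1 (fun y => s^-1 * y `^ s) (x `^ (s - 1)).
  move=> x0; have H := is_derive1_powR s x0.
  have := @is_deriveZ _ _ _ _ s^-1 _ _ _ H.
  by rewrite /GRing.scale/= mulrA mulVf// mul1r.
have cF (t x : R) : 0 < x -> {for x, continuous (fun y : R => y `^ t)}.
  move=> x0; apply: differentiable_continuous; apply/derivable1_diffP.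
  by have [] := is_derive1_powR t x0.
have cF' (x : R) : 0 < x -> {for x, continuous (fun y : R => s^-1 * y `^ s)}.
  by move=> x0; apply: cvgM; [exact: cvg_cst|exact: cF].
rewrite (@continuous_FTC2 _ _ (fun y => s^-1 * y `^ s) _ _ ab).
- by rewrite -EFinB; congr EFin; rewrite -mulrBr mulrC.
- apply: continuous_in_subspaceT => x; rewrite inE/= in_itv/= => /andP[ax _].
  by apply: cF; exact: lt_le_trans ax.
- split.
  + move=> x; rewrite in_itv/= => /andP[ax _].
    by have [] := dF x (lt_trans a0 ax).
  + by apply: cvg_at_right_filter; exact: cF'.
  + by apply: cvg_at_left_filter; exact: cF'.
- move=> x; rewrite in_itv/= => /andP[ax _].
  by rewrite derive1E; have [_] := dF x (lt_trans a0 ax).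
Qed.

Lemma integral_powR_near0 (s : R) : 0 < s ->
  (\int[leb]_(x in `]0%R, 1%R]) (x `^ (s - 1))%:E <= (s^-1)%:E)%E.
Proof.
move=> s0.
(* [k.+2] keeps the intervals non-degenerate, as [integral_powR] requires [a < b]. *)
have -> : `]0%R, 1%R]%classic = \bigcup_k `[k.+2%:R^-1, 1]%classic :> set R.
  apply/seteqP; split => x /=; rewrite in_itv/=.
    move=> /andP[x0 x1]; exists (Num.truncn x^-1) => //=.
    rewrite in_itv/= x1 andbT -[leRHS]invrK lef_pV2 ?posrE ?invr_gt0//.
    by apply: (le_trans (ltW (truncnS_gt _))); rewrite ler_nat.
  by move=> [k _] /=; rewrite in_itv/= => /andP[xk ->]; rewrite (lt_le_trans _ xk).
apply: ge0_integral_bigcup_le.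
- move=> k l kl; apply/subsetPset => x /=; rewrite !in_itv/= => /andP[xk ->].
  by rewrite andbT (le_trans _ xk)// lef_pV2 ?posrE// ler_nat.
- by move=> k; exact: measurable_itv.
- by apply/measurable_EFinP; exact: measurable_powR.
- by move=> x; rewrite lee_fin powR_ge0.
- move=> k; rewrite integral_powR ?gt_eqF//; last first.
    by rewrite invf_lt1// ltr1n.
  by rewrite lee_fin powR1 ler_pdivrMr// mulVf ?gt_eqF// gerBl powR_ge0.
Qed.

Lemma integral_powR_near_infty (s : R) : 0 < s ->
  (\int[leb]_(x in `[1%R, +oo[) (x `^ (- s - 1))%:E <= (s^-1)%:E)%E.
Proof.
move=> s0.
have -> : `[1%R, +oo[%classic = \bigcup_k `[1, k.+2%:R]%classic :> set R.
  apply/seteqP; split => x /=; rewrite in_itv/= ?andbT.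
    move=> x1; exists (Num.truncn x) => //=.
    rewrite in_itv/= x1/=.
    by apply: (le_trans (ltW (truncnS_gt _))); rewrite ler_nat.
  by move=> [k _] /=; rewrite in_itv/= => /andP[].
apply: ge0_integral_bigcup_le.
- move=> k l kl; apply/subsetPset => x /=; rewrite !in_itv/= => /andP[-> xk].
  by rewrite /= (le_trans xk)// ler_nat.
- by move=> k; exact: measurable_itv.
- by apply/measurable_EFinP; exact: measurable_powR.
- by move=> x; rewrite lee_fin powR_ge0.
- move=> k; rewrite integral_powR ?oppr_eq0 ?gt_eqF//; last by rewrite ltr1n.
  by rewrite lee_fin powR1 invrN mulrN -mulNr opprB ler_pdivrMr// mulVf ?gt_eqF// gerBl powR_ge0.
Qed.

End line.

Section subordination.
Context {R : realType}.
Local Notation leb := (@lebesgue_measure R).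
Local Notation pos := (`]0%R, +oo[%classic : set R).
Implicit Types p q r t : R.

(* [kap p q] is [Gamma p * q^(-p)], which at [q = |x - y|^2] is the Riesz kernel up to
   a constant; including the value [+oo] at [q = 0]. *)
Definition heat p r q : R := r `^ (- p - 1) * expR (- (q / r)).

Definition kap p q : \bar R := (\int[leb]_(r in pos) (heat p r q)%:E)%E.

(* [heat] at [q = |x - y|^2] after the convolution in [x] with the centred Gaussian
   of variance [t] in each of the [n] coordinates. *)
Definition smeared_heat n p t r q : R :=
  r `^ (- p - 1) * (Num.sqrt (r / (r + 2 * t)) ^+ n * expR (- (q / (r + 2 * t)))).

Definition smeared_kap n p t q : \bar R :=
  (\int[leb]_(r in pos) (smeared_heat n p t r q)%:E)%E.

Lemma heat_ge0 p r q : 0 <= heat p r q.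
Proof. by rewrite mulr_ge0 ?powR_ge0 ?expR_ge0. Qed.

Lemma smeared_heat_ge0 n p t r q : 0 <= smeared_heat n p t r q.
Proof. by rewrite !mulr_ge0 ?powR_ge0 ?expR_ge0 ?exprn_ge0 ?sqrtr_ge0. Qed.

Lemma sqrtr_powR r n : 0 <= r -> Num.sqrt r ^+ n = r `^ (n%:R / 2).
Proof.
by move=> r0; rewrite -powR12_sqrt// -powR_mulrn ?powR_ge0// -powRrM mulrC.
Qed.

Lemma measurable_inv : measurable_fun setT (@GRing.inv R).
Proof.
rewrite (_ : GRing.inv = fun x : R => if 0 <= x then x `^ (-1) else - ((- x) `^ (-1))).
  apply: measurable_fun_ifT.
  - exact: measurable_fun_ler.
  - exact: measurable_powR.
  - apply: measurableT_comp => //.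
    by apply: (measurableT_comp (measurable_powR _)); exact: oppr_measurable.
apply/funext => x; case: ifPn => [x0|]; first by rewrite powR_inv1.
by rewrite -ltNge => x0; rewrite powR_inv1 ?oppr_ge0 ?ltW// invrN opprK.
Qed.

Lemma measurable_sqrtr : measurable_fun setT (@Num.sqrt R).
Proof.
rewrite (_ : Num.sqrt = fun x : R => if 0 <= x then x `^ 2^-1 else 0).
  apply: measurable_fun_ifT.
  - exact: measurable_fun_ler.
  - exact: measurable_powR.
  - exact: measurable_cst.
apply/funext => x; case: ifPn => [x0|]; first by rewrite powR12_sqrt.
by rewrite -ltNge => x0; rewrite ltr0_sqrtr.
Qed.

Lemma measurable_heat d (X : measurableType d) p (f g : X -> R) :
  measurable_fun setT f -> measurable_fun setT g ->
  measurable_fun setT (fun x => heat p (f x) (g x)).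
Proof.
move=> mf mg; apply: measurable_funM.
  exact: (measurableT_comp (measurable_powR _) mf).
apply: measurableT_comp => //; apply: measurableT_comp => //.
by apply: measurable_funM => //; exact: (measurableT_comp measurable_inv mf).
Qed.

Lemma measurable_smeared_heat d (X : measurableType d) n p t (f g : X -> R) :
  measurable_fun setT f -> measurable_fun setT g ->
  measurable_fun setT (fun x => smeared_heat n p t (f x) (g x)).
Proof.
move=> mf mg; have mi : measurable_fun setT (fun x => (f x + 2 * t)^-1).
  by apply: (measurableT_comp measurable_inv); exact: measurable_funD.
apply: measurable_funM.
  exact: (measurableT_comp (measurable_powR _) mf).
apply: measurable_funM.
  apply: measurable_funX; apply: (measurableT_comp measurable_sqrtr).
  exact: measurable_funM.
apply: measurableT_comp => //; apply: measurableT_comp => //.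
exact: measurable_funM.
Qed.

(** Near 0 the smearing factor is at most a multiple of [r^(n/2)], and [r^(n/2 - p - 1)] is
    integrable there because [2 p < n]. Near infinity the factor is at most 1 and [r^(- p - 1)] is
    integrable because [p > 0]. With [p = lambda / 2] this is how [lambda < n] enters. *)
Lemma smeared_kap_lty n p t : 0 < p -> 2 * p < n%:R -> 0 < t ->
  (smeared_kap n p t 0 < +oo)%E.
Proof.
move=> p0 pn t0.
have s0 : 0 < n%:R / 2 - p by lra.
have mf : measurable_fun setT (fun r => (smeared_heat n p t r 0)%:E).
  by apply/measurable_EFinP; exact: measurable_smeared_heat.
have f0 r : (0 <= (smeared_heat n p t r 0)%:E)%E by rewrite lee_fin smeared_heat_ge0.
rewrite /smeared_kap.
have -> : pos = `]0%R, 1%R]%classic `|` `]1%R, +oo[%classic :> set R.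
  apply/seteqP; split => x /=; rewrite !in_itv/= ?andbT.
    by move=> x0; case: (leP x 1) => x1; [left; apply/andP|right].
  by case=> [/andP[]//|]; exact: lt_trans.
rewrite ge0_integral_setU//; [|exact: measurable_funTS|]; last first.
  apply/disj_set2P; rewrite -subset0 => x []/=; rewrite !in_itv/= andbT.
  by move=> /andP[_ x1]; rewrite ltNge x1.
have rho r : 0 < r -> 0 <= r / (r + 2 * t) by move=> r0; apply: divr_ge0; lra.
apply: lte_add_pinfty.
- pose c := (2 * t)^-1 `^ (n%:R / 2).
  apply: (@le_lt_trans _ _ (c%:E * \int[leb]_(x in `]0%R, 1%R]) (x `^ ((n%:R / 2 - p) - 1))%:E)%E).
    rewrite -ge0_integralZl//; last 3 first.
    + apply: measurable_funTS; apply/measurable_EFinP; exact: measurable_powR.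
    + by move=> r _; rewrite lee_fin powR_ge0.
    + by rewrite lee_fin powR_ge0.
    apply: ge0_le_integral => //.
    + exact: measurable_funTS.
    + by apply: measurable_funTS; apply/measurable_EFinP; apply: measurable_funM => //; exact: measurable_powR.
    move=> r /=; rewrite in_itv/= => /andP[r0 r1].
    rewrite -EFinM lee_fin /smeared_heat mul0r oppr0 expR0 mulr1 sqrtr_powR ?rho//.
    have -> : n%:R / 2 - p - 1 = (- p - 1) + n%:R / 2 :> R by lra.
    rewrite (@powRD _ r (- p - 1)) ?(gt_eqF r0) ?implybT// mulrCA ler_wpM2l ?powR_ge0//.
    rewrite [leRHS]mulrC -powRM ?invr_ge0 ?mulr_ge0 ?(ltW t0) ?(ltW r0)//.
    apply: ge0_ler_powR; rewrite ?nnegrE; [by rewrite divr_ge0|exact: rho| |].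
      by rewrite mulr_ge0 ?invr_ge0; lra.
    by rewrite ler_wpM2l ?(ltW r0)// lef_pV2 ?posrE; lra.
  apply: lte_mul_pinfty => //; first by rewrite lee_fin powR_ge0.
  by apply: le_lt_trans (integral_powR_near0 s0) _; rewrite ltry.
- apply: (@le_lt_trans _ _ (p^-1)%:E); last exact: ltry.
  apply: le_trans (integral_powR_near_infty p0).
  rewrite -integral_itv_obnd_cbnd; last first.
    by apply: measurable_funTS; apply/measurable_EFinP; exact: measurable_powR.
  apply: ge0_le_integral => //.
  + exact: measurable_funTS.
  + by apply: measurable_funTS; apply/measurable_EFinP; exact: measurable_powR.
  move=> r /=; rewrite in_itv/= andbT => r1; have r0 : 0 < r by lra.
  rewrite lee_fin /smeared_heat mul0r oppr0 expR0 mulr1 ler_piMr ?powR_ge0//.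
  rewrite exprn_ile1 ?sqrtr_ge0// -[leRHS]sqrtr1 ler_sqrt// ler_pdivrMr; lra.
Qed.

Lemma le_smeared_kap n p t q : 0 <= q -> 0 < t ->
  (smeared_kap n p t q <= smeared_kap n p t 0)%E.
Proof.
move=> q0 t0; apply: ge0_le_integral => //.
- by move=> r _; rewrite lee_fin smeared_heat_ge0.
- by apply: measurable_funTS; apply/measurable_EFinP; exact: measurable_smeared_heat.
- by apply: measurable_funTS; apply/measurable_EFinP; exact: measurable_smeared_heat.
move=> r /=; rewrite in_itv/= andbT => r0; rewrite lee_fin.
rewrite ler_wpM2l ?powR_ge0// ler_wpM2l ?exprn_ge0 ?sqrtr_ge0// ler_expR.
by rewrite mul0r lerN2 divr_ge0//; lra.
Qed.

Lemma measurable_kap_integrand p q : measurable_fun setT (fun r => (heat p r q)%:E).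
Proof. by apply/measurable_EFinP; exact: measurable_heat. Qed.

(** [exp (- 1 / r) <= (1 + 1 / (N r))^(- N)], and the right-hand side is the smearing factor at
    [q = 0] in dimension [2 N] with [2 t = 1 / N]; so the previous bound applies as soon as
    [N > p]. *)
Lemma kap1_lty p : 0 < p -> (kap p 1 < +oo)%E.
Proof.
move=> p0; pose N := (Num.truncn p).+1.
have N0 : 0 < N%:R :> R by rewrite ltr0n.
have pN : p < N%:R by exact: truncnS_gt.
apply: le_lt_trans (@smeared_kap_lty (2 * N) p (2 * N%:R)^-1 p0 _ _); last 2 first.
- by rewrite natrM ltr_pM2l.
- by rewrite invr_gt0 mulr_gt0.
apply: ge0_le_integral => //.
- by move=> r _; rewrite lee_fin heat_ge0.
- by apply: measurable_funTS; exact: measurable_kap_integrand.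
- by apply: measurable_funTS; apply/measurable_EFinP; exact: measurable_smeared_heat.
move=> r /=; rewrite in_itv/= andbT => r0; rewrite lee_fin.
rewrite ler_wpM2l ?powR_ge0// mul0r oppr0 expR0 mulr1 exprM sqr_sqrtr; last first.
  by rewrite divr_ge0 ?addr_ge0 ?mulr_ge0 ?invr_ge0 ?(ltW r0)// ltW// mulr_gt0.
have -> : - (1 / r) = N%:R * - (N%:R * r)^-1 by field; rewrite !gt_eqF.
rewrite expRM_natl lerXn2r ?nnegrE ?expR_ge0//.
  by rewrite divr_ge0 ?addr_ge0 ?mulr_ge0 ?invr_ge0 ?(ltW r0)// ltW// mulr_gt0.
have Nr : 0 < (N%:R * r)^-1 by rewrite invr_gt0 mulr_gt0.
have -> : r / (r + 2 * (2 * N%:R)^-1) = (1 + (N%:R * r)^-1)^-1.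
  field; rewrite !gt_eqF// ?addr_gt0// ?mulr_gt0//.
rewrite expRN lef_pV2 ?posrE ?expR_gt0 ?addr_gt0//.
exact: expR_ge1Dx.
Qed.

(** Superharmonicity in averaged form. Writing [r + 2 t] for [r] on the right makes the exponentials
    equal; the powers compare because [r / (r + 2 t) <= 1] and [n / 2 >= p + 1]. *)
Lemma smeared_kap_le n p t q : 0 < p -> 2 * p + 2 <= n%:R -> 0 < t ->
  (smeared_kap n p t q <= \int[leb]_(r in `](2 * t)%R, +oo[) (heat p r q)%:E)%E.
Proof.
move=> p0 pn t0.
pose f := (fun r => (heat p r q)%:E) \_ (`](2 * t)%R, +oo[%classic : set R).
have mf : measurable_fun setT f.
  by apply/measurable_restrict => //; apply: measurable_funTS; exact: measurable_kap_integrand.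
have f0 r : (0 <= f r)%E by apply: erestrict_ge0 => ? _; rewrite lee_fin heat_ge0.
rewrite [leRHS]integral_mkcond -/f (@ge0_integral_affine _ 1 (2 * t)%R)// mul1e.
rewrite /smeared_kap integral_mkcond; apply: ge0_le_integral => //.
- by move=> r _; apply: erestrict_ge0 => ? _; rewrite lee_fin smeared_heat_ge0.
- apply/measurable_restrict => //; apply: measurable_funTS.
  by apply/measurable_EFinP; exact: measurable_smeared_heat.
- exact: (measurableT_comp mf (measurable_affine _ _)).
move=> r _; rewrite mul1r /f !patchE.
have -> : (r + 2 * t \in (`](2 * t)%R, +oo[%classic : set R)) = (r \in pos).
  by apply/idP/idP; rewrite !inE/= !in_itv/= !andbT ltrDr.
case: ifPn => //; rewrite inE/= in_itv/= andbT => r0.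
rewrite lee_fin /smeared_heat /heat mulrA ler_wpM2r ?expR_ge0//.
have rt : 0 < r + 2 * t by lra.
have rho0 : 0 < r / (r + 2 * t) by rewrite divr_gt0.
rewrite sqrtr_powR ?(ltW rho0)//.
apply: (@le_trans _ _ (r `^ (- p - 1) * (r / (r + 2 * t)) `^ (p + 1))).
  rewrite ler_wpM2l ?powR_ge0// ger_powR ?rho0//=; last by lra.
  by rewrite ler_pdivrMr//; lra.
rewrite powRM ?invr_ge0 ?(ltW r0) ?(ltW rt)// mulrA -powRD; last by rewrite (gt_eqF r0) implybT.
have -> : - p - 1 + (p + 1) = 0 by lra.
rewrite powRr0 mul1r -powR_inv1 ?(ltW rt)// -powRrM.
by have -> : -1 * (p + 1) = - p - 1 by lra.
Qed.

Lemma kap_split p q t : 0 < t ->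
  (kap p q = \int[leb]_(r in `]0%R, (2 * t)%R]) (heat p r q)%:E +
             \int[leb]_(r in `](2 * t)%R, +oo[) (heat p r q)%:E)%E.
Proof.
move=> t0; rewrite -ge0_integral_setU//.
- congr (integral _ _ _); apply/seteqP; split => x /=; rewrite !in_itv/= ?andbT.
    by move=> x0; case: (leP x (2 * t)) => x1; [left; apply/andP|right].
  by case=> [/andP[]//|]; apply: lt_trans; lra.
- by apply: measurable_funTS; exact: measurable_kap_integrand.
- by move=> r _; rewrite lee_fin heat_ge0.
- apply/disj_set2P; rewrite -subset0 => x []/=; rewrite !in_itv/= andbT.
  by move=> /andP[_ x1]; rewrite ltNge x1.
Qed.

(** The length of [[t, 2 t]] times a lower bound of [heat p r q] on it, valid for [q <= t]. *)
Definition kap_gap p t : R := t * ((2 * t) `^ (- p - 1) * expR (-1)).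

Lemma kap_gap_gt0 p t : 0 < t -> 0 < kap_gap p t.
Proof. by move=> t0; rewrite !mulr_gt0 ?powR_gt0 ?expR_gt0 ?mulr_gt0. Qed.

Lemma kap_gap_le p q t : 0 < t -> 0 < p -> q <= t ->
  ((kap_gap p t)%:E <= \int[leb]_(r in `]0%R, (2 * t)%R]) (heat p r q)%:E)%E.
Proof.
move=> t0 p0 qt.
apply: (@le_trans _ _ (\int[leb]_(r in `[t, (2 * t)%R]) (heat p r q)%:E)%E); last first.
  apply: ge0_subset_integral => //.
  - by apply: measurable_funTS; exact: measurable_kap_integrand.
  - by move=> r _; rewrite lee_fin heat_ge0.
  - by move=> x /=; rewrite !in_itv/= => /andP[tx ->]; rewrite andbT; lra.
apply: (@le_trans _ _ (\int[leb]_(r in `[t, (2 * t)%R]) ((2 * t) `^ (- p - 1) * expR (-1))%:E)%E).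
  rewrite integral_cst// [X in (_ <= _ * X)%E](lebesgue_measure_itv `[t, (2 * t)%R]).
  rewrite /= lte_fin ifT; last by lra.
  rewrite -EFinB -EFinM lee_fin /kap_gap mulrC ler_wpM2l ?mulr_ge0 ?powR_ge0 ?expR_ge0//.
  by lra.
apply: ge0_le_integral => //.
- by move=> r _; rewrite lee_fin mulr_ge0 ?powR_ge0 ?expR_ge0.
- by apply: measurable_funTS; exact: measurable_kap_integrand.
move=> r /=; rewrite in_itv/= => /andP[tr rt]; have r0 : 0 < r by lra.
rewrite lee_fin /heat ler_pM ?powR_ge0 ?expR_ge0//.
  have -> : - p - 1 = - (p + 1) by lra.
  rewrite !powRN lef_pV2 ?posrE ?powR_gt0//; last by lra.
  by apply: ge0_ler_powR; rewrite ?nnegrE; lra.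
by rewrite ler_expR lerN2 ler_pdivrMr//; lra.
Qed.

Lemma kap_ge0 p q : (0 <= kap p q)%E.
Proof. by apply: integral_ge0 => r _; rewrite lee_fin heat_ge0. Qed.

Lemma kap1_gt0 p : 0 < p -> (0 < kap p 1)%E.
Proof.
move=> p0; rewrite (@kap_split p 1 1)//.
apply: lt_le_trans (leeDl _ _).
  by apply: lt_le_trans (kap_gap_le _ p0 (lexx 1)); rewrite ?lte_fin ?kap_gap_gt0.
by apply: integral_ge0 => r _; rewrite lee_fin heat_ge0.
Qed.

Lemma kapE p q : 0 < q -> kap p q = ((q `^ (- p))%:E * kap p 1)%E.
Proof.
move=> q0; pose f := (fun r => (heat p r q)%:E) \_ pos.
have mf : measurable_fun setT f.
  by apply/measurable_restrict => //; apply: measurable_funTS; exact: measurable_kap_integrand.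
have f0 r : (0 <= f r)%E by apply: erestrict_ge0 => ? _; rewrite lee_fin heat_ge0.
rewrite /kap [LHS]integral_mkcond -/f (@ge0_integral_affine _ q 0)//.
rewrite [in RHS]integral_mkcond -ge0_integralZl//; last 3 first.
- by apply/measurable_restrict => //; apply: measurable_funTS; exact: measurable_kap_integrand.
- by move=> r _; apply: erestrict_ge0 => ? _; rewrite lee_fin heat_ge0.
- by rewrite lee_fin powR_ge0.
rewrite -ge0_integralZl//; last 2 first.
- exact: (measurableT_comp mf (measurable_affine _ _)).
- by rewrite lee_fin ltW.
apply: eq_integral => r _; rewrite addr0 /f !patchE.
have -> : (q * r \in pos) = (r \in pos).
  by apply/idP/idP; rewrite !inE/= !in_itv/= !andbT pmulr_rgt0.
case: ifPn; last by rewrite !mule0.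
rewrite inE/= in_itv/= andbT => r0; rewrite -!EFinM /heat; congr EFin.
have -> : q / (q * r) = 1 / r by field; rewrite !gt_eqF.
rewrite powRM ?(ltW q0) ?(ltW r0)// !mulrA -{1}(powRr1 (ltW q0)) -powRD; last by rewrite (gt_eqF q0) implybT.
by congr (_ `^ _ * _ * _); lra.
Qed.

(** The divergence comes from scaling: [kap p 0] is at least [kap p q = q^(- p) * kap p 1] for every
    [q > 0]. With [q = z^(- 1 / p)] the right-hand side would be [kap p 0 + 1]. *)
Lemma kap0 p : 0 < p -> kap p 0 = +oo%E.
Proof.
move=> p0; apply/eqP; rewrite -leye_eq leNgt; apply/negP => k0.
have k0fin : kap p 0 \is a fin_num by rewrite ge0_fin_numE// kap_ge0.
have k1fin : kap p 1 \is a fin_num by rewrite ge0_fin_numE ?kap_ge0// kap1_lty.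
have H (q : R) : 0 < q -> q `^ (- p) * fine (kap p 1) <= fine (kap p 0).
  move=> q0; rewrite -lee_fin EFinM !fineK// -kapE//.
  apply: ge0_le_integral => //.
  - by move=> r _; rewrite lee_fin heat_ge0.
  - by apply: measurable_funTS; exact: measurable_kap_integrand.
  - by apply: measurable_funTS; exact: measurable_kap_integrand.
  move=> r /=; rewrite in_itv/= andbT => r0.
  by rewrite lee_fin ler_wpM2l ?powR_ge0// ler_expR mul0r lerN2 divr_ge0 ?ltW.
have c0 : 0 < fine (kap p 1) by rewrite fine_gt0// kap1_gt0// kap1_lty.
have K0 : 0 <= fine (kap p 0) by rewrite fine_ge0// kap_ge0.
pose z := (fine (kap p 0) + 1) / fine (kap p 1).
have z0 : 0 < z by rewrite divr_gt0//; lra.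
have := H (z `^ (- p^-1)) (powR_gt0 _ z0).
rewrite -powRrM mulrNN mulVf ?gt_eqF// powRr1 ?(ltW z0)// /z divfK ?gt_eqF//.
lra.
Qed.

End subordination.

(** * Truncated Gaussians on the line *)

Section gauss_line.
Context {R : realType}.
Local Notation leb := (@lebesgue_measure R).
Implicit Types (t a x y r m : R).

(* An upper bound of the mass that the centred Gaussian of variance [t] puts off
   [-a, a]; the factor [sqrt 2] is the price of comparing with variance [2 t]. *)
Definition gauss_tail t a : R := Num.sqrt 2 * expR (- (a ^+ 2 / (4 * t))).

Lemma normal_pdf_sqrt t m x : 0 < t ->
  normal_pdf m (Num.sqrt t) x =
  (Num.sqrt (2 * pi * t))^-1 * expR (- ((x - m) ^+ 2 / (2 * t))).
Proof.
move=> t0; rewrite normal_pdfE; last by rewrite gt_eqF// sqrtr_gt0.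
rewrite /normal_peak /normal_fun sqr_sqrtr ?ltW//.
congr ((Num.sqrt _)^-1 * expR _); first by rewrite -mulr_natl; ring.
by rewrite -mulr_natl mulNr.
Qed.

Lemma measurable_sqr_normal m s : measurable_fun setT (fun x => (normal_pdf m s x)%:E).
Proof. by apply/measurable_EFinP; exact: measurable_normal_pdf. Qed.

(** Half of the exponent [x^2 / (2 t)] is at least [a^2 / (4 t)] off the interval; the other half is
    the exponent of the density of variance [2 t], of total mass 1. *)
Lemma integral_gauss_tail t a : 0 < t -> 0 < a ->
  (\int[leb]_(x in ~` `[(- a)%R, a]) (normal_pdf 0 (Num.sqrt t) x)%:E <=
   (gauss_tail t a)%:E)%E.
Proof.
move=> t0 a0.
have mC : measurable (~` (`[(- a)%R, a]%classic : set R)) by apply: measurableC; exact: measurable_itv.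
have e0 : 0 <= gauss_tail t a by rewrite mulr_ge0 ?sqrtr_ge0 ?expR_ge0.
apply: (@le_trans _ _ (\int[leb]_x ((gauss_tail t a)%:E * (normal_pdf 0 (Num.sqrt (2 * t)) x)%:E))%E); last first.
  rewrite ge0_integralZl//; last 2 first.
  - exact: measurable_sqr_normal.
  - by move=> x _; rewrite lee_fin normal_pdf_ge0.
  by rewrite integral_normal_pdf mule1.
apply: (@le_trans _ _ (\int[leb]_(x in ~` `[(- a)%R, a]) ((gauss_tail t a)%:E * (normal_pdf 0 (Num.sqrt (2 * t)) x)%:E))%E); last first.
  apply: ge0_subset_integral => //.
  - by apply: emeasurable_funM => //; exact: measurable_sqr_normal.
  - by move=> x _; rewrite mule_ge0// lee_fin normal_pdf_ge0.
apply: ge0_le_integral => //.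
- by move=> x _; rewrite lee_fin normal_pdf_ge0.
- by apply: measurable_funTS; exact: measurable_sqr_normal.
- apply: measurable_funTS; apply: emeasurable_funM => //; exact: measurable_sqr_normal.
move=> x /= /negP; rewrite in_itv/= -ler_norml -ltNge => ax.
rewrite -EFinM lee_fin !normal_pdf_sqrt ?mulr_gt0// subr0 /gauss_tail.
have -> : Num.sqrt (2 * pi * (2 * t)) = Num.sqrt 2 * Num.sqrt (2 * pi * t).
  by rewrite -sqrtrM//; congr Num.sqrt; ring.
have s2 : 0 < Num.sqrt 2 :> R by rewrite sqrtr_gt0.
have st : 0 < Num.sqrt (2 * pi * t) :> R by rewrite sqrtr_gt0 !mulr_gt0 ?pi_gt0.
have -> : forall A B : R, Num.sqrt 2 * A * ((Num.sqrt 2 * Num.sqrt (2 * pi * t))^-1 * B) =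
    (Num.sqrt (2 * pi * t))^-1 * (A * B).
  by move=> A B; field; rewrite !gt_eqF.
rewrite ler_wpM2l ?invr_ge0 ?(ltW st)// -expRD ler_expR.
have -> : - (x ^+ 2 / (2 * t)) = - (x ^+ 2 / (4 * t)) - x ^+ 2 / (2 * (2 * t)).
  by field; rewrite gt_eqF.
rewrite lerD2r lerN2 ler_pM2r ?invr_gt0 ?mulr_gt0//.
by rewrite -[leRHS]real_normK ?num_real// ler_pXn2r ?nnegrE ?normr_ge0 ?(ltW a0)// ltW.
Qed.

(** Completing the square in [x]. The function [exp (- z^2 / r)] is a Gaussian of variance [r / 2],
    and [r / 2 + t = (r + 2 t) / 2]. *)
Lemma gauss_convolution t r x y : 0 < t -> 0 < r ->
  expR (- ((y + x) ^+ 2 / r)) * normal_pdf 0 (Num.sqrt t) x =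
  Num.sqrt (r / (r + 2 * t)) * expR (- (y ^+ 2 / (r + 2 * t))) *
  normal_pdf (- (2 * t * y / (r + 2 * t))) (Num.sqrt (t * (r / (r + 2 * t)))) x.
Proof.
move=> t0 r0; have rt : 0 < r + 2 * t by lra.
have rho : 0 < r / (r + 2 * t) by rewrite divr_gt0.
rewrite !normal_pdf_sqrt// ?(mulr_gt0 t0 rho)// subr0.
have -> : Num.sqrt (2 * pi * (t * (r / (r + 2 * t)))) =
    Num.sqrt (r / (r + 2 * t)) * Num.sqrt (2 * pi * t).
  by rewrite -sqrtrM ?(ltW rho)//; congr Num.sqrt; ring.
have st : 0 < Num.sqrt (2 * pi * t) :> R by rewrite sqrtr_gt0 !mulr_gt0 ?pi_gt0.
have sr : 0 < Num.sqrt (r / (r + 2 * t)) by rewrite sqrtr_gt0.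
set u := Num.sqrt (r / _) in sr *; set v := Num.sqrt (2 * pi * t) in st *.
rewrite mulrCA -expRD (invfM u v).
have -> : forall A B : R, u * A * (u^-1 * v^-1 * B) = v^-1 * (A * B).
  by move=> A B; field; rewrite !gt_eqF.
rewrite -expRD; congr (_ * expR _).
by field; rewrite !gt_eqF//= mulr_gt0.
Qed.

(** [tau] is the normal law of variance [t] conditioned on [[- a, a]]. Integrating over the whole
    line instead only increases the value, and the normalization costs at most the factor
    [(1 - gauss_tail t a)^-1]. *)
Lemma ex_truncated_gauss t a : 0 < t -> 0 < a -> gauss_tail t a < 1 ->
  exists tau : probability (measurableTypeR R) R,
    tau (~` `[(- a)%R, a]) = 0%E /\
    forall r y, 0 < r ->
    (\int[tau]_x (expR (- ((y + x) ^+ 2 / r)))%:E <=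
     ((1 - gauss_tail t a)^-1 *
      (Num.sqrt (r / (r + 2 * t)) * expR (- (y ^+ 2 / (r + 2 * t)))))%:E)%E.
Proof.
move=> t0 a0 tail1.
pose A : set R := `[(- a)%R, a]%classic.
pose pdf := normal_pdf 0 (Num.sqrt t).
pose g (x : R) := pdf x * \1_A x.
have mA : measurable A by exact: measurable_itv.
have mg : measurable_fun setT g.
  by apply: measurable_funM; [exact: measurable_normal_pdf|exact: measurable_indic].
have g0 x : 0 <= g x by rewrite mulr_ge0 ?normal_pdf_ge0.
have gE : (\int[leb]_x (g x)%:E = \int[leb]_(x in A) (pdf x)%:E)%E.
  rewrite [RHS]integral_mkcond; apply: eq_integral => x _.
  by rewrite /g patchE indicE; case: (x \in A); rewrite ?mulr1 ?mulr0.
have tot : (\int[leb]_(x in A) (pdf x)%:E + \int[leb]_(x in ~` A) (pdf x)%:E = 1)%E.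
  rewrite -ge0_integral_setU//.
  - by rewrite setUv integral_normal_pdf.
  - exact: measurableC.
  - by rewrite setUv; exact: measurable_sqr_normal.
  - by move=> x _; rewrite lee_fin normal_pdf_ge0.
  - by apply/disj_set2P; rewrite setICr.
have I0 : (0 <= \int[leb]_(x in A) (pdf x)%:E)%E.
  by apply: integral_ge0 => x _; rewrite lee_fin normal_pdf_ge0.
have J0 : (0 <= \int[leb]_(x in ~` A) (pdf x)%:E)%E.
  by apply: integral_ge0 => x _; rewrite lee_fin normal_pdf_ge0.
have Ifin : (\int[leb]_(x in A) (pdf x)%:E)%E \is a fin_num.
  by rewrite ge0_fin_numE// (@le_lt_trans _ _ 1%E) ?ltry// -tot leeDl.
have Jfin : (\int[leb]_(x in ~` A) (pdf x)%:E)%E \is a fin_num.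
  by rewrite ge0_fin_numE// (@le_lt_trans _ _ 1%E) ?ltry// -tot leeDr.
pose c := fine (\int[leb]_(x in A) (pdf x)%:E)%E.
have c1 : 1 - gauss_tail t a <= c.
  have := integral_gauss_tail t0 a0; rewrite -/pdf -/A.
  move: tot; rewrite -(fineK Ifin) -(fineK Jfin) -EFinD lee_fin => -[].
  by rewrite -/c; lra.
have c0 : 0 < c by lra.
have [|tau tauE] := @ex_probability_density R g c mg g0 c0.
  by rewrite gE fineK.
exists tau; split.
  transitivity (\int[tau]_x (\1_(~` A) x)%:E)%E.
    by rewrite integral_indic ?setIT//; exact: measurableC.
  have mCA : measurable_fun setT (EFin \o (\1_(~` A) : R -> R)).
    apply/measurable_EFinP; apply: measurable_indic; exact: measurableC.
  rewrite (tauE _ mCA); last first.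
  - by move=> x; rewrite lee_fin.
  rewrite (eq_integral (cst 0%E)) ?integral0 ?mule0// => x _.
  by rewrite -EFinM /g !indicE in_setC; case: (x \in A); rewrite ?mul0r// !mulr0.
move=> r y r0.
have mE : measurable_fun setT (fun x : R => (expR (- ((y + x) ^+ 2 / r)))%:E).
  apply/measurable_EFinP; apply: measurableT_comp => //; apply: measurableT_comp => //.
  by apply: measurable_funM => //; apply: measurable_funX; exact: measurable_funD.
rewrite (tauE _ mE); last by move=> x; rewrite lee_fin expR_ge0.
set K := Num.sqrt _ * expR _.
have K0 : 0 <= K by rewrite mulr_ge0 ?sqrtr_ge0 ?expR_ge0.
apply: (@le_trans _ _ (c^-1%:E * K%:E)%E); last first.
  rewrite -EFinM lee_fin ler_wpM2r// lef_pV2 ?posrE//; lra.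
rewrite lee_wpmul2l ?lee_fin ?invr_ge0 ?(ltW c0)//.
apply: (@le_trans _ _ (\int[leb]_x (K%:E * (normal_pdf (- (2 * t * y / (r + 2 * t)))
    (Num.sqrt (t * (r / (r + 2 * t)))) x)%:E))%E); last first.
  rewrite ge0_integralZl//; last 2 first.
  - exact: measurable_sqr_normal.
  - by move=> x _; rewrite lee_fin normal_pdf_ge0.
  rewrite integral_normal_pdf ?mule1// gt_eqF// sqrtr_gt0 mulr_gt0// divr_gt0//; lra.
apply: ge0_le_integral => //.
- by move=> x _; rewrite -EFinM lee_fin mulr_ge0 ?expR_ge0.
- by apply: emeasurable_funM => //; exact/measurable_EFinP.
- by apply: emeasurable_funM => //; exact: measurable_sqr_normal.
move=> x _; rewrite -!EFinM lee_fin -gauss_convolution// ler_wpM2l ?expR_ge0//.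
by rewrite /g ler_piMr ?normal_pdf_ge0// indicE; case: (_ \in _).
Qed.

End gauss_line.

(** * Truncated Gaussians in R^n, one coordinate at a time *)

Section gauss_space.
Context {R : realType} {n : nat}.
Local Notation T := (borelRn R n).
Implicit Types (t a r C : R).

Lemma measurable_dotv d (X : measurableType d) (f g : X -> 'rV[R]_n) :
  (forall i, measurable_fun setT (fun x => f x 0 i)) ->
  (forall i, measurable_fun setT (fun x => g x 0 i)) ->
  measurable_fun setT (fun x => dotv (f x) (g x)).
Proof. by move=> mf mg; apply: measurable_sum => i; exact: measurable_funM. Qed.

Definition box a : set 'rV[R]_n := [set z | forall i, `|z 0 i| <= a].

(** Carries the laws whose first [k] coordinates have been smeared, the others being still 0. *)
Let partial_box a k : set 'rV[R]_n :=
  [set z | forall i : 'I_n, `|z 0 i| <= if (i < k)%N then a else 0].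

Let measurable_partial_box a k : measurable (partial_box a k : set T).
Proof.
have -> : partial_box a k = \bigcap_(i in [set: 'I_n])
    ((fun x : 'rV[R]_n => x 0 i) @^-1` [set u : R | `|u| <= if (i < k)%N then a else 0]).
  by apply/seteqP; split => x H i; [move=> _; exact: H|exact: (H i I)].
apply: fin_bigcap_measurable => // i _; rewrite -[X in measurable X]setTI.
apply: measurable_coord => //; rewrite -[X in measurable X]setTI.
by apply: measurable_fun_le => //; exact: measurableT_comp.
Qed.

Let weight t r k (i : 'I_n) : R := if (i < k)%N then r + 2 * t else r.

(** The product of [k] truncated Gaussians, built without an [n]-fold product: each step adds an
    independent multiple of the next basis vector. Accordingly [weight] is [r + 2 t] on the
    coordinates already treated. *)
Lemma ex_smear_partial t a k : 0 < t -> 0 < a -> gauss_tail t a < 1 -> (k <= n)%N ->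
  exists sigma : probability T R,
    sigma (~` partial_box a k) = 0%E /\
    forall r y, 0 < r ->
    (\int[sigma]_z (expR (- (\sum_i ((y + z) 0 i) ^+ 2 / r)))%:E <=
     (((1 - gauss_tail t a)^-1 * Num.sqrt (r / (r + 2 * t))) ^+ k *
      expR (- \sum_i ((y 0 i) ^+ 2 / weight t r k i)))%:E)%E.
Proof.
move=> t0 a0 tail1.
have mE r (y : 'rV[R]_n) : measurable_fun setT
    (fun z : T => (expR (- (\sum_i ((y + z) 0 i) ^+ 2 / r)))%:E).
  apply/measurable_EFinP; apply: measurableT_comp => //; apply: measurableT_comp => //.
  apply: measurable_sum => i; apply: measurable_funM => //; apply: measurable_funX.
  rewrite (_ : (fun z : T => _) = (fun z => y 0 i + z 0 i)); last by apply/funext => z; rewrite mxE.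
  by apply: measurable_funD => //; exact: measurable_coord.
have E0 r (y z : 'rV[R]_n) : (0 <= (expR (- (\sum_i ((y + z) 0 i) ^+ 2 / r)))%:E)%E.
  by rewrite lee_fin expR_ge0.
elim: k => [_|k IH kn].
  exists (dirac (0 : T)); split.
    rewrite /= diracE memNset//=; apply; move=> i; rewrite ltn0 mxE normr0//.
  move=> r y r0; rewrite integral_dirac// diracT mul1e expr0 mul1r lee_fin ler_expR lerN2.
  by apply: ler_sum => i _; rewrite addr0 /weight ltn0.
have [sigma [sigma0 sigmaE]] := IH (ltnW kn).
have [tau [tau0 tauE]] := ex_truncated_gauss t0 a0 tail1.
pose e : 'rV[R]_n := delta_mx 0 (Ordinal kn).
have eE i : e 0 i = (i == k :> nat)%:R by rewrite mxE eqxx.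
pose phi (p : measurableTypeR R * T) : T := (p.2 : 'rV[R]_n) + p.1 *: e.
have phiE x (z : T) i : (phi (x, z) : 'rV[R]_n) 0 i = (z : 'rV[R]_n) 0 i + x * e 0 i.
  by rewrite /phi/= !mxE.
have mphi : measurable_fun setT phi.
  apply: measurable_fun_rV => i.
  rewrite (_ : (fun p => phi p 0 i) =
    (fun p : measurableTypeR R * T => (p.2 : 'rV[R]_n) 0 i + p.1 * e 0 i)); last first.
    by apply/funext => p; rewrite !mxE.
  apply: measurable_funD; first exact: (measurableT_comp (measurable_coord i)).
  exact: measurable_funM.
have [M ME] := ex_probability_push tau sigma mphi.
exists M; split.
  have mB : measurable (~` partial_box a k.+1 : set T) by exact: measurableC.
  transitivity (\int[M]_x (EFin \o (\1_(~` partial_box a k.+1) : T -> R)) x)%E.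
    by rewrite integral_indic ?setIT.
  rewrite ME; last 2 first.
  - by apply/measurable_EFinP; exact: measurable_indic.
  - by move=> x; rewrite /= lee_fin.
  have mI : measurable_fun setT (fun p : measurableTypeR R * T =>
      (EFin \o (\1_(~` partial_box a k.+1) : T -> R)) (phi p)).
    by apply: (measurableT_comp _ mphi); apply/measurable_EFinP; exact: measurable_indic.
  apply/eqP; rewrite eq_le; apply/andP; split; last first.
    by apply: integral_ge0 => x _; apply: integral_ge0 => z _; rewrite /= lee_fin.
  have mC : measurable (~` (`[(- a)%R, a]%classic : set R)) by apply: measurableC; exact: measurable_itv.
  have mS : measurable (~` partial_box a k : set T) by exact: measurableC.
  (* The sum leaves the new box only if [x] is off [[- a, a]], or if [z] is off the previous box;
     both events are null. *)
  apply: (@le_trans _ _ (\int[tau]_x ((EFin \o (\1_(~` `[(- a)%R, a]) : R -> R)) x))%E); last first.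
    by rewrite integral_indic ?setIT//= tau0.
  apply: ge0_le_integral => //.
  - by move=> x _; apply: integral_ge0 => z _; rewrite /= lee_fin.
  - by apply: (measurable_fun_fubini_tonelli_F _ mI) => p; rewrite /= lee_fin.
  - by apply/measurable_EFinP; exact: measurable_indic.
  move=> x _; have [ax|ax] := boolP (`|x| <= a); last first.
    rewrite /= [in leRHS]indicE mem_set/=; last by rewrite in_itv/= -ler_norml; exact/negP.
    apply: (@le_trans _ _ (\int[sigma]_z 1)%E); last by rewrite integral_cst// mul1e probability_le1.
    apply: ge0_le_integral => //.
    + exact: (measurableT_comp mI (pair1_measurable x)).
    + by move=> z _; rewrite lee_fin indicE lern1; case: (_ \in _).
  apply: (@le_trans _ _ (\int[sigma]_z ((EFin \o (\1_(~` partial_box a k) : T -> R)) z))%E).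
    apply: ge0_le_integral => //.
    + by move=> z _; rewrite /= lee_fin.
    + exact: (measurableT_comp mI (pair1_measurable x)).
    + by apply/measurable_EFinP; exact: measurable_indic.
    move=> z _; rewrite /= lee_fin !indicE !in_setC ler_nat.
    have [/set_mem zB|zB] := boolP (z \in partial_box a k); last by case: (_ \in _).
    rewrite mem_set// => i; rewrite phiE eE ltnS; have := zB i.
    case: (ltngtP i k) => _ /=; rewrite ?mulr0 ?addr0// normr_le0 => /eqP ->.
    by rewrite mulr1 add0r.
  by rewrite integral_indic ?setIT//= sigma0 lee_fin.
move=> r y r0; rewrite (ME _ (mE r y) (E0 r y)).
set C := (1 - gauss_tail t a)^-1; set u := Num.sqrt (r / (r + 2 * t)).
have C0 : 0 <= C by rewrite invr_ge0 subr_ge0 ltW.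
have u0 : 0 <= u by exact: sqrtr_ge0.
pose ko := Ordinal kn.
pose B := \sum_(i < n | i != ko) (y 0 i) ^+ 2 / weight t r k i.
pose K := (C * u) ^+ k * expR (- B).
have K0 : 0 <= K by rewrite mulr_ge0 ?expR_ge0// exprn_ge0// mulr_ge0.
have mf : measurable_fun setT (fun x : measurableTypeR R => (expR (- ((y 0 ko + x) ^+ 2 / r)))%:E).
  apply/measurable_EFinP; apply: measurableT_comp => //; apply: measurableT_comp => //.
  by apply: measurable_funM => //; apply: measurable_funX; exact: measurable_funD.
apply: (@le_trans _ _ (\int[tau]_x (K%:E * (expR (- ((y 0 ko + x) ^+ 2 / r)))%:E))%E).
  apply: ge0_le_integral => //.
  - by move=> x _; apply: integral_ge0 => z _; exact: E0.
  - apply: (measurable_fun_fubini_tonelli_F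
      (fun p => (expR (- (\sum_i ((y + phi p) 0 i) ^+ 2 / r)))%:E)) => [|p]; last by rewrite lee_fin expR_ge0.
    exact: (measurableT_comp (mE r y) mphi).
  - by apply: emeasurable_funM.
  move=> x _; have -> : (\int[sigma]_z (expR (- (\sum_i (y + phi (x, z)) 0 i ^+ 2 / r)))%:E =
      \int[sigma]_z (expR (- (\sum_i ((y + x *: e) + z) 0 i ^+ 2 / r)))%:E)%E.
    by apply: eq_integral => z _; rewrite /phi/= [_ + x *: e]addrC addrA.
  apply: le_trans (sigmaE r (y + x *: e) r0) _.
  have -> : \sum_i (y + x *: e) 0 i ^+ 2 / weight t r k i = B + (y 0 ko + x) ^+ 2 / r.
    have sE i : (y + x *: e) 0 i = y 0 i + x * e 0 i by rewrite !mxE.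
    rewrite (bigD1 ko)//= addrC; congr (_ + _); last first.
      by rewrite sE eE eqxx mulr1 /weight ltnn.
    apply: eq_bigr => i ik; rewrite sE eE.
    by have -> : (i == k :> nat) = false; [exact/negbTE|rewrite mulr0 addr0].
  by rewrite -/C -/u -EFinM lee_fin /K opprD expRD mulrA.
rewrite ge0_integralZl//.
apply: (@le_trans _ _ (K%:E * (C * (u * expR (- (y 0 ko ^+ 2 / (r + 2 * t)))))%:E)%E).
  by rewrite lee_wpmul2l ?lee_fin//; exact: tauE.
rewrite -EFinM lee_fin (exprSr _ k) /K (bigD1 ko)//= {1}/weight ltnS leqnn.
have -> : \sum_(i < n | i != ko) y 0 i ^+ 2 / weight t r k.+1 i = B.
  apply: eq_bigr => i ik; rewrite /weight ltnS leq_eqVlt.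
  by have -> : (i == k :> nat) = false by apply/negbTE.
rewrite opprD expRD le_eqVlt; apply/orP; left; apply/eqP; ring.
Qed.

Lemma ex_smear t a : 0 < t -> 0 < a -> gauss_tail t a < 1 ->
  exists sigma : probability T R,
    sigma (~` box a) = 0%E /\
    forall r y, 0 < r ->
    (\int[sigma]_z (expR (- (dotv (y + z) (y + z) / r)))%:E <=
     (((1 - gauss_tail t a)^-1 * Num.sqrt (r / (r + 2 * t))) ^+ n *
      expR (- (dotv y y / (r + 2 * t))))%:E)%E.
Proof.
move=> t0 a0 tail1; have [sigma [sigma0 sigmaE]] := ex_smear_partial t0 a0 tail1 (leqnn n).
exists sigma; split.
  have -> // : box a = partial_box a n.
  by apply/seteqP; split => z H i; have := H i; rewrite ltn_ord.
have dE (y : 'rV[R]_n) r : dotv y y / r = \sum_i (y 0 i) ^+ 2 / r.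
  by rewrite mulr_suml; apply: eq_bigr => i _; rewrite expr2.
move=> r y r0; rewrite !dE.
have -> : \sum_i y 0 i ^+ 2 / (r + 2 * t) = \sum_i y 0 i ^+ 2 / weight t r n i.
  by apply: eq_bigr => i _; rewrite /weight ltn_ord.
by under eq_integral do rewrite dE; exact: sigmaE.
Qed.

(** By Tonelli the bound for single Gaussians is integrated over the mixture in [r]; the integrand
    is extended by 0 to [r <= 0]. *)
Lemma smear_kap t a p (sigma : probability T R) : 0 < t -> gauss_tail t a < 1 ->
  (forall r y, 0 < r ->
    (\int[sigma]_z (expR (- (dotv (y + z) (y + z) / r)))%:E <=
     (((1 - gauss_tail t a)^-1 * Num.sqrt (r / (r + 2 * t))) ^+ n *
      expR (- (dotv y y / (r + 2 * t))))%:E)%E) ->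
  forall y, (\int[sigma]_z kap p (dotv (y + z) (y + z)) <=
    ((1 - gauss_tail t a)^-1 ^+ n)%:E * smeared_kap n p t (dotv y y))%E.
Proof.
move=> t0 tail1 sigmaE y.
set C := (1 - _)^-1 in sigmaE *.
have C0 : 0 <= C by rewrite invr_ge0 subr_ge0 ltW.
have mpos : measurable (`]0%R, +oo[%classic : set R) by exact: measurable_itv.
pose F (q : T * measurableTypeR R) := ((fun r => (heat p r (dotv (y + (q.1 : 'rV[R]_n)) (y + (q.1 : 'rV[R]_n))))%:E) \_ `]0%R, +oo[) q.2.
pose D : set (T * measurableTypeR R) := [set q | 0 < q.2].
have mD : measurable D.
  have -> : D = snd @^-1` `]0%R, +oo[ by apply/seteqP; split => q; rewrite /= in_itv/= andbT.
  by rewrite -[X in measurable X]setTI; exact: measurable_snd.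
have mz : measurable_fun setT (fun q : T * measurableTypeR R =>
    dotv (y + (q.1 : 'rV[R]_n)) (y + (q.1 : 'rV[R]_n))).
  have H i : measurable_fun setT (fun q : T * measurableTypeR R => (y + (q.1 : 'rV[R]_n)) 0 i).
    rewrite (_ : (fun q => _) = (fun q : T * measurableTypeR R => y 0 i + (q.1 : 'rV[R]_n) 0 i)); last first.
      by apply/funext => q; rewrite mxE.
    by apply: measurable_funD => //; exact: (measurableT_comp (measurable_coord i)).
  exact: measurable_dotv.
have FE : F = (fun q => (heat p q.2 (dotv (y + (q.1 : 'rV[R]_n)) (y + (q.1 : 'rV[R]_n))))%:E) \_ D.
  apply/funext => q; rewrite /F !patchE.
  by have -> : (q.2 \in (`]0%R, +oo[%classic : set R)) = (q \in D) by apply/idP/idP; rewrite !inE/= in_itv/= andbT.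
have mF : measurable_fun setT F.
  rewrite FE; apply/measurable_restrict => //; apply: measurable_funTS.
  by apply/measurable_EFinP; exact: measurable_heat.
have F0 q : (0 <= F q)%E by rewrite FE; apply: erestrict_ge0 => ? _; rewrite lee_fin heat_ge0.
have -> : (\int[sigma]_z kap p (dotv (y + z) (y + z)) =
    \int[sigma]_z \int[lebesgue_measure]_r F (z, r))%E.
  by apply: eq_integral => z _; rewrite /kap integral_mkcond.
rewrite fubini_tonelli// /smeared_kap -ge0_integralZl//; last 3 first.
- by apply: measurable_funTS; apply/measurable_EFinP; exact: measurable_smeared_heat.
- by move=> r _; rewrite lee_fin smeared_heat_ge0.
- by rewrite lee_fin exprn_ge0.
rewrite [leRHS]integral_mkcond; apply: ge0_le_integral => //.
- by move=> r _; apply: integral_ge0.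
- exact: (measurable_fun_fubini_tonelli_G _ mF).
- apply/measurable_restrict => //; apply: measurable_funTS.
  apply: emeasurable_funM => //; apply/measurable_EFinP; exact: measurable_smeared_heat.
move=> r _; rewrite patchE; case: ifPn => r0; last first.
  rewrite (eq_integral (cst 0%E)) ?integral0// => z _.
  by rewrite /F patchE (negPf r0).
move: (r0); rewrite inE/= in_itv/= andbT => rp.
have mE : measurable_fun setT (fun z : T => (expR (- (dotv (y + z) (y + z) / r)))%:E).
  apply/measurable_EFinP; apply: measurableT_comp => //; apply: measurableT_comp => //.
  apply: measurable_funM => //.
  exact: (measurableT_comp mz (pair2_measurable r)).
apply: (@le_trans _ _ ((r `^ (- p - 1))%:E * \int[sigma]_z (expR (- (dotv (y + z) (y + z) / r)))%:E)%E).
  rewrite -ge0_integralZl//.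
  - rewrite le_eqVlt; apply/orP; left; apply/eqP; apply: eq_integral => z _.
    by rewrite /F /= patchE r0 /heat EFinM.
  - by rewrite lee_fin powR_ge0.
apply: (@le_trans _ _ ((r `^ (- p - 1))%:E * ((C * Num.sqrt (r / (r + 2 * t))) ^+ n *
    expR (- (dotv y y / (r + 2 * t))))%:E)%E).
  by rewrite lee_wpmul2l ?lee_fin ?powR_ge0//; exact: sigmaE.
rewrite -!EFinM lee_fin /smeared_heat exprMn.
set A := r `^ _; set S := Num.sqrt _ ^+ n; set G := expR _.
lra.
Qed.

End gauss_space.

(** * The Riesz kernel as a mixture of Gaussians, and its potentials *)

Section riesz_kernel.
Context {R : realType} {n : nat}.
Local Notation T := (borelRn R n).
Variable lambda : R.
Hypothesis lambda_gt0 : 0 < lambda.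
Local Notation k := (@riesz R n lambda).
Local Notation p := (lambda / 2).

(** The inverse of [Gamma (lambda / 2)], the factor that turns [kap] into the Riesz kernel. *)
Definition riesz_cst (lambda : R) : R := (fine (kap (lambda / 2) 1))^-1.

Let p_gt0 : 0 < p. Proof. by rewrite divr_gt0. Qed.

Lemma kap1_fin_num : kap p 1 \is a fin_num.
Proof. by rewrite ge0_fin_numE ?kap_ge0// kap1_lty. Qed.

Lemma riesz_cst_gt0 : 0 < riesz_cst lambda.
Proof. by rewrite invr_gt0 fine_gt0// kap1_gt0// kap1_lty. Qed.

Lemma riesz_ge0 x y : (0 <= k x y)%E.
Proof. by rewrite /riesz; case: ifP => // _; rewrite lee_fin powR_ge0. Qed.

Lemma riesz_sym x y : k x y = k y x.
Proof. by rewrite /riesz eq_sym enormB. Qed.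

Lemma riesz_kap x y : k x y = ((riesz_cst lambda)%:E * kap p (dotv (x - y) (x - y)))%E.
Proof.
rewrite /riesz; case: eqVneq => [->|xy].
  have -> : dotv (y - y) (y - y) = 0 by rewrite -sqr_enorm subrr enorm0 expr0n.
  by rewrite kap0// gt0_muley// lte_fin riesz_cst_gt0.
have xy0 : 0 < enorm (x - y) by rewrite enorm_gt0 subr_eq0.
rewrite kapE -?sqr_enorm ?exprn_gt0// -(fineK kap1_fin_num) -!EFinM /riesz_cst; congr EFin.
rewrite mulrCA mulVf ?mulr1; last by rewrite gt_eqF// fine_gt0// kap1_gt0// kap1_lty.
by rewrite -powR_mulrn ?(ltW xy0)// -powRrM; congr (_ `^ _); field.
Qed.

Lemma riesz_le A x x' y : 0 < A -> enorm (x - y) <= A * enorm (x' - y) ->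
  (k x' y <= (A `^ lambda)%:E * k x y)%E.
Proof.
move=> A0; rewrite /riesz.
have Al : 0 < A `^ lambda by rewrite powR_gt0.
have [->|xy] := eqVneq x y; first by rewrite gt0_muley ?lte_fin// leey.
have xy0 : 0 < enorm (x - y) by rewrite enorm_gt0 subr_eq0.
have [->|x'y] := eqVneq x' y; first by rewrite subrr enorm0 mulr0 leNgt xy0.
have x'y0 : 0 < enorm (x' - y) by rewrite enorm_gt0 subr_eq0.
move=> H; rewrite -EFinM lee_fin !powRN ler_pdivlMr ?powR_gt0//.
rewrite mulrC ler_pdivrMr ?powR_gt0//.
rewrite -powRM ?(ltW A0) ?enorm_ge0//.
by apply: ge0_ler_powR; rewrite ?nnegrE ?enorm_ge0 ?(ltW lambda_gt0) ?mulr_ge0 ?enorm_ge0 ?(ltW A0).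
Qed.

Lemma riesz_far d x y : 0 < d -> d <= enorm (x - y) -> (k x y <= (d `^ (- lambda))%:E)%E.
Proof.
move=> d0 dxy; have xy0 : 0 < enorm (x - y) by apply: lt_le_trans dxy.
rewrite /riesz ifF; last by rewrite -subr_eq0 -enorm_eq0 gt_eqF.
rewrite lee_fin !powRN lef_pV2 ?posrE ?powR_gt0//.
by apply: ge0_ler_powR; rewrite ?nnegrE ?enorm_ge0 ?(ltW lambda_gt0) ?(ltW d0).
Qed.

Lemma measurable_rVB d (X : measurableType d) (f g : X -> 'rV[R]_n) :
  (forall i, measurable_fun setT (fun x => f x 0 i)) ->
  (forall i, measurable_fun setT (fun x => g x 0 i)) ->
  forall i, measurable_fun setT (fun x => (f x - g x) 0 i).
Proof.
move=> mf mg i; rewrite (_ : (fun x => _) = (fun x => f x 0 i - g x 0 i)).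
  exact: measurable_funB.
by apply/funext => x; rewrite !mxE.
Qed.

Lemma measurable_rVD d (X : measurableType d) (f g : X -> 'rV[R]_n) :
  (forall i, measurable_fun setT (fun x => f x 0 i)) ->
  (forall i, measurable_fun setT (fun x => g x 0 i)) ->
  forall i, measurable_fun setT (fun x => (f x + g x) 0 i).
Proof.
move=> mf mg i; rewrite (_ : (fun x => _) = (fun x => f x 0 i + g x 0 i)).
  exact: measurable_funD.
by apply/funext => x; rewrite !mxE.
Qed.

Lemma measurable_coord_comp d (X : measurableType d) (f : X -> T) :
  measurable_fun setT f -> forall i, measurable_fun setT (fun x => (f x : 'rV[R]_n) 0 i).
Proof. by move=> mf i; exact: (measurableT_comp (measurable_coord i) mf). Qed.

Lemma measurable_enormB d (X : measurableType d) (f g : X -> T) :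
  measurable_fun setT f -> measurable_fun setT g ->
  measurable_fun setT (fun x => enorm ((f x : 'rV[R]_n) - g x)).
Proof.
move=> mf mg; apply: (measurableT_comp measurable_sqrtr).
have H := measurable_rVB (measurable_coord_comp mf) (measurable_coord_comp mg).
exact: measurable_dotv.
Qed.

Lemma measurable_riesz d (X : measurableType d) (f g : X -> T) :
  measurable_fun setT f -> measurable_fun setT g ->
  measurable_fun setT (fun x => k (f x) (g x)).
Proof.
move=> mf mg; have mN := measurable_enormB mf mg.
rewrite (_ : (fun x => _) = (fun x => if 0 < enorm ((f x : 'rV[R]_n) - g x)
    then (enorm ((f x : 'rV[R]_n) - g x) `^ (- lambda))%:E else +oo%E)).
  apply: measurable_fun_ifT.
  - exact: measurable_fun_ltr.
  - by apply/measurable_EFinP; exact: (measurableT_comp (measurable_powR _) mN).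
  - exact: measurable_cst.
apply/funext => x; rewrite /riesz enorm_gt0 subr_eq0.
by case: eqVneq.
Qed.

Definition potential (P : probability T R) (x : 'rV[R]_n) : \bar R :=
  (\int[P]_y k x y)%E.

Lemma potential_ge0 P x : (0 <= potential P x)%E.
Proof. by apply: integral_ge0 => y _; exact: riesz_ge0. Qed.

Lemma measurable_riesz1 x : measurable_fun setT (fun y : T => k x y).
Proof. exact: measurable_riesz. Qed.

Lemma measurable_riesz_pair : measurable_fun setT (fun z : T * T => k z.1 z.2).
Proof. by apply: measurable_riesz; [exact: measurable_fst|exact: measurable_snd]. Qed.

Lemma measurable_potential P : measurable_fun setT (potential P : T -> \bar R).
Proof.
by apply: (measurable_fun_fubini_tonelli_F _ measurable_riesz_pair) => z; exact: riesz_ge0.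
Qed.

Lemma potential_exchange (P Q : probability T R) :
  (\int[P]_x potential Q x = \int[Q]_x potential P x)%E.
Proof.
rewrite /potential (fubini_tonelli _ measurable_riesz_pair); last by move=> z; exact: riesz_ge0.
apply: eq_integral => x _; apply: eq_integral => y _ /=; exact: riesz_sym.
Qed.

Lemma energyE (P : probability T R) : (diam (supp P) <= 1)%E ->
  energy lambda P = (\int[P]_x potential P x)%E.
Proof.
move=> P1; rewrite /energy P1; apply: eq_integral => y _.
by apply: eq_integral => x _; rewrite riesz_sym.
Qed.

Lemma smear_riesz t a (sigma : probability T R) : 0 < t -> gauss_tail t a < 1 ->
  (forall r (y : 'rV[R]_n), 0 < r ->
    (\int[sigma]_z (expR (- (dotv (y + z) (y + z) / r)))%:E <=
     (((1 - gauss_tail t a)^-1 * Num.sqrt (r / (r + 2 * t))) ^+ n *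
      expR (- (dotv y y / (r + 2 * t))))%:E)%E) ->
  forall x y, (\int[sigma]_z k (x + z) y <=
    ((riesz_cst lambda) * (1 - gauss_tail t a)^-1 ^+ n)%:E *
      smeared_kap n p t (dotv (x - y) (x - y)))%E.
Proof.
move=> t0 tail1 sigmaE x y.
have := smear_kap p t0 tail1 sigmaE (x - y).
rewrite EFinM -muleA => H.
apply: le_trans (lee_wpmul2l _ H); last by rewrite lee_fin (ltW riesz_cst_gt0).
rewrite le_eqVlt; apply/orP; left; apply/eqP.
have kE z : kap p (dotv (x - y + z) (x - y + z)) = ((riesz_cst lambda)^-1%:E * k (x + z) y)%E.
  have c1 : (riesz_cst lambda)^-1 * riesz_cst lambda = 1 by rewrite mulVf// gt_eqF// riesz_cst_gt0.
  by rewrite riesz_kap muleA -EFinM c1 mul1e addrAC.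
under [in RHS]eq_integral do rewrite kE.
rewrite ge0_integralZl//; last 3 first.
- apply: measurable_riesz => //; apply: measurable_fun_rV.
  by apply: measurable_rVD => // i; exact: measurable_coord.
- by move=> z _; exact: riesz_ge0.
- by rewrite lee_fin invr_ge0 (ltW riesz_cst_gt0).
by rewrite muleA -EFinM mulfV ?mul1e ?(gt_eqF riesz_cst_gt0).
Qed.

End riesz_kernel.

(** * Variational inequalities for a minimizer *)

Section gauss_tail_decay.
Context {R : realType}.
Implicit Types (a t x : R).

Lemma expR_ge_expn x m : 0 <= x -> (x / m.+1%:R) ^+ m.+1 <= expR x.
Proof.
move=> x0; have -> : expR x = expR (x / m.+1%:R) ^+ m.+1.
  by rewrite -expRM_natl mulrC divfK.
rewrite lerXn2r ?nnegrE ?expR_ge0 ?divr_ge0//.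
by apply: le_trans (expR_ge1Dx _); rewrite lerDr.
Qed.

Lemma gauss_tail_decay a m : 0 < a ->
  exists2 K, 0 < K & forall t, 0 < t -> gauss_tail t a <= K * t ^+ m.+1.
Proof.
move=> a0; pose c := 4 * m.+1%:R / a ^+ 2.
have c0 : 0 < c by rewrite divr_gt0 ?mulr_gt0 ?exprn_gt0.
have s2 : 0 < Num.sqrt 2 :> R by rewrite sqrtr_gt0.
exists (Num.sqrt 2 * c ^+ m.+1); first by rewrite mulr_gt0 ?exprn_gt0.
move=> t t0; rewrite /gauss_tail -[leRHS]mulrA ler_wpM2l ?(ltW s2)// -exprMn expRN.
have x0 : 0 < a ^+ 2 / (4 * t) by rewrite divr_gt0 ?exprn_gt0 ?mulr_gt0.
have := expR_ge_expn m (ltW x0).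
have -> : a ^+ 2 / (4 * t) / m.+1%:R = (c * t)^-1.
  by rewrite /c; field; rewrite !gt_eqF//= ?exprn_gt0//.
rewrite exprVn => H; rewrite -[leRHS]invrK lef_pV2 ?posrE ?expR_gt0//.
by rewrite invr_gt0 exprn_gt0// mulr_gt0.
Qed.

Lemma ex_gauss_tail_le a e : 0 < a -> 0 < e -> exists2 t, 0 < t & gauss_tail t a <= e.
Proof.
move=> a0 e0; have [K K0 KP] := gauss_tail_decay 0 a0.
exists (e / K); first by rewrite divr_gt0.
apply: le_trans (KP _ _) _; first by rewrite divr_gt0.
by rewrite expr1 mulrC divfK ?gt_eqF.
Qed.

End gauss_tail_decay.

(** * Supports, diameters and convolution *)

Section supports.
Context {R : realType} {n : nat}.
Local Notation T := (borelRn R n).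
Implicit Types (P mu nu : probability T R).

Lemma probability_integral_cst d (X : measurableType d) (P : probability X R) (c : R) :
  (\int[P]_x c%:E = c%:E)%E.
Proof.
rewrite (integral_cst P measurableT) -[RHS]mule1; congr (_ * _)%E.
exact: probability_setT.
Qed.

Lemma ge0_integral_supp d (X : measurableType d) (m : {measure set X -> \bar R}) (A : set X)
    (f : X -> \bar R) :
  measurable A -> m (~` A) = 0%E -> measurable_fun setT f -> (forall x, (0 <= f x)%E) ->
  (\int[m]_x f x = \int[m]_(x in A) f x)%E.
Proof.
move=> mA A0 mf f0.
by rewrite [LHS](ge0_negligible_integral (N := ~` A))// ?setTD ?setCK//; exact: measurableC.
Qed.

Lemma ge0_integral_null d (X : measurableType d) (m : {measure set X -> \bar R}) (A : set X)
    (f : X -> \bar R) :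
  measurable A -> m (~` A) = 0%E -> measurable_fun setT f -> (forall x, (0 <= f x)%E) ->
  (forall x, A x -> f x = 0%E) -> (\int[m]_x f x = 0)%E.
Proof.
move=> mA A0 mf f0 fA; rewrite (ge0_integral_supp mA)//.
by rewrite (eq_integral (cst 0%E)) ?integral0// => x /[!inE]; exact: fA.
Qed.

Lemma measurable_EFin_indic d (X : measurableType d) (A : set X) : measurable A ->
  measurable_fun setT (EFin \o (\1_A : X -> R)).
Proof. by move=> mA; apply/measurable_EFinP; exact: measurable_indic. Qed.

Lemma measure_integral d (X : measurableType d) (m : {measure set X -> \bar R}) (A : set X) :
  measurable A -> m A = (\int[m]_x (EFin \o (\1_A : X -> R)) x)%E.
Proof. by move=> mA; rewrite integral_indic ?setIT. Qed.

Lemma supp_sub P (C : set 'rV[R]_n) : closed C -> P (~` C) = 0%E -> supp P `<=` C.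
Proof.
move=> cC P0 x xP; apply: contrapT => nCx.
by have := xP (~` C) (closed_openC cC) nCx; rewrite P0 ltxx.
Qed.

Lemma diam_le1P (A : set 'rV[R]_n) :
  (diam A <= 1)%E <-> forall x y, A x -> A y -> enorm (x - y) <= 1.
Proof.
split=> [A1 x y Ax Ay|A1].
  rewrite -lee_fin; apply: le_trans A1; apply: ereal_sup_ubound.
  by exists x => //; exists y.
by apply: ge_ereal_sup => _ [x Ax [y Ay <-]]; rewrite lee_fin; exact: A1.
Qed.

Lemma measurable_addv (x : 'rV[R]_n) : measurable_fun setT (fun z : T => x + z : T).
Proof.
by apply: measurable_fun_rV; apply: measurable_rVD => // i; exact: measurable_coord.
Qed.

Lemma ex_smeared (P sigma : probability T R) (A B C : set 'rV[R]_n) :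
  measurable (A : set T) -> measurable (B : set T) -> measurable (C : set T) ->
  P (~` A) = 0%E -> sigma (~` B) = 0%E -> (forall x z, A x -> B z -> C (x + z)) ->
  exists nu : probability T R, nu (~` C) = 0%E /\
    forall f : T -> \bar R, measurable_fun setT f -> (forall x, (0 <= f x)%E) ->
    (\int[nu]_x f x = \int[P]_x \int[sigma]_z f ((x : 'rV[R]_n) + z)%R)%E.
Proof.
move=> mA mB mC PA sB ABC.
have mphi : measurable_fun setT (fun q : T * T => (q.1 : 'rV[R]_n) + q.2 : T).
  apply: measurable_fun_rV; apply: measurable_rVD.
    exact: (measurable_coord_comp measurable_fst).
  exact: (measurable_coord_comp measurable_snd).
have [nu nuE] := ex_probability_push P sigma mphi.
exists nu; split=> //.
have mI := measurable_EFin_indic (measurableC mC).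
have I0 x : (0 <= (EFin \o (\1_(~` C) : T -> R)) x)%E by rewrite /= lee_fin.
rewrite measure_integral; last exact: measurableC.
rewrite nuE//; apply: (ge0_integral_null mA) => //.
- apply: (measurable_fun_fubini_tonelli_F (fun q : T * T =>
    (EFin \o (\1_(~` C) : T -> R)) ((q.1 : 'rV[R]_n) + q.2))) => [|q]; last exact: I0.
  exact: (measurableT_comp mI mphi).
- by move=> x; apply: integral_ge0 => z _; exact: I0.
move=> x Ax; apply: (ge0_integral_null mB) => //.
- exact: (measurableT_comp mI (measurable_addv x)).
by move=> z Bz; rewrite /= indicE memNset//; apply; exact: ABC.
Qed.

Lemma measurable_box (a : R) : measurable (box a : set T).
Proof.
have -> : box a = \bigcap_(i in [set: 'I_n])
    ((fun x : 'rV[R]_n => x 0 i) @^-1` [set u : R | `|u| <= a]).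
  by apply/seteqP; split => x H i; [move=> _; exact: H|exact: (H i I)].
apply: fin_bigcap_measurable => // i _; rewrite -[X in measurable X]setTI.
apply: measurable_coord => //; rewrite -[X in measurable X]setTI.
by apply: measurable_fun_le => //; exact: measurableT_comp.
Qed.

End supports.

Section smears.
Context {R : realType} {n : nat}.
Local Notation T := (borelRn R n).
Implicit Types (P sigma : probability T R).

(* [sigma] stands for a Gaussian of variance [t] truncated to the box: it acts on
   Gaussians as the untruncated one does, up to the factor [(1 - gauss_tail t a)^-n]. *)
Definition is_smear (t a : R) sigma : Prop :=
  [/\ 0 < t, gauss_tail t a < 1, sigma (~` box a) = 0%E &
    forall r (y : 'rV[R]_n), 0 < r ->
    (\int[sigma]_z (expR (- (dotv (y + z) (y + z) / r)))%:E <=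
     (((1 - gauss_tail t a)^-1 * Num.sqrt (r / (r + 2 * t))) ^+ n *
      expR (- (dotv y y / (r + 2 * t))))%:E)%E].

Lemma ex_is_smear t a : 0 < t -> 0 < a -> gauss_tail t a < 1 ->
  exists sigma, is_smear t a sigma.
Proof.
by move=> t0 a0 tail1; have [sigma [? ?]] := @ex_smear R n t a t0 a0 tail1; exists sigma.
Qed.

Definition smear_of P sigma (nu : probability T R) : Prop :=
  forall f : T -> \bar R, measurable_fun setT f -> (forall x, (0 <= f x)%E) ->
    (\int[nu]_x f x = \int[P]_x \int[sigma]_z f ((x : 'rV[R]_n) + z)%R)%E.

End smears.

Section energy.
Context {R : realType} {n : nat}.
Local Notation T := (borelRn R n).
Variable lambda : R.
Hypothesis lambda_gt0 : 0 < lambda.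
Hypothesis lambda_ltn : lambda < n%:R.
Local Notation k := (@riesz R n lambda).
Local Notation p := (lambda / 2).
Local Notation U := (@potential R n lambda).
Local Notation I P := (\int[P]_x U P x)%E.
Implicit Types (P Q mu nu sigma : probability T R).

(** Why smears are admissible competitors: a smeared point mass has a bounded potential, so a smear
    of any probability has finite energy. *)
Lemma smear_bounded t a sigma : is_smear t a sigma ->
  exists2 M : R, 0 <= M & forall x y, (\int[sigma]_z k (x + z) y <= M%:E)%E.
Proof.
move=> [t0 tail1 _ sigmaE].
have fin : smeared_kap n p t 0 \is a fin_num.
  rewrite ge0_fin_numE; first by apply: smeared_kap_lty => //; [rewrite divr_gt0|rewrite mulrC divfK].
  by apply: integral_ge0 => r _; rewrite lee_fin smeared_heat_ge0.
have C0 : 0 <= (1 - gauss_tail t a)^-1 by rewrite invr_ge0 subr_ge0 ltW.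
exists (riesz_cst lambda * (1 - gauss_tail t a)^-1 ^+ n * fine (smeared_kap n p t 0)).
  rewrite !mulr_ge0 ?exprn_ge0 ?(ltW (riesz_cst_gt0 lambda_gt0)) ?fine_ge0//.
  by apply: integral_ge0 => r _; rewrite lee_fin smeared_heat_ge0.
move=> x y; apply: le_trans (smear_riesz lambda_gt0 t0 tail1 sigmaE x y) _.
rewrite [leRHS]EFinM fineK// lee_wpmul2l ?lee_fin ?mulr_ge0 ?exprn_ge0 ?(ltW (riesz_cst_gt0 lambda_gt0))//.
by apply: le_smeared_kap => //; exact: dotv_ge0.
Qed.

Lemma measurable_smear_riesz sigma y :
  measurable_fun setT (fun x : T => (\int[sigma]_z k ((x : 'rV[R]_n) + z) y)%E).
Proof.
apply: (measurable_fun_fubini_tonelli_F (fun q : T * T => k ((q.1 : 'rV[R]_n) + q.2) y)) => [|q].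
  apply: measurable_riesz => //; apply: measurable_fun_rV; apply: measurable_rVD.
    exact: (measurable_coord_comp measurable_fst).
  exact: (measurable_coord_comp measurable_snd).
exact: riesz_ge0.
Qed.

Lemma smeared_energy_lty t a P sigma nu : is_smear t a sigma -> smear_of P sigma nu ->
  (I nu < +oo)%E.
Proof.
move=> /smear_bounded[M M0 MP] nuE.
apply: (@le_lt_trans _ _ M%:E); last exact: ltry.
have UM x : (U nu x <= M%:E)%E.
  have -> : U nu x = (\int[P]_y \int[sigma]_z k ((y : 'rV[R]_n) + z)%R x)%E.
    rewrite /potential nuE; [|exact: measurable_riesz1|by move=> z; exact: riesz_ge0].
    by apply: eq_integral => y _; apply: eq_integral => z _; exact: riesz_sym.
  apply: (@le_trans _ _ (\int[P]_y M%:E)%E).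
    apply: ge0_le_integral => //.
    - by move=> y _; apply: integral_ge0 => z _; exact: riesz_ge0.
    - exact: measurable_smear_riesz.
  by rewrite probability_integral_cst.
apply: (@le_trans _ _ (\int[nu]_y M%:E)%E).
  apply: ge0_le_integral => //.
  - by move=> y _; exact: potential_ge0.
  - exact: measurable_potential.
by rewrite probability_integral_cst.
Qed.

Lemma diam_supp_le1 P (C : set 'rV[R]_n) : closed C -> P (~` C) = 0%E ->
  (forall x y, C x -> C y -> enorm (x - y) <= 1) ->
  (diam (supp P) <= 1)%E.
Proof.
move=> cC PC C1; apply/diam_le1P => x y /(supp_sub cC PC) Cx /(supp_sub cC PC) Cy.
exact: C1.
Qed.

Lemma minimizer_finite mu : (0 < n)%N -> minimizes_energy lambda mu ->
  (diam (supp mu) <= 1)%E /\ (I mu < +oo)%E.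
Proof.
move=> n0 mumin.
(* Two points of the box differ by at most [1 / n] in each coordinate, hence by at most 1 in
   Euclidean norm. Below, [2^-1] serves only to have a tail smaller than 1. *)
pose a : R := (2 * n%:R)^-1.
have n0' : 0 < n%:R :> R by rewrite ltr0n.
have a0 : 0 < a by rewrite invr_gt0 mulr_gt0.
have h0 : 0 < 2^-1 :> R by [].
have [t t0 ta] := ex_gauss_tail_le a0 h0.
have [|sigma sigmaP] := @ex_is_smear R n t a t0 a0; first by lra.
have [_ _ sigmaB _] := sigmaP.
have cB : closed (box a : set 'rV[R]_n).
  have -> : box a = closed_ball_ Num.norm (0 : 'rV[R]_n) a.
    apply/seteqP; split => z; rewrite /box /closed_ball_/= sub0r normrN.
      move=> H; rewrite /Num.norm/= mx_normrE; apply/bigmax_leP; split; first exact: ltW.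
      by case=> i j _ /=; rewrite (ord1 i).
    by move=> H i; apply: le_trans H; exact: coord_le_mx_norm.
  exact: closed_closed_ball_.
have mB := @measurable_box R n a.
have m0 : measurable ([set 0 : 'rV[R]_n] : set T).
  apply: borel_closed; apply: compact_closed => //; exact: compact_set1.
have dir0 : (dirac (0 : T) : probability T R) (~` [set 0]) = 0%E.
  by rewrite /= diracE memNset//; apply.
have sum0 (x z : 'rV[R]_n) : [set 0] x -> box a z -> box a (x + z).
  by move=> ->; rewrite add0r.
have [nu [nuB nuE]] := ex_smeared m0 mB mB dir0 sigmaB sum0.
have nuI := smeared_energy_lty sigmaP nuE.
have nu1 : (diam (supp nu) <= 1)%E.
  apply: diam_supp_le1 cB nuB _ => x y Bx By.
  have -> : 1 = n%:R * (a + a) :> R by rewrite /a; field; rewrite gt_eqF.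
  apply: enorm_le_coord => i; rewrite !mxE.
  by apply: le_trans (ler_normB _ _) _; apply: lerD; [exact: Bx|exact: By].
have : (energy lambda mu < +oo)%E.
  by apply: le_lt_trans (mumin nu) _; rewrite energyE.
have [mu1|mu1] := boolP (diam (supp mu) <= 1)%E; first by rewrite energyE.
by rewrite /energy (negPf mu1) ltxx.
Qed.

Lemma mix_energy P Q (M : probability T R) (t : R) : 0 <= t <= 1 ->
  (forall f : T -> \bar R, measurable_fun setT f -> (forall x, (0 <= f x)%E) ->
    (\int[M]_x f x = (1 - t)%:E * \int[P]_x f x + t%:E * \int[Q]_x f x)%E) ->
  (I M = ((1 - t) ^+ 2)%:E * I P + (2 * (t * (1 - t)))%:E * \int[Q]_x U P x
         + (t ^+ 2)%:E * I Q)%E.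
Proof.
move=> /andP[t0 t1] ME; have t1' : 0 <= 1 - t by rewrite subr_ge0.
have UE x : U M x = ((1 - t)%:E * U P x + t%:E * U Q x)%E.
  rewrite {1}/potential ME//; [exact: measurable_riesz1|by move=> y; exact: riesz_ge0].
have U0 N x : (0 <= U N x)%E by exact: potential_ge0.
have mU N := @measurable_potential R n lambda N.
have IE (N : probability T R) : (\int[N]_x U M x = (1 - t)%:E * \int[N]_x U P x + t%:E * \int[N]_x U Q x)%E.
  under eq_integral do rewrite UE.
  rewrite ge0_integralD//; last 4 first.
  - by move=> x _; rewrite mule_ge0.
  - exact: measurable_funeM.
  - by move=> x _; rewrite mule_ge0.
  - exact: measurable_funeM.
  by rewrite !ge0_integralZl.
rewrite ME; [|exact: mU|exact: U0].
rewrite !IE (potential_exchange lambda P Q).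
set A := (\int[P]_x _)%E; set B := (\int[Q]_x U P x)%E; set D := (\int[Q]_x _)%E.
have A0 : (0 <= A)%E by apply: integral_ge0.
have B0 : (0 <= B)%E by apply: integral_ge0.
have D0 : (0 <= D)%E by apply: integral_ge0.
have t0e : (0 <= t%:E)%E by rewrite lee_fin.
have t1e : (0 <= (1 - t)%:E)%E by rewrite lee_fin.
have t1A : (0 <= (1 - t)%:E * A)%E by exact: mule_ge0.
have t1B : (0 <= (1 - t)%:E * B)%E by exact: mule_ge0.
have tB : (0 <= t%:E * B)%E by exact: mule_ge0.
have tD : (0 <= t%:E * D)%E by exact: mule_ge0.
rewrite (ge0_muleDr _ t1A tB) (ge0_muleDr _ t1B tD).
rewrite !muleA -!EFinM -!expr2 -addeA -[RHS]addeA; congr (_ + _)%E.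
rewrite addeA -ge0_muleDl ?lee_fin ?mulr_ge0// -EFinD.
by congr (_%:E * _ + _)%E; ring.
Qed.

(* First variation along the segment from [mu] to [nu]. *)
Lemma minimizer_potential mu nu (W : set 'rV[R]_n) : (0 < n)%N ->
  minimizes_energy lambda mu -> closed W ->
  (forall x y, W x -> W y -> enorm (x - y) <= 1) ->
  mu (~` W) = 0%E -> nu (~` W) = 0%E -> (I nu < +oo)%E ->
  (I mu <= \int[nu]_x U mu x)%E.
Proof.
move=> n0 mumin cW W1 muW nuW nufin.
have [mu1 mufin] := minimizer_finite n0 mumin.
have mW := borel_closed cW.
have U0 N x : (0 <= U N x)%E by exact: potential_ge0.
have I0 (N N' : probability T R) : (0 <= \int[N]_x U N' x)%E by apply: integral_ge0.
have muF : I mu \is a fin_num by rewrite ge0_fin_numE.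
have nuF : I nu \is a fin_num by rewrite ge0_fin_numE.
rewrite leNgt; apply/negP => lt.
have crossF : (\int[nu]_x U mu x)%E \is a fin_num.
  by rewrite ge0_fin_numE// (lt_trans lt).
pose e := fine (I mu); pose f := fine (\int[nu]_x U mu x)%E; pose g := fine (I nu).
have fe : f < e by rewrite -lte_fin !fineK.
have e0 : 0 <= e by rewrite fine_ge0.
have f0 : 0 <= f by rewrite fine_ge0.
have g0 : 0 <= g by rewrite fine_ge0.
(* The mixture has energy [e - 2 t (e - f) + t^2 (e - 2 f + g)]. This [t] makes [t (e - 2 f + g)] at
   most [e - f], so that the linear term wins and the energy is below [e]. *)
pose t := (e - f) / (e + g + 1).
have d0 : 0 < e + g + 1 by lra.
have t0 : 0 < t by rewrite divr_gt0// subr_gt0.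
have t1 : t <= 1 by rewrite ler_pdivrMr//; lra.
have t01 : 0 <= t <= 1 by rewrite (ltW t0).
have [M ME] := ex_probability_mix mu nu t01.
have MW : M (~` W) = 0%E.
  have mCW := measurableC mW.
  rewrite measure_integral// ME; last 2 first.
  - exact: measurable_EFin_indic.
  - by move=> x; rewrite /= lee_fin.
  have muI := esym (measure_integral mu mCW).
  have nuI := esym (measure_integral nu mCW).
  by rewrite (etrans muI muW) (etrans nuI nuW) !mule0 adde0.
have := mumin M; rewrite !energyE//; last exact: diam_supp_le1 cW MW W1.
rewrite (mix_energy t01 ME) -(fineK muF) -(fineK nuF) -(fineK crossF) -!EFinM -!EFinD lee_fin.
rewrite -/e -/f -/g => H.
have tE : t * (e + g + 1) = e - f by rewrite divfK// gt_eqF.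
suff : t * (2 * (e - f)) <= t * (t * (e - 2 * f + g)).
  by rewrite ler_pM2l//; have := mulr_ge0 (ltW t0) f0; lra.
by lra.
Qed.

End energy.

(** Let [A] tend to 1. If [u < e], then [A = (e / u)^(1 / (2 l))] already contradicts the
    assumption, because [A^l * u = sqrt (e u) < e]. *)
Lemma le_of_powR_le {R : realType} (l e u : R) : 0 < l -> 0 <= u ->
  (forall A, 1 < A -> e <= A `^ l * u) -> e <= u.
Proof.
move=> l0 u0 H; rewrite leNgt; apply/negP => ue.
have [u00|u00] := eqVneq u 0.
  have h : 1 < 2 :> R by lra.
  by have := H 2 h; rewrite u00 mulr0; lra.
have up : 0 < u by rewrite lt_def u00.
have B1 : 1 < e / u by rewrite ltr_pdivlMr// mul1r.
have lnB : 0 < ln (e / u) by rewrite ln_gt0.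
pose A := expR (ln (e / u) / (2 * l)).
have A1 : 1 < A by rewrite expR_gt1 divr_gt0// mulr_gt0.
have := H A A1; rewrite leNgt => /negP; apply.
rewrite -ltr_pdivlMr// /powR gt_eqF ?expR_gt0// /A expRK.
have -> : l * (ln (e / u) / (2 * l)) = ln (e / u) / 2 by field; rewrite gt_eqF.
have B0 : 0 < e / u by apply: lt_trans B1.
by rewrite -[ltRHS](lnK B0) ltr_expR; lra.
Qed.

(** * The potential of a minimizer against the minimal energy [E] *)

Section minimizer.
Context {R : realType} {n : nat}.
Local Notation T := (borelRn R n).
Variable lambda : R.
Hypothesis n_gt0 : (0 < n)%N.
Hypothesis lambda_gt0 : 0 < lambda.
Hypothesis lambda_ltn : lambda < n%:R.
Variable mu : probability T R.
Hypothesis mu_min : minimizes_energy lambda mu.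
Variable W : set 'rV[R]_n.
Hypothesis W_complete : unit_complete W.
Hypothesis supp_W : supp mu `<=` W.
Local Notation k := (@riesz R n lambda).
Local Notation U := (@potential R n lambda mu).
Local Notation p := (lambda / 2).

Definition min_energy : R := fine (\int[mu]_x U x)%E.
Local Notation E := min_energy.

Lemma min_energyE : (\int[mu]_x U x)%E = E%:E.
Proof.
have [_ H] := minimizer_finite lambda_gt0 lambda_ltn n_gt0 mu_min.
rewrite fineK// ge0_fin_numE//; apply: integral_ge0 => x _; exact: potential_ge0.
Qed.

Lemma min_energy_ge0 : 0 <= E.
Proof. by rewrite fine_ge0//; apply: integral_ge0 => x _; exact: potential_ge0. Qed.

Let W1 x y : W x -> W y -> enorm (x - y) <= 1.
Proof. exact: unit_complete_dist. Qed.

Let cW : closed W. Proof. exact: unit_complete_closed. Qed.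

Let mW : measurable (W : set T). Proof. exact: borel_closed. Qed.

Lemma measurable_supp : measurable (supp mu : set T).
Proof. by apply: borel_closed; exact: closed_supp. Qed.

Lemma mu_setCW : mu (~` W) = 0%E.
Proof.
apply/eqP; rewrite eq_le measure_ge0 andbT -(supp_setC mu).
apply: le_measure; rewrite ?inE; last exact: subsetC.
- exact: measurableC.
- by apply: measurableC; exact: measurable_supp.
Qed.

Let mU : measurable_fun setT (U : T -> \bar R).
Proof. exact: measurable_potential. Qed.

Let U0 x : (0 <= U x)%E. Proof. exact: potential_ge0. Qed.

Lemma min_energy_le (nu : probability T R) : nu (~` W) = 0%E ->
  (\int[nu]_x potential lambda nu x < +oo)%E -> (E%:E <= \int[nu]_x U x)%E.
Proof.
move=> nuW nufin; rewrite -min_energyE.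
exact: (minimizer_potential lambda_gt0 lambda_ltn n_gt0 mu_min cW W1 mu_setCW).
Qed.

(* Test the first variation with [mu] conditioned on the complement of [A]. *)
Lemma integral_potential_le (A : set T) : measurable A ->
  (\int[mu]_(x in A) U x <= E%:E * mu A)%E.
Proof.
move=> mA; have mA' := measurableC mA.
have split : (\int[mu]_(x in A) U x + \int[mu]_(x in ~` A) U x = E%:E)%E.
  rewrite -min_energyE -ge0_integral_setU//.
  - by rewrite setUv.
  - by rewrite setUv.
  - by apply/disj_set2P; rewrite setICr.
have a0 : (0 <= \int[mu]_(x in A) U x)%E by apply: integral_ge0.
have a0' : (0 <= \int[mu]_(x in ~` A) U x)%E by apply: integral_ge0.
have muA1 : (mu A + mu (~` A) = 1)%E.
  by rewrite -(probability_setT mu) -(setUv A) measureU// setICr.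
have [muA'0|muA'0] := eqVneq (mu (~` A)) 0%E.
  have -> : mu A = 1%E by rewrite -muA1 muA'0 adde0.
  by rewrite mule1 -split leeDl.
have fA' : mu (~` A) \is a fin_num by exact: fin_num_measure.
have fA : mu A \is a fin_num by exact: fin_num_measure.
pose c := fine (mu (~` A)).
have c0 : 0 < c by rewrite fine_gt0// lt0e muA'0 measure_ge0/= ltey_eq fA'.
have cE : mu (~` A) = c%:E by rewrite fineK.
have [nu nuE] := ex_probability_cond mA' c0 cE.
have ci : (0 <= (c^-1)%:E)%E by rewrite lee_fin invr_ge0 ltW.
have nu_le (f : T -> \bar R) : measurable_fun setT f -> (forall x, (0 <= f x)%E) ->
    (\int[nu]_x f x <= c^-1%:E * \int[mu]_x f x)%E.
  by move=> mf f0; rewrite nuE// lee_wpmul2l//; exact: ge0_subset_integral.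
have nuW : nu (~` W) = 0%E.
  have mCW := measurableC mW.
  apply/eqP; rewrite eq_le measure_ge0 andbT (measure_integral nu mCW).
  apply: le_trans (nu_le _ (measurable_EFin_indic mCW) _) _; first by move=> x; rewrite /= lee_fin.
  by have := measure_integral mu mCW => /= <-; rewrite mu_setCW mule0.
have nufin : (\int[nu]_x potential lambda nu x < +oo)%E.
  have Unu x : (potential lambda nu x <= c^-1%:E * U x)%E.
    by apply: nu_le; [exact: measurable_riesz1|move=> y; exact: riesz_ge0].
  apply: (@le_lt_trans _ _ (\int[nu]_x (c^-1%:E * U x))%E).
    apply: ge0_le_integral => //.
    - by move=> x _; exact: potential_ge0.
    - exact: measurable_potential.
    - exact: measurable_funeM.
  rewrite ge0_integralZl//.
  apply: (@le_lt_trans _ _ (c^-1%:E * (c^-1%:E * E%:E))%E).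
    by rewrite lee_wpmul2l// -min_energyE; exact: nu_le.
  by rewrite -!EFinM ltry.
have := min_energy_le nuW nufin; rewrite nuE//.
have f1 : (\int[mu]_(x in A) U x)%E \is a fin_num.
  by rewrite ge0_fin_numE// (@le_lt_trans _ _ E%:E) ?ltry// -split leeDl.
have f2 : (\int[mu]_(x in ~` A) U x)%E \is a fin_num.
  by rewrite ge0_fin_numE// (@le_lt_trans _ _ E%:E) ?ltry// -split leeDr.
move: split muA1; rewrite -(fineK f1) -(fineK f2) -(fineK fA) cE -EFinM -!EFinD -EFinM !lee_fin.
set u := fine (\int[mu]_(x in A) _); set v := fine _; set w := fine (mu A).
move=> [uv] [wc] H.
have : c * E <= v by rewrite mulrC -ler_pdivlMr// mulrC.
have -> : w = 1 - c by rewrite -wc addrK.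
lra.
Qed.

(** By [integral_potential_le] no set receives more than [E] times its mass, yet on this one the
    integrand exceeds [E + e]. *)
Lemma mu_potential_gt (e : R) : 0 < e -> mu [set x : T | ((E + e)%:E < U x)%E] = 0%E.
Proof.
move=> e0; set A := [set x : T | _].
have mA : measurable A.
  by rewrite -[X in measurable X]setTI; exact: emeasurable_fun_o_infty.
have H1 := integral_potential_le mA.
have H2 : ((E + e)%:E * mu A <= \int[mu]_(x in A) U x)%E.
  rewrite -integral_cst//; apply: ge0_le_integral => //.
  - by move=> x _; rewrite lee_fin addr_ge0 ?min_energy_ge0// ltW.
  - exact: measurable_funTS.
  - by move=> x /ltW.
have := le_trans H2 H1.
have fA : mu A \is a fin_num by exact: fin_num_measure.
rewrite -(fineK fA) -!EFinM lee_fin mulrDl gerDl pmulr_rle0// => H.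
by apply/eqP; rewrite eqe eq_le H/= fine_ge0.
Qed.

Lemma potential_le_of_dist (x x' : 'rV[R]_n) (A : R) : 0 < A ->
  (forall y, supp mu y -> enorm (x - y) <= A * enorm (x' - y)) ->
  (U x' <= (A `^ lambda)%:E * U x)%E.
Proof.
move=> A0 H.
have msupp := measurable_supp; have r0 := @riesz_ge0 R n lambda.
have US x0 : U x0 = (\int[mu]_(y in supp mu) k x0 y)%E.
  exact: (ge0_integral_supp msupp (supp_setC mu) (measurable_riesz1 lambda x0) (r0 x0)).
rewrite !US.
rewrite -ge0_integralZl//; last 2 first.
- by apply: measurable_funTS; exact: measurable_riesz1.
- by rewrite lee_fin powR_ge0.
apply: ge0_le_integral => //.
- by apply: measurable_funTS; exact: measurable_riesz1.
- by apply: measurable_funTS; apply: measurable_funeM; exact: measurable_riesz1.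
by move=> y sy; apply: riesz_le => //; exact: H.
Qed.

Lemma min_energy_smear (P sigma : probability T R) (t a : R) (A : set 'rV[R]_n) :
  is_smear t a sigma -> measurable (A : set T) -> P (~` A) = 0%E ->
  (forall x z, A x -> box a z -> W (x + z)) ->
  (E%:E <= \int[P]_x \int[sigma]_z U ((x : 'rV[R]_n) + z)%R)%E.
Proof.
move=> sigmaP mA PA AW.
have [_ _ sigmaB _] := sigmaP.
have [nu [nuW nuE]] := ex_smeared mA (measurable_box a) mW PA sigmaB AW.
rewrite -nuE//; apply: min_energy_le => //.
exact: (smeared_energy_lty lambda_gt0 lambda_ltn sigmaP nuE).
Qed.

(* Test with a smear of the point mass at a point of the interior of [W] close to
   [x0]. *)
Lemma potential_ge_off_supp (x0 : 'rV[R]_n) (d : R) : 0 < d -> W x0 ->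
  (forall y, supp mu y -> d <= enorm (x0 - y)) -> (E%:E <= U x0)%E.
Proof.
move=> d0 Wx0 far.
have Ufin : U x0 \is a fin_num.
  rewrite ge0_fin_numE//; apply: (@le_lt_trans _ _ (d `^ (- lambda))%:E); last exact: ltry.
  rewrite /potential (ge0_integral_supp measurable_supp (supp_setC mu)
    (measurable_riesz1 lambda x0) (riesz_ge0 lambda x0)).
  rewrite -[leRHS](probability_integral_cst mu).
  apply: (@le_trans _ _ (\int[mu]_(y in supp mu) (d `^ (- lambda))%:E)%E).
    apply: ge0_le_integral => //; first exact: measurable_supp.
    - by move=> y _; exact: riesz_ge0.
    - by apply: measurable_funTS; exact: measurable_riesz1.
    - by move=> y sy; apply: riesz_far => //; exact: far.
  apply: ge0_subset_integral => //; first exact: measurable_supp.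
  by move=> y _; rewrite lee_fin powR_ge0.
rewrite -(fineK Ufin) lee_fin; apply: (le_of_powR_le lambda_gt0); first by rewrite fine_ge0.
move=> A A1; have A0 : 0 < A by lra.
have [c [r [r0 cW']]] := unit_complete_interior n_gt0 W_complete.
have Wc : W c by apply: cW'; rewrite subrr enorm0 ltW.
have n0 : 0 < n%:R :> R by rewrite ltr0n.
(* the whole box lies within [s] of [x0] up to the factor [1 + r] *)
pose s := Num.min 1 (d * (1 - A^-1) / (1 + r)).
have Ai : A^-1 < 1 by rewrite invf_lt1.
have s0 : 0 < s by rewrite lt_min ltr01/= divr_gt0 ?mulr_gt0 ?subr_gt0//; lra.
have s1 : s <= 1 by rewrite ge_min lexx.
(* A displacement of at most [d (1 - 1 / A)] divides a distance that is at least [d] by at most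
   [A]. *)
have sd : s * (1 + r) <= d * (1 - A^-1).
  by rewrite -ler_pdivlMr ?ge_min ?lexx ?orbT//; lra.
(* By convexity [W] contains the ball of radius [s r] about [x1], a contraction towards [x0] of the
   ball about [c]; dividing by [n] makes the box fit into it. *)
pose x1 := x0 + s *: (c - x0).
pose a := s * r / n%:R.
have a0 : 0 < a by rewrite divr_gt0// mulr_gt0.
have boxW z : box a z -> W (x1 + z).
  move=> Bz; have zn : enorm z <= s * r.
    by apply: le_trans (enorm_le_coord Bz) _; rewrite /a mulrC divfK ?gt_eqF.
  pose z' := s^-1 *: z.
  have Wz' : W (c + z').
    apply: cW'; rewrite addrC addKr enormZ ger0_norm ?invr_ge0 ?(ltW s0)//.
    by rewrite ler_pdivrMl.
  apply: (unit_complete_in W_complete) => y Wy.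
  have -> : x1 + z - y = (1 - s) *: (x0 - y) + s *: (c + z' - y).
    apply/rowP => i; rewrite /x1 /z' !mxE; field; by rewrite gt_eqF.
  apply: le_trans (ler_enormD _ _) _; rewrite !enormZ !ger0_norm ?subr_ge0 ?(ltW s0)//.
  have := W1 Wx0 Wy; have := W1 Wz' Wy; have := enorm_ge0 (x0 - y); have := enorm_ge0 (c + z' - y).
  nra.
have h0 : 0 < 2^-1 :> R by [].
have [t t0 ta] := ex_gauss_tail_le a0 h0.
have [|sigma sigmaP] := @ex_is_smear R n t a t0 a0; first by lra.
have mx1 : measurable ([set x1] : set T).
  by apply: borel_closed; apply: compact_closed => //; exact: compact_set1.
have dir1 : (dirac (x1 : T) : probability T R) (~` [set x1]) = 0%E.
  by rewrite /= diracE memNset//; apply.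
have x1W (x z : 'rV[R]_n) : [set x1] x -> box a z -> W (x + z) by move=> ->; exact: boxW.
have := min_energy_smear sigmaP mx1 dir1 x1W.
rewrite integral_dirac//; last first.
  apply: (measurable_fun_fubini_tonelli_F (fun q : T * T => U ((q.1 : 'rV[R]_n) + q.2))) => [|q]; last exact: U0.
  apply: (measurableT_comp mU); apply: measurable_fun_rV; apply: measurable_rVD.
    exact: (measurable_coord_comp measurable_fst).
  exact: (measurable_coord_comp measurable_snd).
rewrite diracT mul1e => H; rewrite -lee_fin; apply: le_trans H _.
have [_ _ sigmaB _] := sigmaP.
have mUx1 : measurable_fun setT (fun z : T => U (x1 + z)).
  exact: (measurableT_comp mU (measurable_addv x1)).
rewrite (ge0_integral_supp (measurable_box a) sigmaB mUx1 (fun z => U0 _)).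
rewrite -[leRHS](probability_integral_cst sigma).
have AU0 : 0 <= A `^ lambda * fine (U x0) by rewrite mulr_ge0 ?powR_ge0 ?fine_ge0.
apply: (@le_trans _ _ (\int[sigma]_(z in box a) (A `^ lambda * fine (U x0))%:E)%E); last first.
  apply: ge0_subset_integral => //; first exact: measurable_box.
apply: ge0_le_integral; [exact: measurable_box|by move=> z _; exact: U0|
  exact: measurable_funTS|exact: measurable_cst|].
move=> z Bz; rewrite EFinM fineK//; apply: potential_le_of_dist => // y sy.
have zn : enorm z <= s * r.
  by apply: le_trans (enorm_le_coord Bz) _; rewrite /a mulrC divfK ?gt_eqF.
have dy := far y sy.
have := enorm_triangle (x1 + z) x0 y.
have x01 : enorm (x0 - (x1 + z)) <= s * (1 + r).
  have -> : x0 - (x1 + z) = s *: (x0 - c) + (- z) by apply/rowP => i; rewrite /x1 !mxE; ring.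
  apply: le_trans (ler_enormD _ _) _; rewrite enormN enormZ ger0_norm ?(ltW s0)//.
  by have := W1 Wx0 Wc; nra.
move=> tri; rewrite -ler_pdivrMl//.
have : d * (1 - A^-1) <= enorm (x0 - y) * (1 - A^-1) by rewrite ler_wpM2r// subr_ge0 ltW.
lra.
Qed.

End minimizer.

(** * The superharmonic range *)

Lemma one_sub_expn_le {R : realType} (e : R) m : 0 <= e <= 1 -> 1 - (1 - e) ^+ m <= m%:R * e.
Proof.
move=> /andP[e0 e1]; elim: m => [|m IH]; first by rewrite expr0 subrr mul0r.
have h : (1 - e) ^+ m <= 1 by rewrite exprn_ile1; lra.
have h' : 0 <= (1 - e) ^+ m by rewrite exprn_ge0; lra.
rewrite exprS -natr1; nra.
Qed.

(** Pigeonhole on a grid of mesh [2 b / N]. The rescaled coordinates [h] fill [[0, N]] with both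
    ends, so the cells have [N.+1] indices per axis, the last one for the face [h = N]. *)
Lemma ex_heavy_cell {R : realType} {n : nat} (P : probability (borelRn R n) R)
    (x0 : 'rV[R]_n) (b : R) (N : nat) : 0 < b -> (0 < N)%N ->
  exists Q : set 'rV[R]_n,
    [/\ measurable (Q : set (borelRn R n)),
        forall x, Q x -> box b (- x0 + x),
        forall x y i, Q x -> Q y -> `|(x - y) 0 i| <= 2 * b / N%:R
      & fine (P [set x : borelRn R n | box b (- x0 + x)]) <=
        N.+1%:R ^+ n * fine (P Q)].
Proof.
move=> b0 N0; set T := borelRn R n.
have N0' : 0 < N%:R :> R by rewrite ltr0n.
pose A : set T := [set x | box b (- x0 + x)].
have mA : measurable A.
  by rewrite -[X in measurable X]setTI; apply: (measurable_addv (- x0)) => //; exact: measurable_box.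
pose h i (x : 'rV[R]_n) : R := N%:R * ((- x0 + x) 0 i + b) / (2 * b).
pose cell (f : {ffun 'I_n -> 'I_N.+1}) : set T :=
  A `&` \bigcap_(i in [set: 'I_n]) (h i @^-1` `[(f i)%:R, (f i).+1%:R[).
have mh i : measurable_fun setT (h i : T -> R).
  apply: measurable_funM => //; apply: measurable_funM => //; apply: measurable_funD => //.
  exact: (measurable_coord_comp (measurable_addv (- x0))).
have mcell f : measurable (cell f).
  apply: measurableI => //; apply: fin_bigcap_measurable => // i _.
  by rewrite -[X in measurable X]setTI; apply: mh => //; exact: measurable_itv.
have fin (B : set T) : measurable B -> P B \is a fin_num by exact: fin_num_measure.
pose q f := fine (P (cell f)).
have q0 f : 0 <= q f by rewrite fine_ge0.
have cover : (P A <= (\sum_(f : {ffun 'I_n -> 'I_N.+1}) P (cell f))%R)%E.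
  have mI f : measurable_fun setT (EFin \o (\1_(cell f) : T -> R)) by exact: measurable_EFin_indic.
  have -> : \sum_(f : {ffun 'I_n -> 'I_N.+1}) P (cell f) =
      (\int[P]_x (\sum_(f : {ffun 'I_n -> 'I_N.+1}) (EFin \o (\1_(cell f) : T -> R)) x)%R)%E.
    rewrite ge0_integral_sum//; first by apply: eq_bigr => f _; exact: measure_integral.
    by move=> f x _; rewrite /= lee_fin.
  have PA : (P A <= \int[P]_x (EFin \o (\1_A : T -> R)) x)%E.
    by rewrite le_eqVlt; apply/orP; left; apply/eqP; exact: measure_integral.
  apply: (le_trans PA); apply: ge0_le_integral => //.
  - by move=> x _; rewrite /= lee_fin.
  - exact: measurable_EFin_indic.
  - exact: emeasurable_sum.
  move=> x _; rewrite /= indicE; have [/set_mem Ax|_] := boolP (x \in A); last first.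
    by apply: sume_ge0 => f _; rewrite lee_fin.
  have hx i : (Num.truncn (h i x) < N.+1)%N.
    have hN : h i x <= N%:R.
      rewrite /h ler_pdivrMr ?mulr_gt0// ler_wpM2l ?(ltW N0')//.
      by have := Ax i; rewrite ler_norml => /andP[_]; lra.
    rewrite ltnS -(ler_nat R); apply: le_trans hN.
    by rewrite truncn_le /h divr_ge0 ?mulr_ge0 ?(ltW N0') ?(ltW b0)//; have := Ax i; rewrite ler_norml => /andP[]; lra.
  pose f := [ffun i => Ordinal (hx i)].
  rewrite (bigD1 f)//= indicE mem_set; last first.
    split=> // i _; rewrite /= in_itv/= ffunE/=; apply: truncn_itv.
    by rewrite /h divr_ge0 ?mulr_ge0 ?(ltW N0') ?(ltW b0)//; have := Ax i; rewrite ler_norml => /andP[]; lra.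
  by rewrite leeDl// sume_ge0// => g _; rewrite lee_fin.
have [f _ fmax] := @arg_maxP _ _ _ [ffun=> ord0] predT q isT.
exists (cell f); split => //.
- by move=> x [].
- move=> x y i [_ /(_ i I)] /= + [_ /(_ i I)] /=; rewrite !in_itv/= => /andP[x1 x2] /andP[y1 y2].
  have H : N%:R * ((x - y) 0 i) / (2 * b) = h i x - h i y.
    by rewrite /h !mxE; field; rewrite gt_eqF.
  have H1 : `|N%:R * ((x - y) 0 i) / (2 * b)| <= 1.
    by rewrite H ler_norml -!natr1 in x2 y2 *; apply/andP; split; lra.
  move: H1; rewrite normrM normrM (ger0_norm (ltW N0')) (@ger0_norm _ (2 * b)^-1) ?invr_ge0 ?mulr_ge0 ?(ltW b0)//.
  by rewrite ler_pdivrMr ?mulr_gt0// mul1r ler_pdivlMr// mulrC.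
rewrite -lee_fin fineK ?fin//; apply: (le_trans cover).
have -> : \sum_(g : {ffun 'I_n -> 'I_N.+1}) P (cell g) =
    (\sum_(g : {ffun 'I_n -> 'I_N.+1}) q g)%:E.
  by rewrite -sumEFin; apply: eq_bigr => g _; rewrite fineK// fin.
rewrite lee_fin; apply: (@le_trans _ _ (\sum_(g : {ffun 'I_n -> 'I_N.+1}) q f)).
  by apply: ler_sum => g _; exact: fmax.
by rewrite sumr_const card_ffun !card_ord -[leLHS]mulr_natl natrX.
Qed.

Section superharmonic.
Context {R : realType} {n : nat}.
Local Notation T := (borelRn R n).
Variable lambda : R.
Hypothesis n_gt0 : (0 < n)%N.
Hypothesis lambda_gt0 : 0 < lambda.
Hypothesis lambda_ltn : lambda < n%:R.
Hypothesis lambda_le : lambda <= n%:R - 2.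
Variable mu : probability T R.
Hypothesis mu_min : minimizes_energy lambda mu.
Variable W : set 'rV[R]_n.
Hypothesis W_complete : unit_complete W.
Hypothesis supp_W : supp mu `<=` W.
Local Notation k := (@riesz R n lambda).
Local Notation U := (@potential R n lambda mu).
Local Notation p := (lambda / 2).
Local Notation E := (min_energy lambda mu).

Let p_gt0 : 0 < p. Proof. by rewrite divr_gt0. Qed.

(* Convolution with a Gaussian shifts [r] by [2 t] in the mixture, up to a factor at
   most 1 as [2 p + 2 <= n]; what is lost is the part [r <= 2 t], which is at least
   [kap_gap p t] when [|x - y|^2 <= t]. *)
Lemma smear_riesz_gap t a (sigma : probability T R) (Q : set 'rV[R]_n) x y : is_smear t a sigma ->
  (Q y -> dotv (x - y) (x - y) <= t) ->
  (\int[sigma]_z k (x + z) y +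
     (riesz_cst lambda * (1 - gauss_tail t a)^-1 ^+ n * kap_gap p t * \1_Q y)%:E <=
   ((1 - gauss_tail t a)^-1 ^+ n)%:E * k x y)%E.
Proof.
move=> [t0 tail1 _ sigmaE] Qt.
set C := (1 - gauss_tail t a)^-1 ^+ n; set c1 := riesz_cst lambda.
have C0 : 0 <= C by rewrite exprn_ge0// invr_ge0 subr_ge0 ltW.
have c10 : 0 <= c1 by exact/ltW/riesz_cst_gt0.
have cC0 : 0 <= c1 * C by rewrite mulr_ge0.
set q := dotv (x - y) (x - y).
have J0 : (0 <= \int[lebesgue_measure]_(r in `](2 * t)%R, +oo[) (heat p r q)%:E)%E.
  by apply: integral_ge0 => r _; rewrite lee_fin heat_ge0.
have I0 : (0 <= \int[lebesgue_measure]_(r in `]0%R, (2 * t)%R]) (heat p r q)%:E)%E.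
  by apply: integral_ge0 => r _; rewrite lee_fin heat_ge0.
have -> : (C%:E * k x y = (c1 * C)%:E * \int[lebesgue_measure]_(r in `](2 * t)%R, +oo[) (heat p r q)%:E +
    (c1 * C)%:E * \int[lebesgue_measure]_(r in `]0%R, (2 * t)%R]) (heat p r q)%:E)%E.
  rewrite riesz_kap// -/q -/c1 (kap_split p q t0) muleA -EFinM (mulrC C) -ge0_muleDr// addeC.
  by [].
apply: leeD.
  apply: le_trans (smear_riesz lambda_gt0 t0 tail1 sigmaE x y) _.
  rewrite lee_wpmul2l ?lee_fin//; apply: smeared_kap_le => //.
  have -> : 2 * p + 2 = lambda + 2 by field.
  by rewrite -lerBrDr.
rewrite -mulrA [leLHS]EFinM lee_wpmul2l ?lee_fin// indicE.
have [/set_mem Qy|_] := boolP (y \in Q); last by rewrite mulr0.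
by rewrite mulr1; apply: kap_gap_le => //; exact: Qt.
Qed.

(* Test with [mu] conditioned on [Q] and smeared. *)
Lemma cluster_bound t a (sigma : probability T R) (Q : set 'rV[R]_n) (q : R) : is_smear t a sigma ->
  measurable (Q : set T) -> 0 < q -> mu Q = q%:E ->
  (forall x y, Q x -> Q y -> dotv (x - y) (x - y) <= t) ->
  (forall x z, Q x -> box a z -> W (x + z)) ->
  riesz_cst lambda * kap_gap p t * q <= n%:R * gauss_tail t a * E.
Proof.
move=> sigmaP mQ q0 muQ Qt QW.
have [t0 tail1 _ _] := sigmaP.
have tail0 : 0 <= gauss_tail t a by rewrite mulr_ge0 ?sqrtr_ge0 ?expR_ge0.
set C := (1 - gauss_tail t a)^-1 ^+ n.
have C0 : 0 < C by rewrite exprn_gt0// invr_gt0 subr_gt0.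
pose G := riesz_cst lambda * C * kap_gap p t.
have G0 : 0 <= G.
  apply: mulr_ge0; last exact/ltW/kap_gap_gt0.
  by apply: mulr_ge0; apply: ltW => //; exact: riesz_cst_gt0.
have E0 := min_energy_ge0 lambda mu.
have U0 x : (0 <= U x)%E by exact: potential_ge0.
have mU : measurable_fun setT (U : T -> \bar R) by exact: measurable_potential.
have k0 := @riesz_ge0 R n lambda.
pose S (x : T) := (\int[sigma]_z U ((x : 'rV[R]_n) + z)%R)%E.
have madd : measurable_fun setT (fun q : T * T => (q.1 : 'rV[R]_n) + q.2 : T).
  apply: measurable_fun_rV; apply: measurable_rVD.
    exact: (measurable_coord_comp measurable_fst).
  exact: (measurable_coord_comp measurable_snd).
have mS : measurable_fun setT S.
  apply: (measurable_fun_fubini_tonelli_F (fun q : T * T => U ((q.1 : 'rV[R]_n) + q.2))) => [|z]; last exact: U0.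
  exact: (measurableT_comp mU madd).
have S0 x : (0 <= S x)%E by apply: integral_ge0 => z _; exact: U0.
have SE (x : 'rV[R]_n) : S x = (\int[mu]_y \int[sigma]_z k (x + z) y)%E.
  rewrite /S /potential (fubini_tonelli (fun r : T * T => k (x + (r.1 : 'rV[R]_n)) r.2))//.
  by apply: measurable_riesz => //; exact: (measurableT_comp (measurable_addv x) measurable_fst).
have SQ x : Q x -> (S x + (G * q)%:E <= C%:E * U x)%E.
  move=> Qx; rewrite SE.
  pose f (y : T) : \bar R := (\int[sigma]_z k ((x : 'rV[R]_n) + z)%R y)%E.
  pose g (y : T) : \bar R := (G%:E * (EFin \o (\1_Q : T -> R)) y)%E.
  have f0 y : (0 <= f y)%E by apply: integral_ge0 => z _; exact: k0.
  have g0 y : (0 <= g y)%E by rewrite mule_ge0// lee_fin.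
  have mf : measurable_fun setT f.
    apply: (measurable_fun_fubini_tonelli_G (fun r : T * T => k (x + (r.1 : 'rV[R]_n)) r.2)) => [|z]; last exact: k0.
    by apply: measurable_riesz => //; exact: (measurableT_comp (measurable_addv x) measurable_fst).
  have mg : measurable_fun setT g by apply: measurable_funeM; exact: measurable_EFin_indic.
  have -> : (G * q)%:E = (\int[mu]_y g y)%E.
    rewrite ge0_integralZl//; last 2 first.
    - exact: measurable_EFin_indic.
    - by move=> y _; rewrite /= lee_fin.
    rewrite EFinM; congr (_ * _)%E; rewrite -muQ; exact: measure_integral.
  rewrite -/f -(ge0_integralD mu measurableT (fun y _ => f0 y) mf (fun y _ => g0 y) mg).
  rewrite -ge0_integralZl//; last 2 first.
  - exact: measurable_riesz1.
  - by rewrite lee_fin ltW.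
  apply: ge0_le_integral => //.
  - by move=> y _; rewrite adde_ge0.
  - exact: emeasurable_funD.
  - by apply: measurable_funeM; exact: measurable_riesz1.
  move=> y _; rewrite /g /= -EFinM; apply: (smear_riesz_gap sigmaP) => Qy; exact: Qt.
have [P PE] := ex_probability_cond mQ q0 muQ.
have mCQ := measurableC mQ.
have PQ : P (~` Q) = 0%E.
  rewrite (measure_integral P mCQ) PE; [|exact: measurable_EFin_indic|by move=> x; rewrite /= lee_fin].
  rewrite (eq_integral (cst 0%E)) ?integral0 ?mule0// => x xQ.
  by rewrite /= indicE in_setC xQ.
have := min_energy_smear n_gt0 lambda_gt0 lambda_ltn mu_min W_complete supp_W sigmaP mQ PQ QW.
rewrite PE// -/S => H1.
(* On average over [Q], minimality gives [E] at most the mean of [S], and [integral_potential_le]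
   bounds the mean of [U] by [E]. With [SQ] this yields [E + G q <= C E], so the gain [G q] is paid
   for by the excess of the truncation factor [C] over 1, which Bernoulli's inequality bounds. *)
have H2 : ((q * E)%:E <= \int[mu]_(x in Q) S x)%E.
  rewrite EFinM; have := lee_wpmul2l (ltW q0 : (0 <= q%:E)%E) H1.
  by rewrite muleA -(EFinM q q^-1) divff ?gt_eqF// mul1e.
have H3 : (\int[mu]_(x in Q) S x + (G * q * q)%:E <= (C * (E * q))%:E)%E.
  apply: (@le_trans _ _ (\int[mu]_(x in Q) (C%:E * U x))%E); last first.
    rewrite ge0_integralZl//; last 2 first.
    - exact: measurable_funTS.
    - by rewrite lee_fin ltW.
    rewrite [leRHS]EFinM lee_wpmul2l ?lee_fin ?(ltW C0)// EFinM -muQ.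
    exact: (integral_potential_le n_gt0 lambda_gt0 lambda_ltn mu_min W_complete supp_W).
  have -> : (G * q * q)%:E = (\int[mu]_(x in Q) (G * q)%:E)%E by rewrite integral_cst// [X in (_ * X)%E]muQ -EFinM.
  rewrite -ge0_integralD//; last 2 first.
  - exact: measurable_funTS.
  - by move=> x _; rewrite lee_fin mulr_ge0// ltW.
  apply: ge0_le_integral => //.
  - by move=> x _; rewrite adde_ge0// lee_fin mulr_ge0// ltW.
  - by apply: emeasurable_funD => //; exact: measurable_funTS.
  - by apply: measurable_funeM; exact: measurable_funTS.
have H4 : q * E + G * q * q <= C * (E * q).
  by rewrite -lee_fin EFinD; apply: le_trans H3; rewrite leeD2r.
have H5 : E + G * q <= C * E.
  by rewrite -(ler_pM2r q0) mulrDl (mulrC E) -(mulrA C).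
have Ci : C^-1 = (1 - gauss_tail t a) ^+ n by rewrite /C exprVn invrK.
have H6 : C^-1 * E + riesz_cst lambda * kap_gap p t * q <= E.
  rewrite -(ler_pM2l C0) mulrDr !mulrA divff ?gt_eqF// mul1r.
  apply: le_trans H5; rewrite lerD2l le_eqVlt; apply/orP; left; apply/eqP.
  by rewrite /G /kap_gap; ring.
have := @one_sub_expn_le R (gauss_tail t a) n; rewrite tail0 (ltW tail1) => /(_ isT) H7.
have : (1 - C^-1) * E <= n%:R * gauss_tail t a * E by rewrite ler_wpM2r// Ci.
lra.
Qed.

(** A count of powers. Cells of side [2 b / N] have [t] of order [N^-2], and one has mass at least
    of order [N^-n]; the gain in [cluster_bound] is thus at least of order [N^(- n - 2)]. The loss
    is [O (t^(n + 2)) = O (N^(- 2 n - 4))], which is smaller for large [N]. *)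
Lemma supp_not_interior x0 : supp mu x0 -> ~ interior W x0.
Proof.
move=> sx0 /nbhs_enormP[e e0 eW].
have n0 : 0 < n%:R :> R by rewrite ltr0n.
(* [x0] plus two vectors of [box b] stays within [2 n b = e / 2] of [x0]: one vector for the cell,
   one for the smear. *)
have [b bE] : exists b, b = e / (4 * n%:R) by eexists.
have b0 : 0 < b by rewrite bE divr_gt0 ?mulr_gt0.
pose A : set T := [set x | box b (- x0 + x)].
have mA : measurable A.
  by rewrite -[X in measurable X]setTI; apply: (measurable_addv (- x0)) => //; exact: measurable_box.
have fA : mu A \is a fin_num by exact: fin_num_measure.
pose m := fine (mu A).
have m0 : 0 < m.
  rewrite fine_gt0// ltey_eq fA/= andbT.
  have H := sx0 (ball x0 b) (ball_open x0 b) (ballxx x0 b0).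
  apply: lt_le_trans H _; apply: le_measure; rewrite ?inE//.
    by apply: borel_open; exact: ball_open.
  move=> y; rewrite -ball_normE/= => xy i; rewrite addrC.
  by apply: le_trans (coord_le_mx_norm _ _) _; rewrite distrC ltW.
have [K K0 KP] := gauss_tail_decay n.+1 b0.
(* So that [t = tau / N^2 = n (2 b / N)^2] bounds the squared diameter of a cell. *)
pose tau := 4 * n%:R * b ^+ 2.
have tau0 : 0 < tau by apply: mulr_gt0; [exact: mulr_gt0|exact: exprn_gt0].
pose e1 : R := expR (-1).
have e10 : 0 < e1 by exact: expR_gt0.
pose c1 := riesz_cst lambda.
have c10 : 0 < c1 by exact: riesz_cst_gt0.
have E0 := min_energy_ge0 lambda mu.
pose Y := n%:R * K * E * tau ^+ n.+1 * 2 ^+ n.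
have Y0 : 0 <= Y.
  apply: mulr_ge0; last exact: exprn_ge0.
  apply: mulr_ge0; last exact/exprn_ge0/ltW.
  by apply: mulr_ge0 => //; apply: mulr_ge0; exact: ltW.
(* Three thresholds for [N]: the final contradiction, [2 t <= 1], and a tail smaller than 1. *)
pose Z := Y / (c1 * e1 * m) + 2 * tau + K * tau ^+ n.+2.
pose N := (Num.truncn Z).+1.
have cem0 : 0 < c1 * e1 * m by apply: mulr_gt0 => //; exact: mulr_gt0.
have Y1 : 0 <= Y / (c1 * e1 * m) by apply: divr_ge0 => //; exact: ltW.
have K1 : 0 < K * tau ^+ n.+2 by apply: mulr_gt0 => //; exact: exprn_gt0.
have ZN : Z < N%:R by exact: truncnS_gt.
have N1 : 1 <= N%:R :> R by rewrite ler1n.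
have N0 : 0 < N%:R :> R by lra.
have [t tE] : exists t, t = tau / N%:R ^+ 2 by eexists.
have t0 : 0 < t by rewrite tE divr_gt0 ?exprn_gt0.
have tN : t <= tau / N%:R.
  by rewrite tE ler_pM2l// lef_pV2 ?posrE ?exprn_gt0// ler_eXnr.
have t2 : 2 * t <= 1.
  have : tau / N%:R <= 1 / 2 by rewrite ler_pdivrMr//; move: ZN; rewrite /Z; lra.
  by lra.
have tail1 : gauss_tail t b < 1.
  apply: le_lt_trans (KP t t0) _.
  have -> : K * t ^+ n.+2 = K * tau ^+ n.+2 / (N%:R ^+ 2) ^+ n.+2.
    by rewrite tE expr_div_n mulrA.
  rewrite ltr_pdivrMr ?exprn_gt0// mul1r.
  apply: (@lt_le_trans _ _ N%:R); first by move: ZN; rewrite /Z; lra.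
  by rewrite -exprM ler_eXnr.
have [sigma sigmaP] := @ex_is_smear R n t b t0 b0 tail1.
have [Q [mQ QA Qd Qm]] := @ex_heavy_cell R n mu x0 b N b0 isT.
have fQ : mu Q \is a fin_num by exact: fin_num_measure.
pose q := fine (mu Q).
have Qm' : m <= N.+1%:R ^+ n * q by exact: Qm.
have q0 : 0 < q.
  by rewrite -(pmulr_rgt0 q (exprn_gt0 n (ltr0Sn R N))); exact: lt_le_trans Qm'.
have Qt x y : Q x -> Q y -> dotv (x - y) (x - y) <= t.
  move=> Qx Qy; rewrite /dotv.
  apply: (@le_trans _ _ (\sum_(i < n) (2 * b / N%:R) ^+ 2)).
    apply: ler_sum => i _; rewrite -expr2 -[leLHS]real_normK ?num_real//.
    have bN0 : 0 <= 2 * b / N%:R by rewrite divr_ge0 ?mulr_ge0 ?(ltW b0) ?(ltW N0).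
    by rewrite ler_pXn2r ?nnegrE//; exact: Qd.
  rewrite sumr_const card_ord -[leLHS]mulr_natl tE /tau le_eqVlt; apply/orP; left; apply/eqP.
  by field; rewrite gt_eqF.
have QW x z : Q x -> box b z -> W (x + z).
  move=> Qx Bz; apply: eW.
  have -> : x0 - (x + z) = - ((- x0 + x) + z) by apply/rowP => i; rewrite !mxE; ring.
  rewrite enormN; apply: (@le_lt_trans _ _ (n%:R * (b + b))).
    apply: enorm_le_coord => i; rewrite mxE; apply: le_trans (ler_normD _ _) _.
    by apply: lerD; [exact: QA|exact: Bz].
  have -> : n%:R * (b + b) = e / 2 by rewrite bE; field; rewrite gt_eqF.
  by lra.
have := cluster_bound sigmaP mQ q0 (esym (fineK fQ)) Qt QW.
rewrite -/c1 => main.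
have gap : t * e1 <= kap_gap p t.
  rewrite /kap_gap ler_pM2l// -/e1 ler_peMl ?(ltW e10)//.
  have -> : - p - 1 = - (p + 1) by lra.
  rewrite powRN -[leLHS]invr1 lef_pV2 ?posrE ?powR_gt0 ?mulr_gt0//.
  have one : 1 = 1 `^ (p + 1) :> R by rewrite powR1.
  rewrite [leRHS]one; apply: ge0_ler_powR; rewrite ?nnegrE//; last by lra.
  by have := divr_gt0 lambda_gt0 (ltr0Sn R 1); lra.
have qN : m <= (2 * N%:R) ^+ n * q.
  apply: le_trans Qm' _; rewrite ler_wpM2r ?(ltW q0)// lerXn2r ?nnegrE ?mulr_ge0 ?(ltW N0)//.
  by rewrite -natr1; lra.
have S1 : c1 * (t * e1) * q <= n%:R * (K * t ^+ n.+2) * E.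
  apply: (@le_trans _ _ (c1 * kap_gap p t * q)).
    by apply: ler_wpM2r; [exact: ltW|apply: ler_wpM2l; [exact: ltW|exact: gap]].
  apply: le_trans main _; apply: ler_wpM2r => //; apply: ler_wpM2l; [exact: ltW|exact: KP].
have S2 : c1 * e1 * q <= n%:R * K * E * t ^+ n.+1.
  rewrite -(ler_pM2l t0); move: S1; rewrite (exprS t n.+1).
  have -> : c1 * (t * e1) * q = t * (c1 * e1 * q) by ring.
  have -> // : n%:R * (K * (t * t ^+ n.+1)) * E = t * (n%:R * K * E * t ^+ n.+1) by ring.
have S3 : c1 * e1 * m <= n%:R * K * E * t ^+ n.+1 * (2 * N%:R) ^+ n.
  apply: (@le_trans _ _ (c1 * e1 * ((2 * N%:R) ^+ n * q))).
    by rewrite ler_wpM2l// mulr_ge0 ?(ltW c10) ?(ltW e10).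
  rewrite mulrCA [leRHS]mulrC ler_wpM2l// exprn_ge0// mulr_ge0// ltW.
have S4 : c1 * e1 * m * N%:R ^+ n.+2 <= Y.
  rewrite -ler_pdivlMr ?exprn_gt0//; apply: le_trans S3 _.
  rewrite /Y tE expr_div_n (exprMn n 2) le_eqVlt; apply/orP; left; apply/eqP.
  have -> : (N%:R ^+ 2) ^+ n.+1 = N%:R ^+ n * N%:R ^+ n.+2 :> R.
    by rewrite -exprM -exprD; congr (_ ^+ _); rewrite mul2n -addnn addSnnS.
  have Nn0 m' : N%:R ^+ m' != 0 :> R by rewrite expf_neq0// gt_eqF.
  move: (Nn0 n) (Nn0 n.+2).
  move: (N%:R ^+ n) (N%:R ^+ n.+2) (tau ^+ n.+1) (2 ^+ n) => a c u v a0 c0.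
  by field; rewrite ?a0 ?c0.
have S5 : c1 * e1 * m * N%:R <= Y.
  apply: le_trans S4; rewrite ler_wpM2l ?mulr_ge0 ?(ltW c10) ?(ltW e10) ?(ltW m0)//.
  by rewrite ler_eXnr.
have : N%:R <= Y / (c1 * e1 * m) by rewrite ler_pdivlMr// mulrC.
by move: ZN; rewrite /Z; lra.
Qed.

End superharmonic.

(** * The maximum principle *)

Section second_difference.
Context {R : realType}.
Implicit Types (a b p s : R).

Lemma ge0_derive_le (f df : R -> R) b : 0 <= b ->
  (forall x : R, 0 <= x <= b -> is_derive x 1 f (df x)) ->
  (forall x : R, 0 <= x <= b -> 0 <= df x) -> f 0 <= f b.
Proof.
move=> b0 fdf df0.
have [c||c cb fE] := @MVT_segment R f df 0 b b0.
- by rewrite in_itv/= => /andP[c0 cb]; apply: fdf; rewrite !ltW.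
- apply: continuous_in_subspaceT => x; rewrite inE/= in_itv/= => xb.
  by apply: differentiable_continuous; apply/derivable1_diffP; have [] := fdf x xb.
by rewrite -subr_ge0 fE subr0 mulr_ge0// df0.
Qed.

Lemma is_derive_powR_affine a e s x : 0 < a + e * x ->
  is_derive x 1 (fun y => (a + e * y) `^ s) (e * (s * (a + e * x) `^ (s - 1))).
Proof.
move=> x0.
have Dg : is_derive x 1 (fun y : R => a + e * y) e.
  have D1 := is_deriveD (is_derive_cst a x 1) (is_deriveZ e (is_derive_id x (1 : R))).
  by apply: (is_derive_eq D1); rewrite add0r /GRing.scale/= mulr1.
have := @is_derive1_comp R (fun z => z `^ s) (fun y => a + e * y) x _ _ (is_derive1_powR s x0) Dg.
by rewrite mulrC.
Qed.

(** [u * v = (a^2 - b^2)^(- s)] is at least [a^(- 2 s)]; then the inequality of arithmetic and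
    geometric means. *)
Lemma powR_midpoint a b s : 0 < s -> `|b| < a ->
  2 * a `^ (- s) <= (a + b) `^ (- s) + (a - b) `^ (- s).
Proof.
move=> s0; rewrite ltr_norml => /andP[b1 b2].
have a0 : 0 < a by lra.
have p0 : 0 < a + b by lra.
have m0 : 0 < a - b by lra.
set u := (a + b) `^ (- s); set v := (a - b) `^ (- s).
have u0 : 0 <= u by exact: powR_ge0.
have v0 : 0 <= v by exact: powR_ge0.
have w0 : 0 <= a `^ (- s) by exact: powR_ge0.
have uv : (a `^ (- s)) ^+ 2 <= u * v.
  rewrite expr2 -!powRM ?(ltW a0) ?(ltW p0) ?(ltW m0)// !powRN.
  rewrite lef_pV2 ?posrE ?powR_gt0 ?mulr_gt0//.
  apply: ge0_ler_powR; rewrite ?nnegrE ?mulr_ge0 ?(ltW s0) ?(ltW a0) ?(ltW p0) ?(ltW m0)//.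
  by have := sqr_ge0 b; lra.
rewrite -(@ler_pXn2r _ 2) ?nnegrE ?addr_ge0 ?mulr_ge0//.
have := sqr_ge0 (u - v); rewrite !expr2 in uv *; lra.
Qed.

(** Taylor's formula at order two with a remainder of known sign. As a function of [b] the
    difference of the two sides vanishes at 0 and has derivative [p * H]; [H] vanishes at 0 too, and
    its derivative is non-negative by [powR_midpoint] with exponent [p + 2]. *)
Lemma powR_second_diff a b p : 0 < p -> 0 <= b -> b < a ->
  2 * a `^ (- p) + p * (p + 1) * a `^ (- p - 2) * b ^+ 2 <=
  (a + b) `^ (- p) + (a - b) `^ (- p).
Proof.
move=> p0 b0 ba; have a0 : 0 < a by lra.
pose H y : R := (a + (-1) * y) `^ (- p - 1) - (a + 1 * y) `^ (- p - 1)
  - 2 * (p + 1) * a `^ (- p - 2) * y.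
pose dH y : R := (p + 1) * ((a + 1 * y) `^ (- (p + 2)) + (a + (-1) * y) `^ (- (p + 2))
  - 2 * a `^ (- (p + 2))).
have H0 y : 0 <= y <= b -> 0 <= H y.
  move=> /andP[y0 yb].
  have -> : 0 = H 0 by rewrite /H !mulr0 addr0 subrr subr0.
  apply: (@ge0_derive_le H dH _ y0) => x /andP[x0 xy].
    have m0 : 0 < a + (-1) * x by lra.
    have q0 : 0 < a + 1 * x by lra.
    have D := is_deriveB (is_deriveB (is_derive_powR_affine (- p - 1) m0)
      (is_derive_powR_affine (- p - 1) q0))
      (is_deriveZ (2 * (p + 1) * a `^ (- p - 2)) (is_derive_id x (1 : R))).
    apply: (is_derive_eq D); rewrite /dH /GRing.scale/= mulr1.
    have -> : - p - 1 - 1 = - (p + 2) by lra.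
    have -> : - p - 2 = - (p + 2) by lra.
    by ring.
  rewrite /dH mulr_ge0 ?subr_ge0//; first by lra.
  have -> : a + -1 * x = a - x by lra.
  rewrite mul1r; apply: powR_midpoint; first by lra.
  by rewrite ger0_norm//; lra.
pose G y : R := (a + 1 * y) `^ (- p) + (a + (-1) * y) `^ (- p)
  - p * (p + 1) * a `^ (- p - 2) * (y * y).
have : G 0 <= G b.
  apply: (@ge0_derive_le G (fun y => p * H y) _ b0) => x /andP[x0 xb].
    have m0 : 0 < a + (-1) * x by lra.
    have q0 : 0 < a + 1 * x by lra.
    have D := is_deriveB (is_deriveD (is_derive_powR_affine (- p) q0)
      (is_derive_powR_affine (- p) m0))
      (is_deriveZ (p * (p + 1) * a `^ (- p - 2))
        (is_deriveM (is_derive_id x (1 : R)) (is_derive_id x (1 : R)))).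
    apply: (is_derive_eq D); rewrite /H /GRing.scale/= !mulr1.
    by ring.
  by rewrite mulr_ge0 ?(ltW p0)// H0// x0.
rewrite /G !mulr0 !addr0 subr0 mul1r mulN1r -expr2.
lra.
Qed.

(* The discrete Laplacian of [|w|^(-2p)], as a function of [q = |w|^2] and of the
   coordinates [w i]; its leading term is [h^2 2p (2p + 2 - n) q^(-p-1)]. *)
Lemma powR_laplacian n (w : 'I_n -> R) (q h p d : R) : 0 < p -> n%:R <= 2 * p + 2 ->
  q = \sum_i w i ^+ 2 -> 0 < h -> h < d -> d ^+ 2 <= q ->
  2 * n%:R * q `^ (- p) + h ^+ 2 * (2 * p * (2 * p + 2 - n%:R)) * q `^ (- p - 1)
    - 4 * p * (p + 1) * (p + 2) * h ^+ 4 * d `^ (- (2 * p + 4)) <=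
  \sum_(i < n) ((q + h ^+ 2 + 2 * h * w i) `^ (- p) + (q + h ^+ 2 - 2 * h * w i) `^ (- p)).
Proof.
move=> p0 np qE h0 hd dq.
have d0 : 0 < d by lra.
have q0 : 0 < q by apply: lt_le_trans dq; rewrite exprn_gt0.
pose a := q + h ^+ 2.
have a0 : 0 < a by rewrite addr_gt0// exprn_gt0.
have wq i : w i ^+ 2 <= q.
  by rewrite qE (bigD1 i)//= lerDl sumr_ge0// => j _; exact: sqr_ge0.
(* Makes both bases [a + 2 h w_i] and [a - 2 h w_i] positive. It amounts to
   [(h - |w_i|)^2 + (q - w_i^2) > 0]; if the first square vanishes, [h < d] makes the second term
   positive. *)
have hw i : `|2 * h * w i| < a.
  have H : (h - `|w i|) ^+ 2 + (q - w i ^+ 2) > 0.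
    have [hwi|hwi] := eqVneq h `|w i|.
      rewrite -hwi subrr expr0n/= add0r subr_gt0.
      apply: lt_le_trans dq; rewrite -real_normK ?num_real// -hwi.
      by rewrite ltr_pXn2r ?nnegrE// ltW.
    rewrite ltr_pwDl ?subr_ge0 ?wq//.
    by rewrite exprn_even_gt0//= subr_eq0.
  rewrite !normrM (ger0_norm (ltW h0)) (@ger0_norm _ 2)// /a.
  by move: H; rewrite sqrrB (real_normK (num_real _)); lra.
have step i : 2 * a `^ (- p) + p * (p + 1) * a `^ (- p - 2) * (2 * h * w i) ^+ 2 <=
    (a + 2 * h * w i) `^ (- p) + (a - 2 * h * w i) `^ (- p).
  have [w0|w0] := leP 0 (2 * h * w i).
    apply: powR_second_diff => //.
    by have := hw i; rewrite ger0_norm.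
  have nw0 : 0 <= - (2 * h * w i) by rewrite oppr_ge0 ltW.
  have nwa : - (2 * h * w i) < a by have := hw i; rewrite ltr0_norm.
  by have := powR_second_diff p0 nw0 nwa; rewrite opprK sqrrN addrC [X in _ <= X]addrC [X in X <= _]addrC.
apply: le_trans (ler_sum _ (fun i _ => step i)).
(* The sum of the lower bounds is [2 n a^(- p) + 4 p (p + 1) h^2 q a^(- p - 2)]. Replacing both
   powers of [a = q + h^2] by their tangents at [q] produces the coefficient
   [4 p (p + 1) - 2 n p = 2 p (2 p + 2 - n)] of [h^2 q^(- p - 1)], and the error of order [h^4]. *)
rewrite big_split/= sumr_const card_ord -mulr_sumr.
have -> : \sum_(i < n) (2 * h * w i) ^+ 2 = 4 * h ^+ 2 * q.
  by rewrite qE mulr_sumr; apply: eq_bigr => i _; rewrite !exprMn; ring.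
have aq : q <= a by rewrite lerDl sqr_ge0.
(* convexity of [x^(-s)]: the tangent at [q] is below *)
have tangent s : 0 < s -> q `^ (- s) - s * h ^+ 2 * q `^ (- s - 1) <= a `^ (- s).
  move=> s0.
  pose F y : R := (q + 1 * y) `^ (- s) + s * q `^ (- s - 1) * y.
  pose dF y : R := s * (q `^ (- s - 1) - (q + 1 * y) `^ (- s - 1)).
  have : F 0 <= F (h ^+ 2).
    apply: (@ge0_derive_le F dF _ (sqr_ge0 h)) => x /andP[x0 xh].
      have x1 : 0 < q + 1 * x by lra.
      have D := is_deriveD (is_derive_powR_affine (- s) x1)
        (is_deriveZ (s * q `^ (- s - 1)) (is_derive_id x (1 : R))).
      by apply: (is_derive_eq D); rewrite /dF /GRing.scale/= !mulr1; ring.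
    rewrite /dF mulr_ge0 ?(ltW s0)// subr_ge0 mul1r.
    have -> : - s - 1 = - (s + 1) by lra.
    rewrite !powRN lef_pV2 ?posrE ?powR_gt0//; last by lra.
    by apply: ge0_ler_powR; rewrite ?nnegrE; lra.
  by rewrite /F !mulr0 !addr0 mul1r -/a; lra.
have p2 : 0 < p + 2 by lra.
have T1 := tangent p p0; have := tangent _ p2.
have -> : - (p + 2) = - p - 2 by lra.
have qm s : q * q `^ (s - 1) = q `^ s.
  rewrite -{1}(powRr1 (ltW q0)) -powRD; last by rewrite (gt_eqF q0) implybT.
  by congr (_ `^ _); lra.
have Q1 := qm (- p - 1); have Q2 := qm (- p - 2).
have E1 : - p - 1 - 1 = - p - 2 by lra.
rewrite E1 in Q1.
have Q3 : q `^ (- p - 2) <= d `^ (- (2 * p + 4)).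
  have -> : - (2 * p + 4) = 2%:R * (- p - 2) by lra.
  rewrite powRrM powR_mulrn ?(ltW d0)//.
  have -> : - p - 2 = - (p + 2) by lra.
  rewrite !powRN lef_pV2 ?posrE ?powR_gt0 ?exprn_gt0//.
  by apply: ge0_ler_powR; rewrite ?nnegrE ?exprn_ge0 ?(ltW d0) ?(ltW q0) ?(ltW p2).
move=> T2.
set A := a `^ (- p) in T1 *; set A2 := a `^ (- p - 2) in T2 *.
set B := q `^ (- p) in T1 *; set B1 := q `^ (- p - 1) in T1 Q1 *.
set B2 := q `^ (- p - 2) in T2 Q1 Q2 Q3 *; set B3 := q `^ (- p - 2 - 1) in T2 Q2.
have n0 : 0 <= n%:R :> R by [].
rewrite -(mulr_natl (2 * A) n).
have S1 : n%:R * (2 * (B - p * h ^+ 2 * B1)) <= n%:R * (2 * A).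
  by rewrite ler_wpM2l// ler_pM2l.
have pp : 0 <= p * (p + 1) by rewrite mulr_ge0//; lra.
have h2 : 0 <= h ^+ 2 by exact: sqr_ge0.
have c0 : 0 <= p * (p + 1) * (4 * h ^+ 2) by rewrite mulr_ge0// mulr_ge0.
have S2 : p * (p + 1) * (4 * h ^+ 2) * (q * (B2 - (p + 2) * h ^+ 2 * B3)) <=
    p * (p + 1) * (4 * h ^+ 2) * (q * A2).
  by rewrite ler_wpM2l// ler_wpM2l// ltW.
have S3 : p * (p + 1) * (4 * h ^+ 2) * (p + 2) * h ^+ 2 * B2 <=
    p * (p + 1) * (4 * h ^+ 2) * (p + 2) * h ^+ 2 * d `^ (- (2 * p + 4)).
  by rewrite ler_wpM2l// mulr_ge0// mulr_ge0//; lra.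
have S4 : q * (B2 - (p + 2) * h ^+ 2 * B3) = B1 - (p + 2) * h ^+ 2 * B2.
  by rewrite mulrBr Q1 -Q2; ring.
rewrite S4 in S2.
move: S1 S2 S3; set D := d `^ _.
have -> : h ^+ 4 = h ^+ 2 * h ^+ 2 by rewrite -exprD.
lra.
Qed.

End second_difference.

(* [v + e |x - x0|^2] has a positive discrete Laplacian of order [h^2] on [D'], which is
   excluded at a point where it almost reaches its supremum. *)
Lemma approx_max_principle {R : realType} {n : nat} (v : 'rV[R]_n -> R)
    (D D' : set 'rV[R]_n) (d C B r M : R) (x0 : 'rV[R]_n) :
  (0 < n)%N -> 0 < d -> 0 <= C ->
  (forall x y, D' x -> enorm (x - y) <= d -> D y) ->
  (forall x, D x -> v x <= B) ->
  (forall x, D x -> ~ D' x -> v x <= M) ->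
  (forall x, D x -> r <= enorm (x - x0) -> v x <= M) ->
  (forall x h, D' x -> 0 < h -> h < d -> 2 * n%:R * v x - C * h ^+ 4 <=
    \sum_i (v (x + h *: delta_mx 0 i) + v (x - h *: delta_mx 0 i))) ->
  D x0 -> v x0 <= M.
Proof.
move=> n0 d0 C0 D'D vB bd far mean Dx0; rewrite leNgt; apply/negP => Mv.
have nR : 1 <= n%:R :> R by rewrite ler1n.
(* A point within [r] of [x0] keeps its neighbours of step [h < d] within [b]. *)
pose b := Num.max r 0 + d.
have r0 : 0 <= Num.max r 0 by rewrite le_max lexx orbT.
have b0 : 0 < b by rewrite ltr_wpDl.
have b2 : 0 < b ^+ 2 by rewrite exprn_gt0.
(* The added quadratic is at most half of the excess [v x0 - M] on [G], so a near-maximum of [g]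
   still has [v > M], and [bd] and [far] place it in [D'] and within [r]. *)
have [e eE] : exists e, e = (v x0 - M) / (2 * b ^+ 2) by eexists.
have e0 : 0 < e by rewrite eE divr_gt0 ?mulr_gt0// subr_gt0.
have eb : e * b ^+ 2 = (v x0 - M) / 2 by rewrite eE; field; rewrite gt_eqF.
pose G : set 'rV[R]_n := [set x | D x /\ enorm (x - x0) <= b].
pose g x := v x + e * enorm (x - x0) ^+ 2.
pose h := Num.min (d / 2) (Num.sqrt (e / (C + 1))).
have C1 : 0 < C + 1 by lra.
have h0 : 0 < h by rewrite lt_min !divr_gt0//= sqrtr_gt0 divr_gt0.
have hd : h < d by rewrite gt_min; apply/orP; left; lra.
have he : C * h ^+ 2 <= e.
  have H : h ^+ 2 * (C + 1) <= e.
    rewrite -ler_pdivlMr// -[leRHS]sqr_sqrtr ?divr_ge0// ?(ltW e0) ?(ltW C1)//.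
    by rewrite ler_pXn2r ?nnegrE ?sqrtr_ge0 ?(ltW h0)// ge_min lexx orbT.
  have := sqr_ge0 h; lra.
have Gx0 : G x0 by split => //; rewrite subrr enorm0 ltW.
have gG x : G x -> g x <= B + e * b ^+ 2.
  move=> [Dx xb]; rewrite lerD ?vB// ler_pM2l//.
  by rewrite ler_pXn2r ?nnegrE ?enorm_ge0 ?(ltW b0).
have supG : has_sup (g @` G).
  split; first by exists (g x0); exists x0.
  by exists (B + e * b ^+ 2) => _ [x Gx <-]; exact: gG.
have gsup x : G x -> g x <= sup (g @` G).
  by move=> Gx; apply: (sup_upper_bound supG); exists x.
(* An approximate maximum replaces a maximum, as [v] is not assumed continuous. At [z] the second
   differences of [g] sum to at most [2 n theta], while the quadratic contributes [2 n e h^2] and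
   the error is at most [e h^2]; hence the bound [e h^2 / 4]. *)
pose theta := Num.min (e * h ^+ 2 / 4) ((v x0 - M) / 4).
have h2 : 0 < h ^+ 2 by rewrite exprn_gt0.
have eh : 0 < e * h ^+ 2 by rewrite mulr_gt0.
have theta0 : 0 < theta by rewrite lt_min; apply/andP; split; lra.
have [_ [z [Dz zb] <-] gz] := sup_adherent theta0 supG.
have gx0 : v x0 <= sup (g @` G).
  by have := gsup _ Gx0; rewrite /g subrr enorm0 expr0n/= mulr0 addr0.
have t1 : theta <= e * h ^+ 2 / 4 by rewrite ge_min lexx.
have t2 : theta <= (v x0 - M) / 4 by rewrite ge_min lexx orbT.
have vz : M < v z.
  have : e * enorm (z - x0) ^+ 2 <= e * b ^+ 2.
    by rewrite ler_pM2l// ler_pXn2r ?nnegrE ?enorm_ge0 ?(ltW b0).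
  by move: gz; rewrite /g eb; lra.
have D'z : D' z.
  by apply: contrapT => nD; have := bd _ Dz nD; lra.
have zr : enorm (z - x0) < r.
  by rewrite ltNge; apply/negP => /(far _ Dz); lra.
have near s i : `|s| = 1 -> G (z + (s * h) *: delta_mx 0 i).
  move=> s1.
  have H : enorm (z + (s * h) *: delta_mx 0 i - z) <= d.
    rewrite addrC addKr enormZ normrM s1 mul1r ger0_norm ?(ltW h0)//.
    by rewrite enorm_delta mulr1 ltW.
  split; first by apply: (D'D z) => //; rewrite enormB.
  apply: le_trans (enorm_triangle z _ _) _.
  rewrite addrC lerD//; apply: ltW; apply: lt_le_trans zr _.
  by rewrite le_max lexx.
have nearp i : g (z + h *: delta_mx 0 i) <= g z + theta.
  have := gsup _ (near 1 i (normr1 _)); rewrite mul1r; move: gz; lra.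
have nearm i : g (z - h *: delta_mx 0 i) <= g z + theta.
  have := gsup _ (near (-1) i (normrN1 _)); rewrite mulN1r scaleNr; move: gz; lra.
have par i : enorm (z + h *: delta_mx 0 i - x0) ^+ 2 + enorm (z - h *: delta_mx 0 i - x0) ^+ 2
    = 2 * enorm (z - x0) ^+ 2 + 2 * h ^+ 2.
  have -> : z + h *: delta_mx 0 i - x0 = (z - x0) + h *: delta_mx 0 i by rewrite addrAC.
  have -> : z - h *: delta_mx 0 i - x0 = (z - x0) + (- h) *: delta_mx 0 i.
    by rewrite addrAC scaleNr.
  by rewrite !sqr_enorm !dotv_step; ring.
have : \sum_(i < n) (v (z + h *: delta_mx 0 i) + v (z - h *: delta_mx 0 i)) <=
    \sum_(i < n) (2 * v z + 2 * theta - 2 * e * h ^+ 2).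
  apply: ler_sum => i _; have := par i; have := nearp i; have := nearm i; rewrite /g.
  set a1 := enorm _ ^+ 2; set a2 := enorm _ ^+ 2; set a3 := enorm _ ^+ 2.
  move=> H1 H2 H3.
  have : e * (a3 + a1) = e * (2 * a2 + 2 * h ^+ 2) by rewrite H3.
  lra.
rewrite sumr_const card_ord -(mulr_natl _ n).
have := mean z h D'z h0 hd.
have C4 : C * h ^+ 4 <= e * h ^+ 2.
  have -> : C * h ^+ 4 = C * h ^+ 2 * h ^+ 2 by ring.
  apply: ler_wpM2r he; exact: ltW.
have : n%:R * (2 * theta - 2 * e * h ^+ 2) <= 1 * (2 * theta - 2 * e * h ^+ 2).
  rewrite ler_wnM2r//.
  lra.
lra.
Qed.

(** * Potential of the restriction to a set, and its discrete Laplacian *)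

Section potential_on.
Context {R : realType} {n : nat}.
Local Notation T := (borelRn R n).
Variable lambda : R.
Hypothesis lambda_gt0 : 0 < lambda.
Local Notation k := (@riesz R n lambda).
Local Notation p := (lambda / 2).
Variable P : probability T R.
Implicit Types (F : set T) (x y : 'rV[R]_n) (d h s : R).

Definition potential_on F x : \bar R := (\int[P]_(y in F) k x y)%E.

Let mk x F : measurable_fun F (fun y : T => k x y).
Proof. by apply: measurable_funTS; exact: measurable_riesz1. Qed.

Lemma potential_on_ge0 F x : (0 <= potential_on F x)%E.
Proof. by apply: integral_ge0 => y _; exact: riesz_ge0. Qed.

Lemma potential_onS (F G : set T) x : measurable F -> measurable G -> F `<=` G ->
  (potential_on F x <= potential_on G x)%E.
Proof.
by move=> mF mG FG; apply: ge0_subset_integral => // y _; exact: riesz_ge0.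
Qed.

Lemma potential_on_le_potential F x : measurable F ->
  (potential_on F x <= potential lambda P x)%E.
Proof. by move=> mF; exact: potential_onS. Qed.

Lemma potential_on_far F x d : measurable F -> 0 < d ->
  (forall y, F y -> d <= enorm (x - y)) ->
  (potential_on F x <= (d `^ (- lambda))%:E * P F)%E.
Proof.
move=> mF d0 far; rewrite -integral_cst//.
apply: ge0_le_integral => //.
- by move=> y _; exact: riesz_ge0.
- by move=> y Fy; apply: riesz_far => //; exact: far.
Qed.

Lemma potential_on_far1 F x d : measurable F -> 0 < d ->
  (forall y, F y -> d <= enorm (x - y)) ->
  (potential_on F x <= (d `^ (- lambda))%:E)%E.
Proof.
move=> mF d0 far; apply: le_trans (potential_on_far mF d0 far) _.
by rewrite -[leRHS]mule1 lee_pmul ?lee_fin ?powR_ge0// probability_le1.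
Qed.

Lemma potential_on_fin F x d : measurable F -> 0 < d ->
  (forall y, F y -> d <= enorm (x - y)) -> potential_on F x \is a fin_num.
Proof.
move=> mF d0 far; rewrite ge0_fin_numE ?potential_on_ge0//.
by apply: le_lt_trans (potential_on_far1 mF d0 far) _; rewrite ltry.
Qed.

Lemma potential_on_dist F x x' (A : R) : measurable F -> 0 < A ->
  (forall y, F y -> enorm (x - y) <= A * enorm (x' - y)) ->
  (potential_on F x' <= (A `^ lambda)%:E * potential_on F x)%E.
Proof.
move=> mF A0 H; rewrite /potential_on -ge0_integralZl//; last 2 first.
- by move=> y _; exact: riesz_ge0.
- by rewrite lee_fin powR_ge0.
apply: ge0_le_integral => //.
- by move=> y _; exact: riesz_ge0.
- by apply: measurable_funeM; exact: mk.
by move=> y sy; apply: riesz_le => //; exact: H.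
Qed.

Lemma riesz_dotv x y : x != y -> k x y = (dotv (x - y) (x - y) `^ (- p))%:E.
Proof.
move=> xy; rewrite /riesz (negPf xy); congr EFin.
rewrite -sqr_enorm -powR_mulrn ?enorm_ge0// -powRrM; congr (_ `^ _).
by field.
Qed.

(* [s] bounds below the exact Laplacian of the kernel on [F]. *)
Lemma potential_on_laplacian F x h d s : n%:R <= lambda + 2 ->
  measurable F -> 0 < h -> h < d -> 0 <= s ->
  (forall y, F y -> d <= enorm (x - y)) ->
  (forall y, F y -> s <= lambda * (lambda + 2 - n%:R) * dotv (x - y) (x - y) `^ (- p - 1)) ->
  2 * n%:R * fine (potential_on F x) + h ^+ 2 * s * fine (P F)
    - 4 * p * (p + 1) * (p + 2) * d `^ (- (2 * p + 4)) * h ^+ 4 <=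
  \sum_i (fine (potential_on F (x + h *: delta_mx 0 i)) +
          fine (potential_on F (x - h *: delta_mx 0 i))).
Proof.
move=> np mF h0 hd s0 far sF.
have dh : 0 < d - h by lra.
have d0 : 0 < d by lra.
have p0 : 0 < p by rewrite divr_gt0.
have farh (t : R) i : `|t| = h -> forall y, F y -> d - h <= enorm (x + t *: delta_mx 0 i - y).
  move=> th y Fy; have := far y Fy; have := enorm_triangle (x + t *: delta_mx 0 i) x y.
  have -> : x - (x + t *: delta_mx 0 i) = - (t *: delta_mx 0 i) by rewrite opprD addNKr.
  by rewrite enormN enormZ enorm_delta mulr1 th; lra.
have nh : `|h| = h by rewrite ger0_norm// ltW.
have nNh : `|- h| = h by rewrite normrN.
set C := 4 * p * _ * _ * _; have C0 : 0 <= C * h ^+ 4.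
  have p1 : 0 <= p + 1 by lra.
  have p2 : 0 <= p + 2 by lra.
  by rewrite !mulr_ge0 ?powR_ge0 ?exprn_ge0 ?(ltW p0) ?(ltW h0) ?(ltW lambda_gt0).
have [v vE] : exists v, potential_on F x = v%:E.
  by exists (fine (potential_on F x)); rewrite (fineK (potential_on_fin mF d0 far)).
have [a aE] : exists a, forall i : 'I_n, potential_on F (x + h *: delta_mx 0 i) = (a i)%:E.
  exists (fun i => fine (potential_on F (x + h *: delta_mx 0 i))) => i.
  by rewrite (fineK (potential_on_fin mF dh (farh h i nh))).
have [b bE] : exists b, forall i : 'I_n, potential_on F (x - h *: delta_mx 0 i) = (b i)%:E.
  exists (fun i => fine (potential_on F (x - h *: delta_mx 0 i))) => i.
  by rewrite -scaleNr (fineK (potential_on_fin mF dh (farh (- h) i nNh))).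
have [m mE] : exists m, P F = m%:E.
  by exists (fine (P F)); rewrite fineK// fin_num_measure.
rewrite vE mE (eq_bigr (fun i => a i + b i)); last by move=> i _; rewrite aE bE.
(* The error term changes sides so that all the integrands below are non-negative extended reals. *)
rewrite [fine _]/= [fine m%:E]/= lerBlDr -lee_fin.
have n2 : (0 <= (2 * n%:R)%:E :> \bar R)%E by rewrite lee_fin mulr_ge0.
have hs : (0 <= (h ^+ 2 * s)%:E)%E by rewrite lee_fin mulr_ge0// sqr_ge0.
have k0 := @riesz_ge0 R n lambda.
have -> : (2 * n%:R * v + h ^+ 2 * s * m)%:E =
    (\int[P]_(y in F) ((2 * n%:R)%:E * k x y + (h ^+ 2 * s)%:E))%E.
  rewrite ge0_integralD//; last 2 first.
  - by move=> y _; rewrite mule_ge0.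
  - by apply: measurable_funeM; exact: mk.
  by rewrite ge0_integralZl// integral_cst// EFinD !(EFinM (_ * _)) -vE -mE.
have [S SE] : exists S : T -> \bar R, forall y : T, S y = (\sum_(i < n)
    (k (x + h *: delta_mx 0 i)%R y + k (x - h *: delta_mx 0 i)%R y)%E)%R by eexists.
have S0 y : (0 <= S y)%E by rewrite SE sume_ge0// => i _; rewrite adde_ge0.
have mS : measurable_fun F S.
  rewrite (funext SE).
  by apply: emeasurable_sum => i; apply: emeasurable_funD.
rewrite EFinD.
have -> : (\sum_i (a i + b i))%:E =
    (\int[P]_(y in F) S y)%E.
  rewrite (funext SE) ge0_integral_sum//; last 2 first.
  - by move=> i; apply: emeasurable_funD.
  - by move=> i y _; rewrite adde_ge0.
  rewrite -sumEFin; apply: eq_bigr => i _; rewrite ge0_integralD//.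
  by rewrite EFinD -aE -bE.
apply: (@le_trans _ _ (\int[P]_(y in F) (S y + (C * h ^+ 4)%:E))%E).
  apply: ge0_le_integral => //.
  - by move=> y _; rewrite adde_ge0// mule_ge0.
  - by apply: emeasurable_funD => //; apply: measurable_funeM; exact: mk.
  - by apply: emeasurable_funD.
  move=> y Fy.
  have neq z : 0 < enorm (z - y) -> z != y by rewrite enorm_gt0 subr_eq0.
  have xy : x != y by apply: neq; apply: lt_le_trans (far y Fy).
  have xh i : x + h *: delta_mx 0 i != y.
    by apply: neq; apply: lt_le_trans (farh h i nh y Fy).
  have xNh i : x - h *: delta_mx 0 i != y.
    by rewrite -scaleNr; apply: neq; apply: lt_le_trans (farh (- h) i nNh y Fy).
  rewrite SE (eq_bigr (fun i => (dotv (x + h *: delta_mx 0 i - y) (x + h *: delta_mx 0 i - y) `^ (- p)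
    + dotv (x - h *: delta_mx 0 i - y) (x - h *: delta_mx 0 i - y) `^ (- p))%:E)); last first.
    by move=> i _; rewrite (riesz_dotv (xh i)) (riesz_dotv (xNh i)).
  rewrite (riesz_dotv xy) sumEFin -EFinM -!EFinD lee_fin -lerBlDr.
  have dq : d ^+ 2 <= dotv (x - y) (x - y).
    by rewrite -le_enorm ?(ltW d0)// far.
  have qE : dotv (x - y) (x - y) = \sum_i (x - y) 0 i ^+ 2.
    by apply: eq_bigr => i _; rewrite expr2.
  have np' : n%:R <= 2 * p + 2 by lra.
  have := powR_laplacian p0 np' qE h0 hd dq.
  have -> : 2 * p = lambda by field.
  move=> L; apply: le_trans; last apply: le_trans L _.
    have := sF y Fy; set D := d `^ _; set Q' := _ `^ (- p - 1).
    rewrite /C; have -> : 2 * p = lambda by field.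
    rewrite -/D => H.
    have : h ^+ 2 * s <= h ^+ 2 * (lambda * (lambda + 2 - n%:R) * Q').
      by rewrite ler_wpM2l ?sqr_ge0.
    lra.
  apply: ler_sum => i _.
  have -> : x + h *: delta_mx 0 i - y = (x - y) + h *: delta_mx 0 i by rewrite addrAC.
  have -> : x - h *: delta_mx 0 i - y = (x - y) + (- h) *: delta_mx 0 i.
    by rewrite addrAC scaleNr.
  by rewrite !dotv_step sqrrN mulrN mulNr.
rewrite ge0_integralD// leeD2l// integral_cst//.
by rewrite -[leRHS]mule1 lee_pmul ?lee_fin// probability_le1.
Qed.

End potential_on.

(** * The contribution of a small ball to the potential at its centre *)

Section near_potential.
Context {R : realType} {n : nat}.
Local Notation T := (borelRn R n).
Variable lambda : R.
Hypothesis lambda_gt0 : 0 < lambda.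
Local Notation k := (@riesz R n lambda).
Variable P : probability T R.

Definition eball (x : 'rV[R]_n) (d : R) : set T := [set y : T | enorm (x - y) < d].

Definition near_potential (d : R) (x : 'rV[R]_n) : \bar R :=
  potential_on lambda P (eball x d) x.

Lemma measurable_enormB1 (x : 'rV[R]_n) :
  measurable_fun setT (fun y : T => enorm (x - (y : 'rV[R]_n))).
Proof. exact: (@measurable_enormB R n _ T (fun=> x : T) (fun y => y)). Qed.

Lemma measurable_eball x d : measurable (eball x d).
Proof.
rewrite -[X in measurable X]setTI.
exact: (measurable_fun_ltr (measurable_enormB1 x) (measurable_cst d) measurableT).
Qed.

Lemma potential_on_setC (F : set T) x : measurable F ->
  (potential_on lambda P F x + potential_on lambda P (~` F) x = potential lambda P x)%E.
Proof.
move=> mF; have mF' := measurableC mF.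
rewrite /potential_on -ge0_integral_setU//.
- by rewrite setUv.
- by rewrite setUv; exact: measurable_riesz1.
- by move=> y _; exact: riesz_ge0.
- by apply/disj_set2P; rewrite setICr.
Qed.

Lemma potential_onID (F G : set T) x : measurable F -> measurable G ->
  potential_on lambda P F x =
  (potential_on lambda P (F `&` G) x + potential_on lambda P (F `\` G) x)%E.
Proof.
move=> mF mG; rewrite /potential_on -ge0_integral_setU ?setUIDK//.
- exact: measurableI.
- exact: measurableD.
- by apply: measurable_funTS; exact: measurable_riesz1.
- by move=> y _; exact: riesz_ge0.
- by apply/disj_set2P; rewrite setDE setIACA setICr setI0.
Qed.

Lemma measurable_near_potential d : measurable_fun setT (near_potential d : T -> \bar R).
Proof.
pose f (q : T * T) : \bar R := if enorm ((q.1 : 'rV[R]_n) - q.2) < d then k q.1 q.2 else 0%E.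
have mf : measurable_fun setT f.
  apply: measurable_fun_ifT.
  - apply: measurable_fun_ltr => //.
    exact: (measurable_enormB measurable_fst measurable_snd).
  - exact: measurable_riesz_pair.
  - exact: measurable_cst.
have f0 q : (0 <= f q)%E by rewrite /f; case: ifP => // _; exact: riesz_ge0.
have := measurable_fun_fubini_tonelli_F (m2 := P) _ mf f0.
congr (measurable_fun _ _); apply/funext => x.
rewrite /near_potential /potential_on integral_mkcond /fubini_F.
apply: eq_integral => y _; rewrite /f patchE.
by have -> : (y \in eball x d) = (enorm (x - (y : 'rV[R]_n)) < d) by apply/idP/idP; rewrite inE.
Qed.

(** A finite potential excludes an atom at [x], whose contribution would be infinite. By monotone
    convergence the complements of small balls about [x] then exhaust the potential. *)
Lemma ex_near_potential_le x (e : R) : (potential lambda P x < +oo)%E -> 0 < e ->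
  exists j : nat, (near_potential j.+1%:R^-1 x <= e%:E)%E.
Proof.
move=> Ufin e0.
have k0 := @riesz_ge0 R n lambda.
have mk := measurable_riesz1 lambda x.
have mx : measurable ([set x] : set T).
  by apply: borel_closed; apply: compact_closed => //; exact: compact_set1.
have k1 : potential_on lambda P [set x] x = 0%E.
  have E1 : potential_on lambda P [set x] x = (+oo * P [set x])%E.
    rewrite -integral_cst//; apply: eq_integral => y; rewrite inE => ->.
    by rewrite /riesz eqxx.
  have := potential_on_le_potential lambda P x mx; rewrite {}E1.
  have [->|P1] := eqVneq (P [set x]) 0%E; first by rewrite mule0.
  by rewrite gt0_mulye ?lt0e ?P1 ?measure_ge0// leye_eq => /eqP E2; rewrite E2 in Ufin.
pose G j := ~` eball x j.+1%:R^-1.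
have mG j : measurable (G j) by apply: measurableC; exact: measurable_eball.
have GE : \bigcup_j G j = ~` [set x].
  apply/seteqP; split => [y [j _]|y /eqP].
    by move=> Gy yx; apply: Gy; rewrite yx /eball/= subrr enorm0 invr_gt0.
  move=> xy; have d0 : 0 < enorm (x - y) by rewrite enorm_gt0 subr_eq0 eq_sym.
  have [j jd] := ltr_add_invr d0; exists j => //.
  by rewrite /G /eball/= => H; move: jd; rewrite add0r => jd; have := lt_trans H jd; rewrite ltxx.
have Gle : {homo G : i j / (i <= j)%N >-> (i <= j)%O}.
  move=> i j ij; apply/subsetPset; apply: subsetC => y; rewrite /eball/= => H.
  by apply: lt_le_trans H _; rewrite lef_pV2 ?posrE// ler_nat.
have mkG j : measurable_fun (G j) (fun y : T => k x y) by exact: measurable_funTS.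
have cvgG := ge0_nondecreasing_set_cvg_integral (mu := P) Gle mG mkG (fun j y _ => k0 x y).
have UE : potential lambda P x = (\int[P]_(y in \bigcup_j G j) k x y)%E.
  by rewrite GE -(potential_on_setC x mx) k1 add0e.
have Ur : potential lambda P x \is a fin_num by rewrite ge0_fin_numE// potential_ge0.
apply: contrapT => /forallNP H.
have : (potential lambda P x <= potential lambda P x - e%:E)%E.
  rewrite {1}UE; apply: cvge_le cvgG; apply: nearW => j.
  have /negP := H j; rewrite -ltNge => ej.
  have := potential_on_setC x (measurable_eball x j.+1%:R^-1).
  rewrite -/(near_potential _ _) -/(G j) => <-.
  rewrite leeBrDr//.
  by rewrite addeC leeD2r// ltW.
by rewrite -(fineK Ur) -EFinB lee_fin; lra.
Qed.

End near_potential.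

(** * The support of a minimizer for [lambda >= n - 2] *)

Section support.
Context {R : realType} {n : nat}.
Local Notation T := (borelRn R n).
Variable lambda : R.
Hypothesis n_gt0 : (0 < n)%N.
Hypothesis lambda_gt0 : 0 < lambda.
Hypothesis lambda_ltn : lambda < n%:R.
Variable mu : probability T R.
Hypothesis mu_min : minimizes_energy lambda mu.
Variable W : set 'rV[R]_n.
Hypothesis W_complete : unit_complete W.
Hypothesis supp_W : supp mu `<=` W.
Local Notation k := (@riesz R n lambda).
Local Notation U := (potential lambda mu).
Local Notation E := (min_energy lambda mu).

(* [U] need not be continuous, but off a set of small measure the part of the
   potential that comes from a small ball about [x] is uniformly small. *)
Lemma ex_good_set (e h : R) : 0 < e -> 0 < h -> exists (F : set T) (d : R),
  [/\ measurable F, F `<=` supp mu, 0 < d, (mu (~` F) <= h%:E)%E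
    & forall x, F x -> (U x <= (E + e)%:E /\ near_potential lambda mu d x <= e%:E)%E].
Proof.
move=> e0 h0.
pose G := [set x : T | ((E + e)%:E < U x)%E].
have mU : measurable_fun setT (U : T -> \bar R) by exact: measurable_potential.
have mG : measurable G.
  by rewrite -[X in measurable X]setTI; exact: emeasurable_fun_o_infty.
have mS : measurable (supp mu : set T) by exact: measurable_supp.
pose B j := [set x : T | (near_potential lambda mu j.+1%:R^-1 x <= e%:E)%E].
have mB j : measurable (B j).
  rewrite -[X in measurable X]setTI; apply: emeasurable_fun_infty_c => //.
  exact: measurable_near_potential.
pose F j : set T := supp mu `&` ~` G `&` B j.
have mF j : measurable (F j).
  by apply: measurableI; [apply: measurableI => //; exact: measurableC|].
have Fle i j : (i <= j)%N -> F i `<=` F j.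
  move=> ij x [SG Bx]; split => //; apply: le_trans Bx.
  apply: potential_onS; try exact: measurable_eball.
  move=> y; rewrite /eball/= => H; apply: lt_le_trans H _.
  by rewrite lef_pV2 ?posrE// ler_nat.
have mCF j : measurable (~` F j) by exact: measurableC.
have mcap : measurable (\bigcap_j ~` F j) by exact: bigcapT_measurable.
(* A point of [supp mu] off [G] has finite potential, hence lies in some [B j]. So the intersection
   consists of points of [G] or off [supp mu], both null. *)
have cap0 : mu (\bigcap_j ~` F j) = 0%E.
  pose SG : set T := ~` (supp mu : set T) `|` G.
  have mSG : measurable SG by apply: measurableU => //; exact: measurableC.
  apply/eqP; rewrite eq_le measure_ge0 andbT.
  apply: (@le_trans _ _ (mu SG)).
    apply: le_measure; rewrite ?inE// => x capx.
    apply: contrapT => /not_orP[/contrapT Sx nGx].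
    have Ux : (U x < +oo)%E.
      apply: (@le_lt_trans _ _ (E + e)%:E); last exact: ltry.
      by rewrite leNgt; apply/negP.
    have [j Bx] := ex_near_potential_le Ux e0.
    by apply: (capx j I).
  have G0 : mu G = 0%E by exact: (mu_potential_gt n_gt0 lambda_gt0 lambda_ltn mu_min W_complete supp_W e0).
  have S0 : mu (~` (supp mu : set T)) = 0%E by exact: supp_setC.
  have H : (mu SG <= mu (~` (supp mu : set T)) + mu G)%E := measureU2 mu (measurableC mS) mG.
  by apply: le_trans H _; rewrite S0 add0e G0.
have fin0 : (mu (~` F 0%N) < +oo)%E by rewrite -ge0_fin_numE ?measure_ge0// fin_num_measure.
have CFle : {homo (fun j => ~` F j) : i j / (i <= j)%N >-> (j <= i)%O}.
  by move=> i j ij; apply/subsetPset; apply: subsetC; exact: Fle.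
have cvgF := nonincreasing_cvg_mu fin0 mCF mcap CFle.
have [j Fj] : exists j, (mu (~` F j) <= h%:E)%E.
  apply: contrapT => /forallNP H.
  have : (h%:E <= mu (\bigcap_j ~` F j))%E.
    apply: cvge_ge cvgF; apply: nearW => j /=.
    by have /negP := H j; rewrite -ltNge => /ltW.
  by rewrite cap0 lee_fin leNgt h0.
exists (F j), j.+1%:R^-1; split => //.
- by move=> x [[]].
- by move=> x [[Sx nGx] Bx]; split => //; rewrite leNgt; apply/negP.
Qed.

(* Maximum principle for the potential of [mu] restricted to a good set [F]: close to
   [F], compare [x] with an almost nearest point of [F]. *)
Lemma potential_le_off_supp (x0 : 'rV[R]_n) (d0 : R) : n%:R <= lambda + 2 -> 0 < d0 ->
  (forall y, supp mu y -> d0 <= enorm (x0 - y)) -> (U x0 <= E%:E)%E.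
Proof.
move=> n_le d00 far0; apply/lee_addgt0Pr => e' e'0.
have E0 : 0 <= E by exact: min_energy_ge0.
have p3 : 0 <= 3 `^ lambda :> R by exact: powR_ge0.
(* Budget of errors: [3^lambda * e] for the part of [F] close to [y0] below, [2 e] for the rest of
   [F], and [e] for the part of [supp mu] off [F]. *)
have [e eE] : exists e, e = e' / (3 + 3 `^ lambda) by eexists.
have e0 : 0 < e by rewrite eE divr_gt0//; lra.
have e'E : e' = (3 + 3 `^ lambda) * e by rewrite eE; field; lra.
(* At [x0], which is at distance at least [d0] from [supp mu], a mass of at most [e d0^lambda]
   contributes at most [e]. *)
have [F [delta [mF FS delta0 muF HF]]] := ex_good_set e0 (mulr_gt0 e0 (powR_gt0 lambda d00)).
have [M ME] : exists M, M = E + (2 + 3 `^ lambda) * e by eexists.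
have Me : e <= M by rewrite ME; nra.
(* Chosen for [A^lambda * (E + e) = E + 2 e]: a loss of a factor [A] in the distances costs [e]. *)
have [q qE] : exists q, q = (E + 2 * e) / (E + e) by eexists.
have q1 : 1 < q by rewrite qE ltr_pdivlMr; lra.
have qEe : q * (E + e) = E + 2 * e by rewrite qE; field; lra.
have q0 : 0 < q by lra.
have [A AE] : exists A, A = q `^ lambda^-1 by eexists.
have A0 : 0 < A by rewrite AE powR_gt0.
have AqE : A `^ lambda = q by rewrite AE -powRrM mulVf ?gt_eqF// powRr1// ltW.
have A1 : 1 < A.
  have li : 0 < lambda^-1 by rewrite invr_gt0.
  by have := gt0_ltr_powR li (@ler01 R) (ltW q0) q1; rewrite powR1 -AE.
have Ai : A^-1 < 1 by rewrite invf_lt1.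
(* [2 d] is so small that moving by it divides distances of at least [delta] by at most [A]. *)
have [d dE] : exists d, d = Num.min d0 (delta * (1 - A^-1) / 2) by eexists.
have d_gt0 : 0 < d by rewrite dE lt_min d00 divr_gt0// mulr_gt0// subr_gt0.
have dd0 : d <= d0 by rewrite dE ge_min lexx.
have dd : 2 * d <= delta * (1 - A^-1).
  have : d <= delta * (1 - A^-1) / 2 by rewrite dE ge_min lexx orbT.
  by lra.
have mS : measurable (supp mu : set T) by exact: measurable_supp.
pose D s : set 'rV[R]_n := [set x | forall y, F y -> s <= enorm (x - y)].
have Dx0 : D d x0 by move=> y Fy; apply: le_trans dd0 (far0 _ (FS _ Fy)).
have Vfin x : D d x -> potential_on lambda mu F x \is a fin_num.
  by move=> Dx; exact: (potential_on_fin lambda_gt0 mu mF d_gt0 Dx).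
have d2 : 0 < 2 * d by rewrite mulr_gt0.
(* Here [x] is within [2 d] of [y0] but at least [d] from [F], so
   [|y0 - y| <= 2 d + |x - y| <= 3 |x - y|] on [F]: the potential of the points close to [y0] grows
   at most by [3^lambda], and that of the others at most by [A^lambda = q]. *)
have near x : D d x -> ~ D (2 * d) x -> (potential_on lambda mu F x <= M%:E)%E.
  move=> Dx /existsNP[y0 /not_implyP[Fy0 /negP]]; rewrite -ltNge => xy0.
  have [Uy0 Ny0] := HF _ Fy0.
  have mb := measurable_eball y0 delta.
  rewrite (potential_onID _ _ _ mF mb) ME.
  have -> : E + (2 + 3 `^ lambda) * e = 3 `^ lambda * e + q * (E + e) by rewrite qEe; ring.
  rewrite EFinD; apply: leeD.
    apply: le_trans (potential_on_dist (x := y0) lambda_gt0 mu (measurableI _ _ mF mb) _ _) _.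
    - exact: (@ltr0n R 3).
    - move=> y [Fy _]; have := enorm_triangle x y0 y; rewrite [enorm (y0 - x)]enormB.
      by have := Dx y Fy; lra.
    rewrite EFinM lee_pmul2l ?lte_fin ?powR_gt0//.
    apply: le_trans Ny0; apply: potential_onS => //; exact: measurableI.
  apply: le_trans (potential_on_dist (x := y0) lambda_gt0 mu (measurableD mF mb) A0 _) _.
    move=> y [Fy]; rewrite /eball/= => /negP; rewrite -leNgt => dy.
    have := enorm_triangle x y0 y; rewrite [enorm (y0 - x)]enormB => tri.
    rewrite -ler_pdivrMl//.
    have : delta * (1 - A^-1) <= enorm (y0 - y) * (1 - A^-1) by rewrite ler_wpM2r// subr_ge0 ltW.
    by lra.
  rewrite AqE EFinM lee_pmul2l ?lte_fin//.
  by apply: le_trans Uy0; apply: potential_on_le_potential; exact: measurableD.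
have [w Ww] := unit_complete_neq0 W_complete.
(* At distance [r1] or more from [F] the potential is at most [r1^(- lambda) = e <= M], the
   condition far away in the maximum principle. *)
have [r1 r1E] : exists r1, r1 = e `^ (- lambda^-1) by eexists.
have r10 : 0 < r1 by rewrite r1E powR_gt0.
have r1e : r1 `^ (- lambda) = e.
  by rewrite r1E -powRrM mulrNN mulVf ?gt_eqF// powRr1// ltW.
have V0 : fine (potential_on lambda mu F x0) <= M.
  apply: (@approx_max_principle R n (fun x => fine (potential_on lambda mu F x)) (D d) (D (2 * d))
    d (4 * (lambda / 2) * (lambda / 2 + 1) * (lambda / 2 + 2) *
      (2 * d) `^ (- (2 * (lambda / 2) + 4))) (d `^ (- lambda)) (enorm (x0 - w) + 1 + r1)) => //.
  - by rewrite !mulr_ge0 ?powR_ge0// ?addr_ge0// ?divr_ge0// ltW.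
  - move=> x y Dx xy z Fz; have := Dx z Fz; have := enorm_triangle y x z.
    by lra.
  - move=> x Dx; rewrite -lee_fin fineK ?Vfin//; exact: potential_on_far1.
  - by move=> x Dx D'x; rewrite -lee_fin fineK ?Vfin//; exact: near.
  - move=> x Dx xr; rewrite -lee_fin fineK ?Vfin//.
    apply: (@le_trans _ _ e%:E); last by rewrite lee_fin.
    rewrite -r1e; apply: potential_on_far1 => // y Fy.
    have := unit_complete_dist W_complete Ww (supp_W (FS _ Fy)).
    have := enorm_triangle y x x0; have := enorm_triangle w y x0.
    by rewrite [enorm (y - w)]enormB [enorm (w - x0)]enormB; lra.
  - move=> x h D'x h0 hd.
    have hd2 : h < 2 * d by lra.
    have := @potential_on_laplacian R n lambda lambda_gt0 mu F x h (2 * d) 0 n_le mF h0 hd2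
      (lexx 0) D'x.
    rewrite mulr0 mul0r addr0; apply=> y Fy.
    by rewrite !mulr_ge0 ?powR_ge0 ?(ltW lambda_gt0)// subr_ge0.
rewrite /potential (ge0_integral_supp mS (supp_setC mu) (measurable_riesz1 lambda x0)
  (riesz_ge0 lambda x0)) -/(potential_on lambda mu (supp mu : set T) x0).
rewrite (potential_onID _ _ _ mS mF).
have -> : (E%:E + e'%:E = M%:E + e%:E)%E by rewrite -!EFinD e'E ME; congr EFin; ring.
apply: leeD.
  apply: (@le_trans _ _ (potential_on lambda mu F x0)).
    by apply: potential_onS => //; exact: measurableI.
  by rewrite -(fineK (Vfin _ Dx0)) lee_fin.
have mD : measurable ((supp mu : set T) `\` F) by exact: measurableD.
apply: le_trans (potential_on_far lambda_gt0 mu mD d00 _) _; first by move=> y [/far0].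
apply: (@le_trans _ _ ((d0 `^ (- lambda))%:E * (e * d0 `^ lambda)%:E)%E).
  rewrite lee_pmul2l ?lte_fin ?powR_gt0//; apply: le_trans muF.
  by apply: le_measure; rewrite ?inE//; exact: measurableC.
by rewrite -EFinM powRN mulrCA mulVf ?mulr1// gt_eqF// powR_gt0.
Qed.

Lemma potential_supp x : U x = potential_on lambda mu (supp mu : set T) x.
Proof.
exact: (ge0_integral_supp (measurable_supp mu) (supp_setC mu)
  (measurable_riesz1 lambda x) (riesz_ge0 lambda x)).
Qed.

Lemma measure_supp : mu (supp mu : set T) = 1%E.
Proof.
have mS : measurable (supp mu : set T) by exact: measurable_supp.
rewrite -[RHS](probability_integral_cst mu) (ge0_integral_supp mS (supp_setC mu))//.
by rewrite integral_cst// mul1e.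
Qed.

(** The kernel is at least 1 at distances up to 1. Used for [E > 0], without which
    [E <= A^lambda * E] with [A < 1] would be no contradiction. *)
Lemma potential_ge1 x : W x -> (1 <= U x)%E.
Proof.
move=> Wx; have mS : measurable (supp mu : set T) by exact: measurable_supp.
rewrite potential_supp -measure_supp -[leLHS]mul1e -(integral_cst mu mS).
apply: ge0_le_integral => //.
- by apply: measurable_funTS; exact: measurable_riesz1.
- move=> y /supp_W Wy; rewrite /riesz; case: eqVneq => [_|xy]; first exact: leey.
  have xy0 : 0 < enorm (x - y) by rewrite enorm_gt0 subr_eq0.
  rewrite lee_fin powRN invf_ge1 ?powR_gt0//.
  have := ge0_ler_powR (ltW lambda_gt0) (ltW xy0) ler01 (unit_complete_dist W_complete Wx Wy).
  by rewrite powR1.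
Qed.

Lemma off_supp_dist x : ~ supp mu x ->
  exists2 d, 0 < d <= 1 & forall y, supp mu y -> d <= enorm (x - y).
Proof.
move=> nSx; have oS : open (~` supp mu) by rewrite openC; exact: closed_supp.
have /nbhs_enormP[e e0 He] := open_nbhs_nbhs (conj oS nSx).
 exists (Num.min e 1); first by rewrite lt_min e0 ltr01 ge_min lexx orbT.
move=> y Sy; rewrite ge_min; apply/orP; left; rewrite leNgt; apply/negP => /He.
exact.
Qed.

(* [x' = x - t (x - c)] is closer than [x] to every point of [supp mu], by the factor [A]. *)
Lemma boundary_sub_supp x : lambda = n%:R - 2 -> W x -> ~ interior W x -> supp mu x.
Proof.
move=> lambdaE Wx nWx; apply: contrapT => /off_supp_dist[d /andP[d0 d1] far].
have n_le : n%:R <= lambda + 2 by lra.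
have [c Wc xc] := unit_complete_boundary W_complete Wx nWx.
(* Let [q = |x - y|^2] and [b = (x - y).(x - c)]. From [|c - y| <= 1 = |x - c|] follows [2 b >= q],
   so [|x' - y|^2 = q - 2 t b + t^2 <= (1 - t) q + t^2]; and [t^2 = t d^2 / 2 <= t q / 2], whence
   the factor [A^2 = 1 - t / 2]. *)
pose t := d ^+ 2 / 2.
have [x' x'E] : exists x', x' = x - t *: (x - c) by eexists.
have dd : d ^+ 2 <= d by rewrite expr2; nra.
have d20 : 0 < d ^+ 2 by rewrite exprn_gt0.
have t0 : 0 < t by rewrite /t; lra.
have [A AE] : exists A, A = Num.sqrt (1 - t / 2) by eexists.
have A2 : A ^+ 2 = 1 - t / 2 by rewrite AE sqr_sqrtr// /t; lra.
have A0 : 0 < A by rewrite AE sqrtr_gt0 /t; lra.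
have Adist y : supp mu y -> enorm (x' - y) <= A * enorm (x - y).
  move=> Sy; rewrite enorm_le ?mulr_ge0 ?enorm_ge0 ?(ltW A0)// exprMn A2 sqr_enorm.
  have := unit_complete_dist W_complete Wc (supp_W Sy).
  rewrite enorm_le// expr1n => cy.
  have cc : dotv (x - c) (x - c) = 1 by rewrite -sqr_enorm xc expr1n.
  have dq : d ^+ 2 <= dotv (x - y) (x - y) by rewrite -le_enorm ?(ltW d0)// far.
  have E1 : c - y = (x - y) - (x - c) by apply/rowP => i; rewrite !mxE; ring.
  have E2 : x' - y = (x - y) - t *: (x - c) by apply/rowP => i; rewrite x'E !mxE; ring.
  have sqB (u v : 'rV[R]_n) : dotv (u - v) (u - v) = dotv u u - 2 * dotv u v + dotv v v.
    by rewrite !dotvE [dotv v u]dotvC; ring.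
  move: cy; rewrite E1 E2 (sqB (x - y) (x - c)) (sqB (x - y) (t *: _)) !dotvZr dotvZl cc.
  set q := dotv (x - y) (x - y) in dq *; set b := dotv (x - y) (x - c).
  have : t * (d ^+ 2) <= t * q by rewrite ler_pM2l.
  have -> : t * (d ^+ 2) = 2 * (t * t) by rewrite /t; field.
  move=> H1 H2; have H3 : t * q <= t * (2 * b) by rewrite ler_pM2l//; lra.
  by lra.
have far' y : supp mu y -> d / 2 <= enorm (x' - y).
  move=> Sy; have := far y Sy; have := enorm_triangle x' x y.
  have -> : x - x' = t *: (x - c) by rewrite x'E opprB addrC subrK.
  by rewrite enormZ xc mulr1 ger0_norm ?(ltW t0)// /t; lra.
have d20' : 0 < d / 2 by rewrite divr_gt0.
have Ux' := potential_le_off_supp n_le d20' far'.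
have Ux := potential_ge_off_supp n_gt0 lambda_gt0 lambda_ltn mu_min W_complete supp_W d0 Wx far.
have UA := potential_le_of_dist lambda_gt0 A0 Adist.
have AU : (U x <= (A `^ lambda * E)%:E)%E.
  by apply: le_trans UA _; rewrite EFinM lee_pmul2l// lte_fin powR_gt0.
have := le_trans (potential_ge1 Wx) AU; have := le_trans Ux AU; rewrite !lee_fin => H1 H2.
have E0 : 0 < E by rewrite -(pmulr_rgt0 _ (powR_gt0 lambda A0)); apply: lt_le_trans H2.
have A1 : A `^ lambda < 1.
  have AA : A < 1.
    rewrite -(@ltr_pXn2r _ 2) ?nnegrE ?(ltW A0)// expr1n A2.
    by lra.
  by have := gt0_ltr_powR lambda_gt0 (ltW A0) ler01 AA; rewrite powR1.
by move: H1; rewrite leNgt gtr_pMl ?A1.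
Qed.

(** At a point of [W] off the support [U >= E], while its [2 n] neighbours have [U <= E]; the
    neighbours may leave [W], as the upper bound holds anywhere off [supp mu]. So the second
    difference is at most 0, against a lower bound of [s h^2 - C h^4]. *)
Lemma supp_eq : n%:R - 2 < lambda -> supp mu = W.
Proof.
move=> n_lt; apply/seteqP; split => // x Wx.
apply: contrapT => /off_supp_dist[d /andP[d0 d1] far].
have n_le : n%:R <= lambda + 2 by lra.
have mS : measurable (supp mu : set T) by exact: measurable_supp.
(* The Laplacian of the kernel is [s |x - y|^(- lambda - 2)], at least [s] because
   [|x - y| <= 1]. *)
have [s sE] : exists s, s = lambda * (lambda + 2 - n%:R) by eexists.
have s0 : 0 < s by rewrite sE mulr_gt0//; lra.
have [C CE] : exists C, C = 4 * (lambda / 2) * (lambda / 2 + 1) * (lambda / 2 + 2) *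
  d `^ (- (2 * (lambda / 2) + 4)) by eexists.
have C0 : 0 <= C.
  by rewrite CE !mulr_ge0 ?powR_ge0// ?addr_ge0// ?divr_ge0// ltW.
have sC : 0 < s / (C + 1) by rewrite divr_gt0//; lra.
(* [d / 2] keeps the neighbours at distance at least [d / 2] from [supp mu]; the square root gives
   [h^2 (C + 1) <= s], hence [C h^4 < s h^2]. *)
have [h hE] : exists h, h = Num.min (d / 2) (Num.sqrt (s / (C + 1))) by eexists.
have h0 : 0 < h by rewrite hE lt_min divr_gt0//= sqrtr_gt0.
have hd2 : h <= d / 2 by rewrite hE ge_min lexx.
have hd : h < d by lra.
have hs : h ^+ 2 * (C + 1) <= s.
  rewrite -ler_pdivlMr; last by lra.
  rewrite -[leRHS]sqr_sqrtr ?(ltW sC)//.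
  by rewrite ler_pXn2r ?nnegrE ?sqrtr_ge0 ?(ltW h0)// hE ge_min lexx orbT.
have q1 y : supp mu y -> s <= s * dotv (x - y) (x - y) `^ (- (lambda / 2) - 1).
  move=> Sy; rewrite ler_peMr ?(ltW s0)//.
  have q0 : 0 < dotv (x - y) (x - y).
    by rewrite -sqr_enorm exprn_gt0//; apply: lt_le_trans (far y Sy).
  have q1 : dotv (x - y) (x - y) <= 1.
    by have := unit_complete_dist W_complete Wx (supp_W Sy); rewrite enorm_le// expr1n.
  have l0 : 0 < lambda / 2 + 1 by rewrite addr_gt0// divr_gt0.
  rewrite -opprD powRN invf_ge1 ?powR_gt0//.
  by have := ge0_ler_powR (ltW l0) (ltW q0) ler01 q1; rewrite powR1.
rewrite sE in q1.
have := potential_on_laplacian lambda_gt0 mu n_le mS h0 hd (ltW s0) far.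
rewrite {1}sE => /(_ q1).
rewrite measure_supp [fine 1]/= mulr1 -CE -potential_supp.
have Ux := potential_ge_off_supp n_gt0 lambda_gt0 lambda_ltn mu_min W_complete supp_W d0 Wx far.
have Ufin : U x \is a fin_num.
  by rewrite potential_supp; exact: (potential_on_fin lambda_gt0 mu mS d0 far).
rewrite -(fineK Ufin) lee_fin in Ux.
have d20 : 0 < d / 2 by rewrite divr_gt0.
have Uh (a : R) i : `|a| = h ->
    fine (potential_on lambda mu (supp mu : set T) (x + a *: delta_mx 0 i)) <= E.
  move=> ah; have far' y : supp mu y -> d / 2 <= enorm (x + a *: delta_mx 0 i - y).
    move=> Sy; have := far y Sy; have := enorm_triangle (x + a *: delta_mx 0 i) x y.
    have -> : x - (x + a *: delta_mx 0 i) = - (a *: delta_mx 0 i) by rewrite opprD addNKr.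
    by rewrite enormN enormZ enorm_delta mulr1 ah; lra.
  rewrite -lee_fin fineK; last exact: (potential_on_fin lambda_gt0 mu mS d20 far').
  rewrite -potential_supp.
  exact: (potential_le_off_supp n_le d20 far').
have nh : `|h| = h by rewrite ger0_norm// ltW.
have nNh : `|- h| = h by rewrite normrN.
set S := \sum_i _.
have : S <= \sum_(i < n) (E + E).
  apply: ler_sum => i _; apply: lerD; first exact: (Uh h i nh).
  by have := Uh (- h) i nNh; rewrite scaleNr; apply.
rewrite sumr_const card_ord -(mulr_natl _ n).
have h20 : 0 < h ^+ 2 by rewrite exprn_gt0.
have : n%:R * E <= n%:R * fine (U x) by rewrite ler_wpM2l.
have : h ^+ 2 * (h ^+ 2 * (C + 1)) <= h ^+ 2 * s by rewrite ler_pM2l.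
have -> : h ^+ 4 = h ^+ 2 * h ^+ 2 by rewrite -exprD.
have : 0 < h ^+ 2 * h ^+ 2 by rewrite mulr_gt0.
lra.
Qed.

End support.

Theorem theorem3 (R : realType) (n : nat) (lambda : R)
    (mu : probability (borelRn R n) R) :
  (3 <= n)%N -> 0 < lambda -> lambda < n%:R ->
  minimizes_energy lambda mu ->
  exists W : set 'rV[R]_n,
    [/\ convex_body W,
        constant_width 1 W,
        lambda < n%:R - 2 -> supp mu `<=` boundary W,
        lambda = n%:R - 2 -> supp mu = boundary W
      & n%:R - 2 < lambda -> supp mu = W].
Proof.
move=> n3 lambda_gt0 lambda_ltn mu_min.
have n_gt0 : (0 < n)%N by apply: leq_trans n3.
have [/diam_le1P supp1 _] := minimizer_finite lambda_gt0 lambda_ltn n_gt0 mu_min.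
have [W supp_W W_complete] := ex_unit_complete supp1.
have sub_boundary : lambda <= n%:R - 2 -> supp mu `<=` boundary W.
  move=> lambda_le x Sx; split; first by apply: subset_closure; exact: supp_W.
  exact: (supp_not_interior n_gt0 lambda_gt0 lambda_ltn lambda_le mu_min W_complete supp_W).
exists W; split.
- exact: unit_complete_body.
- exact: unit_complete_width.
- by move=> /ltW.
- move=> lambdaE; apply/seteqP; split; first by apply: sub_boundary; rewrite lambdaE.
  move=> x [clWx nWx].
  apply: (boundary_sub_supp n_gt0 lambda_gt0 lambda_ltn mu_min W_complete supp_W lambdaE) => //.
  exact: (unit_complete_closed W_complete).
- exact: (supp_eq n_gt0 lambda_gt0 lambda_ltn mu_min W_complete supp_W).
Qed.
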